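(* Let $E$ be the total space of a non-orientable $n$-disc bundle over $\mathbb{S}^1$, equipped with a locally flat metric. Then $E$ admits at least one codimension one foliation by minimal submanifolds.
   Context: A locally flat metric is a Riemannian metric locally isometric to Euclidean space $\mathbb{R}^{n+1}$. No boundary condition is imposed on the foliation: there is no requirement on how the leaves meet $\partial E$. Minimal submanifold means a submanifold with zero mean curvature (a stationary point of volume). *)

(* Defs.v *)
From HB Require Import structures.
From mathcomp Require Import all_boot all_order all_algebra.
From mathcomp Require Import all_classical all_reals all_analysis.

Set Implicit Arguments.
Unset Strict Implicit.
Unset Printing Implicit Defensive.

Import Order.TTheory GRing.Theory Num.Theory.
Import numFieldNormedType.Exports.

Local Open Scope classical_set_scope.
Local Open Scope ring_scope.

(* Points and tangent vectors of R^m are row vectors; the norm carried by 'rV_m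
   in the library is the sup norm, and is only used for the topology and for
   first-order expansions.  Euclidean geometry uses [inner 1%:M]. *)

Section Calculus.
Variable R : realType.

(* C^k on an open set U (the definition is only used for open U). *)
Fixpoint Ck (V W : normedModType R) (k : nat) (U : set V) (f : V -> W) : Prop :=
  if k is k'.+1 then
    (forall x, U x -> differentiable f x) /\
    (forall v, Ck k' U (fun x => 'D_v f x))
  else forall x, U x -> {for x, continuous f}.

(* Smoothness on an arbitrary subset A: f extends to a C^oo function on a
   neighbourhood of each point of A.  Values of f outside A are irrelevant. *)
Definition smooth_on (V W : normedModType R) (A : set V) (f : V -> W) : Prop :=
  forall x, A x -> exists (U : set V) (F : V -> W),
    [/\ open U, U x, (forall k, Ck k U F) &
        forall y, A y -> U y -> F y = f y].

(* First-order expansion of f at x along A.  When A is relatively open in a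
   half-space and f is smooth on A, the differential exists and is unique at
   every point of A, boundary points included. *)
Definition is_dwithin (V W : normedModType R) (A : set V) (f : V -> W) (x : V)
    (L : {linear V -> W}) : Prop :=
  continuous L /\
  forall eps : R, 0 < eps ->
    \forall y \near within A (nbhs x),
      `|f y - f x - L (y - x)| <= eps * `|y - x|.

Definition dwithin (V W : normedModType R) (A : set V) (f : V -> W) (x : V) :
    {linear V -> W} :=
  get [set L | is_dwithin A f x L].

Definition inner (m : nat) (G : 'M[R]_m) (X Y : 'rV[R]_m) : R :=
  (X *m G *m Y^T) 0 0.

Definition half_space (m : nat) : set 'rV[R]_m.+1 :=
  [set x | 0 <= x ord0 ord0].

Definition circle : set 'rV[R]_2 := [set b | inner 1%:M b b = 1].

Definition disc (n : nat) : set 'rV[R]_n := [set x | inner 1%:M x x <= 1].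

Definition open_disc (n : nat) : set 'rV[R]_n := [set x | inner 1%:M x x < 1].

End Calculus.

Arguments half_space : clear implicits.
Arguments circle : clear implicits.
Arguments disc : clear implicits.
Arguments open_disc : clear implicits.

Section Manifold.
Variables (R : realType) (m : nat).

(* A partial bijection; [cmap] and [cinv] are total functions whose values
   outside [cdom] and [cimg] are irrelevant. *)
Record chart (T : Type) := Chart {
  cdom : set T;
  cmap : T -> 'rV[R]_m.+1;
  cinv : 'rV[R]_m.+1 -> T }.

Definition cimg (T : Type) (c : chart T) : set 'rV[R]_m.+1 :=
  cmap c @` cdom c.

Definition is_chart (T : topologicalType) (c : chart T) : Prop :=
  [/\ open (cdom c),
      (exists O : set 'rV[R]_m.+1, open O /\ cimg c = O `&` half_space R m),
      (forall e, cdom c e -> cinv c (cmap c e) = e),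
      {within cdom c, continuous (cmap c)} &
      {within cimg c, continuous (cinv c)}].

Definition transition (T : Type) (c c' : chart T) : 'rV[R]_m.+1 -> 'rV[R]_m.+1 :=
  cmap c' \o cinv c.

Definition overlap (T : Type) (c c' : chart T) : set 'rV[R]_m.+1 :=
  cmap c @` (cdom c `&` cdom c').

(* Smooth manifold of dimension m.+1, with (possibly empty) boundary. *)
Record smooth_manifold := SmoothManifold {
  carrier :> topologicalType;
  carrier_hausdorff : hausdorff_space carrier;
  carrier_second_countable : @second_countable carrier;
  atlas : set (chart carrier);
  atlas_charts : forall c, atlas c -> is_chart c;
  atlas_cover : forall e : carrier, exists2 c, atlas c & cdom c e;
  atlas_smooth : forall c c', atlas c -> atlas c' ->
    smooth_on (overlap c c') (transition c c') }.

Variable E : smooth_manifold.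

Definition smooth_from (W : normedModType R) (A : set E) (f : E -> W) : Prop :=
  forall c, atlas c ->
    smooth_on (cmap c @` (A `&` cdom c)) (f \o cinv c).

Definition smooth_to (V : normedModType R) (A : set V) (k : V -> E) : Prop :=
  {within A, continuous k} /\
  forall c, atlas c ->
    smooth_on (A `&` k @^-1` cdom c) (cmap c \o k).

(* [gram c x] is the Gram matrix at x of the metric in the chart c; it is
   meaningful for c in the atlas and x in [cimg c]. *)
Record riemannian_metric := RiemannianMetric {
  gram : chart E -> 'rV[R]_m.+1 -> 'M[R]_m.+1;
  gram_smooth : forall c, atlas c -> smooth_on (cimg c) (gram c);
  gram_sym : forall c x, atlas c -> cimg c x -> (gram c x)^T = gram c x;
  gram_pos : forall c x (X : 'rV[R]_m.+1), atlas c -> cimg c x ->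
    X != 0 -> 0 < inner (gram c x) X X;
  gram_transition : forall c c' x (X Y : 'rV[R]_m.+1), atlas c -> atlas c' ->
    overlap c c' x ->
    let L := dwithin (overlap c c') (transition c c') x in
    inner (gram c x) X Y = inner (gram c' (transition c c' x)) (L X) (L Y) }.

Variable g : riemannian_metric.

(* Every point has an open neighbourhood W that is isometric, through f with
   inverse k, to a subset of Euclidean space.  The image f @` W need not be open
   when W meets the boundary of E, and the boundary need not be flat. *)
Definition locally_flat : Prop :=
  forall e : E, exists (W : set E) (f : E -> 'rV[R]_m.+1) (k : 'rV[R]_m.+1 -> E),
    [/\ open W /\ W e,
        (forall y, W y -> k (f y) = y),
        smooth_from W f,
        smooth_to (f @` W) k &
        forall c x (X Y : 'rV[R]_m.+1), atlas c -> (cmap c @` (W `&` cdom c)) x ->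
          let L := dwithin (cmap c @` (W `&` cdom c)) (f \o cinv c) x in
          inner (gram g c x) X Y = inner 1%:M (L X) (L Y)].

(* Codimension one foliation given by its distinguished functions: local smooth
   submersions to R whose level sets agree on overlaps, since two of them differ
   there by a local diffeomorphism h of R.  The leaves are locally the level sets.
   No relation with the boundary of E is imposed; at boundary points a
   distinguished function is still a submersion on the full tangent space of E,
   but its level sets may be tangent to the boundary. *)
Record foliation := Foliation {
  distinguished : set (set E * (E -> R));
  distinguished_open : forall U f, distinguished (U, f) -> open U;
  distinguished_cover : forall e : E, exists U f, distinguished (U, f) /\ U e;
  distinguished_smooth : forall U f, distinguished (U, f) -> smooth_from U f;
  distinguished_submersion : forall U f c x, distinguished (U, f) -> atlas c ->
    (cmap c @` (U `&` cdom c)) x ->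
    exists X : 'rV[R]_m.+1,
      dwithin (cmap c @` (U `&` cdom c)) (f \o cinv c) x X != 0;
  distinguished_compat : forall U f U' f' e,
    distinguished (U, f) -> distinguished (U', f') -> U e -> U' e ->
    exists (I : set R) (h : R -> R),
      [/\ open I,
          smooth_on I h,
          (forall t, I t -> derive1 h t != 0) &
          \forall y \near e, I (f y) /\ f' y = h (f y)] }.

End Manifold.

(* Extrinsic geometry, in an open subset of R^m carrying the metric G, of the
   level sets of a function u without critical points. *)
Section LevelSets.
Variables (R : realType) (m : nat).
Variables (G : 'rV[R]_m -> 'M[R]_m) (u : 'rV[R]_m -> R).

Definition pd (f : 'rV[R]_m -> R) (i : 'I_m) (x : 'rV[R]_m) : R :=
  'D_(delta_mx 0 i) f x.

Definition gradient (x : 'rV[R]_m) : 'rV[R]_m :=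
  (\row_i pd u i x) *m invmx (G x).

Definition unit_normal (x : 'rV[R]_m) : 'rV[R]_m :=
  (Num.sqrt (inner (G x) (gradient x) (gradient x)))^-1 *: gradient x.

(* Christoffel symbol Gamma^k_ij of the Levi-Civita connection. *)
Definition christoffel (k i j : 'I_m) (x : 'rV[R]_m) : R :=
  2^-1 * \sum_l invmx (G x) k l *
    (pd (fun y => G y j l) i x + pd (fun y => G y i l) j x
     - pd (fun y => G y i j) l x).

Definition covariant_derivative (X : 'rV[R]_m) (Z : 'rV[R]_m -> 'rV[R]_m)
    (x : 'rV[R]_m) : 'rV[R]_m :=
  \row_k \sum_i X 0 i *
    (pd (fun y => Z y 0 k) i x + \sum_j christoffel k i j x * Z x 0 j).

Definition second_fundamental_form (x X Y : 'rV[R]_m) : R :=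
  - inner (G x) (covariant_derivative X unit_normal x) Y.

(* The rows of e form a G-orthonormal basis of the tangent hyperplane at x of
   the level set of u, when e has m.-1 rows. *)
Definition tangent_frame (r : nat) (x : 'rV[R]_m) (e : 'M[R]_(r, m)) : Prop :=
  e *m G x *m e^T = 1%:M /\
  forall a, \sum_i e a i * pd u i x = 0.

Definition frame_trace (r : nat) (x : 'rV[R]_m) (e : 'M[R]_(r, m)) : R :=
  \sum_a second_fundamental_form x (row a e) (row a e).

Definition mean_curvature_zero (x : 'rV[R]_m) : Prop :=
  forall e : 'M[R]_(m.-1, m), tangent_frame x e -> frame_trace x e = 0.

End LevelSets.

(* The mean curvature of the leaves is required to vanish at all points of E off
   the boundary (the interior points of the image of a chart). *)
Definition minimal_leaves (R : realType) (m : nat) (E : smooth_manifold R m)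
    (g : riemannian_metric E) (F : foliation E) : Prop :=
  forall U f c x, distinguished F (U, f) -> atlas c ->
    ((cimg c)^°) x -> U (cinv c x) ->
    mean_curvature_zero (gram g c) (f \o cinv c) x.

(* The circle is embedded in R^2 and the disc in R^n, so that circle x disc is
   a subset of R^(2 + n), the first two coordinates being those of the base. *)
Section DiscBundle.
Variables (R : realType) (m n : nat) (E : smooth_manifold R m).
Variable p : E -> 'rV[R]_2.

Record trivialization := Trivialization {
  tbase : set 'rV[R]_2;
  tmap : E -> 'rV[R]_(2 + n);
  tinv : 'rV[R]_(2 + n) -> E }.

Definition tprod (t : trivialization) : set 'rV[R]_(2 + n) :=
  [set z | [/\ tbase t (lsubmx z), circle R (lsubmx z) & disc R n (rsubmx z)]].

Definition is_trivialization (t : trivialization) : Prop :=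
  [/\ open (tbase t),
      (forall e, tbase t (p e) ->
         [/\ tprod t (tmap t e), lsubmx (tmap t e) = p e & tinv t (tmap t e) = e]),
      (forall z, tprod t z -> p (tinv t z) = lsubmx z /\ tmap t (tinv t z) = z),
      smooth_from (p @^-1` tbase t) (tmap t) &
      smooth_to (tprod t) (tinv t)].

(* p : E -> S^1 is a smooth fibre bundle with fibre the closed unit n-disc. *)
Definition is_disc_bundle : Prop :=
  [/\ (forall e, circle R (p e)),
      smooth_from setT p &
      forall b, circle R b -> exists t, is_trivialization t /\ tbase t b].

Definition fibre_transition (t t' : trivialization) (b : 'rV[R]_2)
    (x : 'rV[R]_n) : 'rV[R]_n :=
  rsubmx (tmap t' (tinv t (row_mx b x))).

(* There is a bundle atlas whose transition functions preserve the orientation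
   of the fibre.  Jacobians are taken in the open disc. *)
Definition orientable_disc_bundle : Prop :=
  exists A : set trivialization,
    [/\ (forall t, A t -> is_trivialization t),
        (forall b, circle R b -> exists t, A t /\ tbase t b) &
        forall t t' b x, A t -> A t' -> tbase t b -> tbase t' b ->
          circle R b -> open_disc R n x ->
          0 < \det (jacobian (fibre_transition t t' b) x)].

End DiscBundle.

(* Main.v *)
(** A locally isometric map to Euclidean space is determined by its value and
    derivative at a point: [d_i d_j f = Gamma^k_ij d_k f], so two of them differ
    by a rigid motion.  Hence they can be continued over any simply connected
    piece of [E], and developing along the pullback of the bundle to an interval
    of length [3 pi] yields a holonomy [x |-> x Q + b] with [Q] orthogonal.
    If [det Q = 1], comparing the orientation of a trivialization with that of
    the developing map orients the bundle, which is excluded.  So [det Q = -1],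
    and [det (Q + 1) = det Q * det (Q + 1)] forces the eigenvalue [-1]: a unit
    eigenvector [v] gives functions [x |-> <v, x>] on the developed picture that
    the holonomy changes only to [- <v, x> + c].  Their level sets are pieces of
    parallel hyperplanes, which are totally geodesic. *)

(* The boundary shapes the proof. It need not be flat or convex, so a flat map is controlled only on
   half-balls of charts, and its developed image need not be convex or embedded. Flat maps are
   therefore handled through smooth extensions to full balls, rigidity is proved off the boundary
   and carried to it by continuity, and all gluing takes place over convex parameter sets instead of
   in [E]. One abstract gluing argument is used twice: over angle times disc, which yields a flat
   map around a whole fibre, and then over an interval of angles. The interval [(0, 3 pi)] is open,
   still covers the circle, and overlaps its translate by [2 pi] in a connected set; so one holonomy
   element serves the whole overlap. Orientation is read from the sign of the Jacobian determinant
   of the developing map in the coordinates (angle, fibre). A change of trivialization preserves the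
   angle, so its full determinant equals that of its fibre part; this turns an orientation of the
   total space into one of the fibres. *)
From HB Require Import structures.
From mathcomp Require Import all_boot all_order all_algebra.
From mathcomp Require Import all_classical all_reals all_analysis.
From mathcomp Require Import ring lra.
Require Import Defs.

Set Implicit Arguments.
Unset Strict Implicit.
Unset Printing Implicit Defensive.

Import Order.TTheory GRing.Theory Num.Theory.
Import numFieldNormedType.Exports.

Local Open Scope classical_set_scope.
Local Open Scope ring_scope.

(** * Differential calculus *)

Section CkTheory.
Context {R : realType}.
Implicit Types V W : normedModType R.

(** Puts differentiability in the form used by [is_dwithin], so that the two notions can be compared
    directly. *)
Lemma diff_expansion V W (f : V -> W) (x : V) : differentiable f x ->
  forall eps : R, 0 < eps ->
    \forall y \near x, `|f y - f x - 'd f x (y - x)| <= eps * `|y - x|.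
Proof.
move=> /diff_locally dfE e e0.
have /eqaddoP /(_ e e0) h := dfE.
have := near_shift 0 x (fun y => `|f y - f x - 'd f x (y - x)| <= e * `|y - x|).
rewrite /= subr0 => ->; near=> y => /=.
rewrite addrK -addrA -opprD; near: y; exact: h.
Unshelve. all: by end_near. Qed.

Lemma expansion_diff V W (f : V -> W) (x : V) (L : {linear V -> W}) :
  continuous L ->
  (forall eps : R, 0 < eps ->
    \forall y \near x, `|f y - f x - L (y - x)| <= eps * `|y - x|) ->
  differentiable f x /\ 'd f x = L :> (V -> W).
Proof.
move=> Lc h.
have E : f \o shift x = cst (f x) + L +o_ (0 : V) id.
  apply/eqaddoP => e e0.
  have := near_shift 0 x (fun y => `|f y - f x - L (y - x)| <= e * `|y - x|).
  rewrite /= subr0 => H; move: (h e e0); rewrite H; apply: filterS => y /=.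
  by rewrite addrK -addrA -opprD.
have D := diff_unique Lc E.
split=> //; apply/diff_locallyP; split; first by rewrite D.
by rewrite D.
Qed.

Lemma near_eq_differentiable V W (f g : V -> W) (a : V) :
  (\near a, f a = g a) -> differentiable f a -> differentiable g a.
Proof.
move=> fg df; apply: (expansion_diff (L := 'd f a) _ _).1; first by case: df => [[]].
move=> e e0; have h := diff_expansion df e0.
rewrite -(nbhs_singleton fg).
by near=> y; rewrite -(near fg y)//; near: y.
Unshelve. all: by end_near. Qed.

Lemma Ck_ext V W k (U : set V) (f g : V -> W) : open U ->
  (forall x, U x -> f x = g x) -> Ck k U f -> Ck k U g.
Proof.
move=> oU; elim: k f g => [|k IH] f g fg /=.
  move=> fc x Ux; have := fc x Ux; rewrite /prop_for /continuous_at -fg// => h.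
  apply: cvg_trans h; apply: near_eq_cvg.
  by near=> y; rewrite fg//; near: y; exact: open_nbhs_nbhs.
move=> [df Df].
have nfg x : U x -> \near x, f x = g x.
  by move=> Ux; near=> y; rewrite fg//; near: y; exact: open_nbhs_nbhs.
split.
  by move=> x Ux; apply: near_eq_differentiable (nfg x Ux) (df x Ux).
move=> v; apply: IH (Df v) => x Ux.
exact/near_eq_derive/nfg.
Unshelve. all: by end_near. Qed.

Lemma Ck_sub V W k (U U' : set V) (f : V -> W) :
  U' `<=` U -> Ck k U f -> Ck k U' f.
Proof.
move=> UU; elim: k f => [|k IH] f /=; first by move=> h x /UU; exact: h.
by move=> [df Df]; split=> [x /UU/df//|v]; exact/IH/Df.
Qed.

Lemma Ck_lin V W W' k (U : set V) (f : V -> W) (l : {linear W -> W'}) :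
  open U -> continuous l -> Ck k U f -> Ck k U (l \o f).
Proof.
move=> oU lc; elim: k f => [|k IH] f /=.
  by move=> fc x Ux; apply: continuous_comp; [exact: fc|exact: lc].
move=> [df Df]; split=> [x Ux|v].
  by apply: differentiable_comp; [exact: df|exact: linear_differentiable].
apply: Ck_ext (IH _ (Df v)) => // x Ux /=.
have ld := linear_differentiable (f x) lc.
rewrite [RHS]deriveE; last by apply: differentiable_comp => //; exact: df.
by rewrite diff_comp//= ?diff_lin// ?deriveE//; exact: df.
Qed.

Lemma Ck_prelin V V' W k (U : set V) (f : V -> W) (l : {linear V' -> V}) :
  open U -> continuous l -> Ck k U f -> Ck k (l @^-1` U) (f \o l).
Proof.
move=> oU lc; elim: k f => [|k IH] f /=.
  by move=> fc x Ux; apply: continuous_comp; [exact: lc|exact: fc].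
move=> [df Df]; split=> [x Ux|v].
  by apply: differentiable_comp; [exact: linear_differentiable|exact: df].
apply: Ck_ext (IH _ (Df (l v))) => //.
  by apply: open_comp => // x _; exact: lc.
move=> x Ux /=.
have ld := linear_differentiable x lc.
rewrite [RHS]deriveE; last by apply: differentiable_comp => //; exact: df.
by rewrite diff_comp//= ?diff_lin// ?deriveE//; exact: df.
Qed.

Lemma Ck_cst V W k (U : set V) (b : W) : Ck k U (cst b).
Proof.
elim: k b => [|k IH] b /=; first by move=> x _; exact: cst_continuous.
split=> [x _|v]; first exact: differentiable_cst.
have -> : (fun x : V => 'D_v (cst b) x) = cst 0.
  by apply/funext => x; rewrite derive_cst.
exact: IH.
Qed.

Lemma Ck_addc V W k (U : set V) (f : V -> W) (b : W) :
  open U -> Ck k U f -> Ck k U (fun x => f x + b).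
Proof.
move=> oU; case: k => [|k] /=.
  by move=> fc x Ux; apply: continuousD; [exact: fc|exact: cst_continuous].
move=> [df Df]; split=> [x Ux|v].
  by apply: differentiableD; [exact: df|exact: differentiable_cst].
apply: Ck_ext (Df v) => // x Ux.
have fd : derivable f x v by exact/diff_derivable/df.
have bd : derivable (cst b : V -> W) x v.
  exact/diff_derivable/differentiable_cst.
by rewrite -[RHS]/('D_v (f + cst b) x) deriveD// derive_cst addr0.
Qed.

End CkTheory.

(** * Mean value arguments along lines and symmetry of second derivatives *)

Section Lines.
Context {R : realType}.
Implicit Types V W : normedModType R.

Lemma is_derive_line V W (f : V -> W) (x v : V) (t : R) :
  derivable f (x + t *: v) v ->
  is_derive t (1 : R) (fun s : R => f (x + s *: v)) ('D_v f (x + t *: v)).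
Proof.
move=> df.
have E : (fun h : R => h^-1 *: (((fun s : R => f (x + s *: v)) \o shift t) (h *: (1:R)) - f (x + t *: v))) =
   (fun h => h^-1 *: ((f \o shift (x + t *: v)) (h *: v) - f (x + t *: v))).
  apply/funext => h /=; congr (_ *: (f _ - _)).
  by rewrite scalerDl addrCA [h *: 1]mulr1.
by apply: DeriveDef; rewrite /derivable /derive E.
Qed.

Lemma mvt_line V (f : V -> R) (x v : V) (h : R) : 0 <= h ->
  (forall t, 0 <= t <= h -> derivable f (x + t *: v) v) ->
  exists2 c, 0 <= c <= h & f (x + h *: v) - f x = h * 'D_v f (x + c *: v).
Proof.
move=> h0 df.
have dg t : 0 <= t <= h ->
    is_derive t (1 : R) (fun s : R => f (x + s *: v)) ('D_v f (x + t *: v)).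
  by move=> th; exact/is_derive_line/df.
have := @MVT_segment R (fun s : R => f (x + s *: v))
  (fun s => 'D_v f (x + s *: v)) 0 h h0.
case.
- move=> t; rewrite in_itv/= => /andP[t0 th]; apply: dg; by rewrite !ltW.
- apply: derivable_within_continuous => t; rewrite in_itv/= => th.
  by have [] := dg t th.
- move=> c; rewrite in_itv/= => ch; rewrite subr0 scale0r addr0 => E.
  by exists c => //; rewrite E mulrC.
Qed.

(** The mean value theorem is applied twice: along [v] to the increment [f (y + h w) - f y], then
    along [w] to the derivative in direction [v]. The left-hand side is symmetric in [v] and [w],
    which is what makes mixed derivatives comparable. *)
Lemma second_difference V (f p : V -> R) (U : set V) (x v w : V) (h : R) :
  0 < h -> Ck 2 U f -> (forall y, p y = 'D_w ('D_v f) y) ->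
  (forall s t, 0 <= s <= h -> 0 <= t <= h -> U (x + s *: v + t *: w)) ->
  exists s t, [/\ 0 <= s <= h, 0 <= t <= h &
    f (x + h *: v + h *: w) - f (x + h *: v) - (f (x + h *: w) - f x)
    = h * (h * p (x + s *: v + t *: w))].
Proof.
move=> h0 [df Df] pE Uh.
have hh : 0 <= h <= h by rewrite lexx ltW.
have h00 : (0 : R) <= 0 <= h by rewrite lexx ltW.
pose g := (fun y => f (y + h *: w) - f y).
have dg t : 0 <= t <= h ->
  is_derive (x + t *: v) v g ('D_v f (x + t *: v + h *: w) - 'D_v f (x + t *: v)).
  move=> th.
  have d1 : derivable f (x + t *: v + h *: w) v by apply/diff_derivable/df/Uh.
  have d2 : derivable f (x + t *: v) v.
    by apply/diff_derivable/df; have := Uh t 0 th h00; rewrite scale0r addr0.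
  have d3 : is_derive (x + t *: v) v (fun y => f (y + h *: w)) ('D_v f (x + t *: v + h *: w)).
    have E : (fun k : R => k^-1 *: (((fun y => f (y + h *: w)) \o shift (x + t *: v)) (k *: v) - f (x + t *: v + h *: w))) =
      (fun k => k^-1 *: ((f \o shift (x + t *: v + h *: w)) (k *: v) - f (x + t *: v + h *: w))).
      by apply/funext => k /=; congr (_ *: (f _ - _)); rewrite !addrA.
    by apply: DeriveDef; rewrite /derivable /derive E.
  exact: (is_deriveB d3 (DeriveDef d2 erefl)).
have [|s sh E] := @mvt_line _ g x v h (ltW h0).
  by move=> t th; have [] := dg t th.
have [_ dgE] := dg s sh; rewrite dgE in E.
have [|t th E'] := @mvt_line _ ('D_v f) (x + s *: v) w h (ltW h0).
  by move=> t th; apply/diff_derivable/(Df v).1/Uh.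
by exists s, t; split=> //; rewrite pE -E' -E /g addrAC (addrAC x).
Qed.

Lemma ball_close2 V (p q : V -> R) (U : set V) (x : V) (e : R) : open U ->
  U x -> {for x, continuous p} -> {for x, continuous q} -> 0 < e ->
  exists2 r : R, 0 < r & forall y, `|x - y| < r ->
    [/\ U y, `|p x - p y| < e & `|q x - q y| < e].
Proof.
move=> oU Ux c1 c2 e0.
have n0 : \forall y \near x, U y by exact: open_nbhs_nbhs.
move/cvgrPdist_lt : c1 => /(_ _ e0) n1.
move/cvgrPdist_lt : c2 => /(_ _ e0) n2.
have /nbhs_ballP[r /= r0 H] : nbhs x (U `&` [set y | `|p x - p y| < e] `&` [set y | `|q x - q y| < e]).
  by apply: filterI => //; apply: filterI.
exists r => // y xy; have [[]] : (U `&` [set y | `|p x - p y| < e] `&` [set y | `|q x - q y| < e]) y.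
  by apply: H; rewrite -ball_normE.
by [].
Qed.

Lemma mixed_derive_eq V (f p q : V -> R) (U : set V) (x v w : V) : open U -> U x ->
  Ck 2 U f -> (forall y, p y = 'D_w ('D_v f) y) ->
  (forall y, q y = 'D_v ('D_w f) y) ->
  {for x, continuous p} -> {for x, continuous q} -> p x = q x.
Proof.
move=> oU Ux C2 pE qE c1 c2.
apply/eqP; rewrite -subr_eq0 -normr_le0; apply/ler_addgt0Pl => e e0.
rewrite addr0.
have e2 : 0 < e / 2 by rewrite divr_gt0.
have [r r0 Hr] := ball_close2 oU Ux c1 c2 e2.
(* The parallelogram with sides [h v] and [h w] then stays within [r / 2] of [x]; the [1] keeps the
   denominator positive when both vectors vanish. *)
pose h := r / 2 / (`|v| + `|w| + 1).
have d0 : 0 < `|v| + `|w| + 1 by rewrite ltr_wpDl// addr_ge0.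
have h0 : 0 < h by rewrite !divr_gt0.
have Hh s t : 0 <= s <= h -> 0 <= t <= h -> `|x - (x + s *: v + t *: w)| < r.
  move=> /andP[s0 sh] /andP[t0 th].
  rewrite -addrA opprD addrA subrr sub0r normrN.
  apply: (@le_lt_trans _ _ (h * (`|v| + `|w| + 1))).
    apply: le_trans (ler_normD _ _) _; rewrite !normrZ !ger0_norm//.
    rewrite mulrDr mulrDr mulr1 -[leLHS]addr0; apply: lerD; last exact: ltW.
    by apply: lerD; apply: ler_wpM2r.
  by rewrite divfK ?gt_eqF// ltr_pdivrMr// ltr_pMr// ltr1n.
have [|s [t [sh th E]]] := @second_difference _ f p U x v w h h0 C2 pE.
  by move=> s t sh th; have [] := Hr _ (Hh s t sh th).
have [|t' [s' [th' sh' E']]] := @second_difference _ f q U x w v h h0 C2 qE.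
  move=> t' s' th' sh'; have [] := Hr _ (Hh s' t' sh' th') => //.
  by rewrite addrAC.
have Eq : p (x + s *: v + t *: w) = q (x + t' *: w + s' *: v).
  have hn : h != 0 by rewrite gt_eqF.
  apply: (mulfI hn); apply: (mulfI hn); rewrite -E -E'.
  rewrite (addrAC x (h *: w)); ring.
have [_ P1 _] := Hr _ (Hh s t sh th); have [_ _ P2] := Hr _ (Hh s' t' sh' th').
rewrite (addrAC x) in P2.
rewrite Eq in P1.
set a := q _ in P1 P2.
rewrite (splitr e); apply: le_trans (ler_distD a _ _) _.
by apply: lerD; [exact: ltW|rewrite distrC; exact: ltW].
Qed.

Lemma schwarz V (f : V -> R) (U : set V) (x v w : V) : open U -> U x ->
  Ck 2 U f -> 'D_w ('D_v f) x = 'D_v ('D_w f) x.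
Proof.
move=> oU Ux C2.
exact: (@mixed_derive_eq V f ('D_w ('D_v f)) ('D_v ('D_w f)) U x v w oU Ux C2
  (fun=> erefl) (fun=> erefl) ((C2.2 v).2 w x Ux) ((C2.2 w).2 v x Ux)).
Qed.

Lemma derive0_convex_cst V (f : V -> R) (U : set V) (x y : V) :
  (forall t : R, 0 <= t <= 1 -> U (x + t *: (y - x))) ->
  (forall z, U z -> differentiable f z) ->
  (forall z v, U z -> 'D_v f z = 0) -> f x = f y.
Proof.
move=> cU df Df.
have [|c c01] := @mvt_line _ f x (y - x) 1 ler01.
  by move=> t t01; exact/diff_derivable/df/cU.
rewrite Df; last exact: cU.
by rewrite mulr0 scale1r (addrC x) subrK => /eqP; rewrite subr_eq0 => /eqP.
Qed.
End Lines.

(** * Matrix-valued functions and Jacobians *)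

Section MatrixCalculus.
Context {R : realType}.
Implicit Types V W : normedModType R.

Lemma is_derive_mulmx V m n p (A : V -> 'M[R]_(m, n)) (B : V -> 'M[R]_(n, p))
    (x v : V) : derivable A x v -> derivable B x v ->
  is_derive x v (fun y => A y *m B y) ('D_v A x *m B x + A x *m 'D_v B x).
Proof.
move=> dA dB.
have dA' i j : is_derive x v (fun y => A y i j) ('D_v A x i j).
  have d := (derivable_mxP A x v).1 dA i j.
  by apply: DeriveDef => //; rewrite derive_mx// mxE.
have dB' i j : is_derive x v (fun y => B y i j) ('D_v B x i j).
  have d := (derivable_mxP B x v).1 dB i j.
  by apply: DeriveDef => //; rewrite derive_mx// mxE.
have E i j : is_derive x v (fun y => (A y *m B y) i j)
   (('D_v A x *m B x + A x *m 'D_v B x) i j).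
  have -> : (fun y => (A y *m B y) i j) = \sum_k (fun y => A y i k * B y k j).
    by apply/funext => y; rewrite mxE fct_sumE.
  have H := @is_derive_sum _ _ _ _ _ x v _ (fun k => is_deriveM (dA' i k) (dB' k j)).
  apply: (is_derive_eq H).
  rewrite !mxE -big_split/=; apply: eq_bigr => k _.
  by rewrite /GRing.scale/=; ring.
have D : derivable (fun y => A y *m B y) x v.
  by apply/derivable_mxP => i j; have [] := E i j.
apply: DeriveDef => //; rewrite derive_mx//.
by apply/matrixP => i j; rewrite [LHS]mxE; have [_ ->] := E i j.
Qed.

Lemma is_derive_trmx V m n (A : V -> 'M[R]_(m, n)) (x v : V) :
  derivable A x v -> is_derive x v (fun y => (A y)^T) ('D_v A x)^T.
Proof.
move=> dA.
have D : derivable (fun y => (A y)^T) x v.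
  apply/derivable_mxP => i j.
  have -> : (fun y => (A y)^T i j) = (fun y => A y j i) by apply/funext => y; rewrite mxE.
  exact: (derivable_mxP A x v).1.
apply: DeriveDef => //; rewrite !derive_mx//; apply/matrixP => i j.
by rewrite !mxE; congr ('D_v _ x); apply/funext => y; rewrite mxE.
Qed.

Lemma differentiable_mx V m n (M : V -> 'M[R]_(m, n)) (x : V) :
  (forall i j, differentiable (fun y => M y i j) x) -> differentiable M x.
Proof.
move=> d.
have -> : M = \sum_(i < m) \sum_(j < n) (fun y => M y i j *: delta_mx i j).
  apply/funext => y; rewrite fct_sumE [LHS]matrix_sum_delta.
  by apply: eq_bigr => i _; rewrite fct_sumE.
by do 2 (apply: differentiable_sum => ?); exact: differentiableZl.
Qed.

Lemma differentiable_entry V m n (M : V -> 'M[R]_(m, n)) (x : V) i j :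
  differentiable M x -> differentiable (fun y => M y i j) x.
Proof.
move=> d; apply: (@differentiable_comp _ _ _ _ M (fun N : 'M[R]_(m, n) => N i j)) => //.
exact: differentiable_coord.
Qed.

Lemma differentiable_bigsum V (I : Type) (r : seq I) (P : pred I) (F : I -> V -> R) (x : V) :
  (forall i, differentiable (F i) x) ->
  differentiable (fun y => \sum_(i <- r | P i) F i y) x.
Proof.
move=> d; elim: r => [|i r IH].
  have -> : (fun y => \sum_(i <- [::] | P i) F i y) = cst 0.
    by apply/funext => y; rewrite big_nil.
  exact: differentiable_cst.
have -> : (fun y => \sum_(i <- i :: r | P i) F i y) =
  (if P i then F i else cst 0) + (fun y => \sum_(i <- r | P i) F i y).
  apply/funext => y; rewrite big_cons; case: (P i) => //.
  by rewrite -[RHS]/(0 + _) add0r.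
by apply: differentiableD => //; case: (P i) => //; exact: differentiable_cst.
Qed.

Lemma differentiable_bigprod V (I : Type) (r : seq I) (P : pred I) (F : I -> V -> R) (x : V) :
  (forall i, differentiable (F i) x) ->
  differentiable (fun y => \prod_(i <- r | P i) F i y) x.
Proof.
move=> d; elim: r => [|i r IH].
  have -> : (fun y => \prod_(i <- [::] | P i) F i y) = cst 1.
    by apply/funext => y; rewrite big_nil.
  exact: differentiable_cst.
have -> : (fun y => \prod_(i <- i :: r | P i) F i y) =
  (if P i then F i else cst 1) * (fun y => \prod_(i <- r | P i) F i y).
  apply/funext => y; rewrite big_cons; case: (P i) => //.
  by rewrite -[RHS]/(1 * _) mul1r.
by apply: differentiableM => //; case: (P i) => //; exact: differentiable_cst.
Qed.

Lemma differentiable_det V n (M : V -> 'M[R]_n) (x : V) :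
  differentiable M x -> differentiable (fun y => \det (M y)) x.
Proof.
move=> d; rewrite /determinant; apply: differentiable_bigsum => s.
apply: differentiableM; first exact: differentiable_cst.
by apply: differentiable_bigprod => i; exact: differentiable_entry.
Qed.

Lemma near_unitmx V n (M : V -> 'M[R]_n) (x : V) :
  {for x, continuous (fun y => \det (M y))} ->
  M x \in unitmx -> \forall y \near x, M y \in unitmx.
Proof.
move=> c; rewrite unitmxE unitfE => d0.
have := c; move=> /cvgr_neq0 /(_ d0); apply: filterS => y.
by rewrite unitmxE unitfE.
Qed.

(** Cramer's rule: near [x] the inverse is the adjugate divided by the determinant. The agreement is
    only local, because [invmx] returns its argument on singular matrices. *)
Lemma differentiable_invmx V n (M : V -> 'M[R]_n) (x : V) :
  differentiable M x -> M x \in unitmx -> differentiable (fun y => invmx (M y)) x.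
Proof.
move=> dM Mx.
have dd := differentiable_det dM.
have := near_unitmx (differentiable_continuous dd) Mx => nu.
have : differentiable (fun y => (\det (M y))^-1 *: \adj (M y)) x.
  apply: differentiable_mx => i j.
  have -> : (fun y => ((\det (M y))^-1 *: \adj (M y)) i j) =
    (fun y => (\det (M y))^-1) * (fun y => (-1) ^+ (j + i) * \det (row' j (col' i (M y)))).
    by apply/funext => y; rewrite !mxE.
  apply: differentiableM.
    by apply: differentiableV => //; rewrite -unitfE -unitmxE.
  apply: differentiableM; first exact: differentiable_cst.
  apply: differentiable_det; apply: differentiable_mx => k l.
  have -> : (fun y => row' j (col' i (M y)) k l) = (fun y => M y (lift j k) (lift i l)).
    by apply/funext => y; rewrite !mxE.
  exact: differentiable_entry.
apply: near_eq_differentiable.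
by apply: filterS nu => y yu; rewrite /invmx yu.
Qed.

Lemma jacobianE m n (f : 'rV[R]_m -> 'rV[R]_n) x i j : differentiable f x ->
  ('J f x) i j = 'D_(delta_mx 0 i) f x 0 j.
Proof. by move=> df; rewrite deriveEjacobian// -rowE [RHS]mxE. Qed.

Lemma pd_jacobian m n (f : 'rV[R]_m -> 'rV[R]_n) x i j : differentiable f x ->
  pd (fun y => f y 0 j) i x = ('J f x) i j.
Proof.
move=> df; rewrite jacobianE// derive_mx; first by rewrite mxE.
exact: diff_derivable.
Qed.

Lemma differentiable_jacobian m n (U : set 'rV[R]_m) (f : 'rV[R]_m -> 'rV[R]_n) x :
  open U -> U x -> Ck 2 U f -> differentiable (jacobian f) x.
Proof.
move=> oU Ux [df Df]; apply: differentiable_mx => i j.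
apply: (@near_eq_differentiable _ _ _ (fun y => 'D_(delta_mx 0 i) f y 0 j)).
  near=> y; rewrite -jacobianE//; apply: df; near: y; exact: open_nbhs_nbhs.
by apply: differentiable_entry; exact: (Df _).1.
Unshelve. all: by end_near. Qed.

Lemma Ck_entry V m n k (U : set V) (f : V -> 'M[R]_(m, n)) i j :
  open U -> Ck k U f -> Ck k U (fun x => f x i j).
Proof.
move=> oU Cf.
have @l : {linear 'M[R]_(m, n) -> R}.
  by exists (fun N : 'M[R]_(_, _) => N i j); do 2![eexists]; do ?[constructor];
     rewrite ?mxE// => ? *; rewrite ?mxE//; move=> ?; rewrite !mxE.
exact: (@Ck_lin _ _ _ _ k U f l oU (coord_continuous (i:=i) (j:=j)) Cf).
Qed.

(** With row vectors, row [j] of the Jacobian is the derivative in direction [j], so this is the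
    symmetry of second derivatives of the component [a]. *)
Lemma jacobian_derive_sym m n (U : set 'rV[R]_m) (f : 'rV[R]_m -> 'rV[R]_n) x i j a :
  open U -> U x -> Ck 2 U f ->
  'D_(delta_mx 0 i) (jacobian f) x j a = 'D_(delta_mx 0 j) (jacobian f) x i a.
Proof.
move=> oU Ux C2; have dJ := differentiable_jacobian oU Ux C2.
have E k l : 'D_(delta_mx 0 k) (jacobian f) x l a =
   'D_(delta_mx 0 k) ('D_(delta_mx 0 l) (fun y => f y 0 a)) x.
  rewrite derive_mx ?mxE; last exact: diff_derivable.
  apply: near_eq_derive; near=> y.
  rewrite -pd_jacobian//; apply: C2.1; near: y; exact: open_nbhs_nbhs.
have C2a := Ck_entry 0 a oU C2.
have S := @schwarz R _ (fun y => f y 0 a) U x (delta_mx 0 j) (delta_mx 0 i) oU Ux C2a.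
exact: (etrans (E i j) (etrans S (esym (E j i)))).
Unshelve. all: by end_near. Qed.

End MatrixCalculus.

(** * Christoffel symbols and rigidity of local isometries *)

Section Christoffel.
Context {R : realType} {m : nat}.
Variables (U : set 'rV[R]_m) (f : 'rV[R]_m -> 'rV[R]_m) (G : 'rV[R]_m -> 'M[R]_m).
Hypotheses (oU : open U) (C2 : Ck 2 U f)
  (GE : forall y, U y -> G y = 'J f y *m ('J f y)^T).

(** The indices are arranged so that, for fixed [i], the equation for all second derivatives of [f]
    is one matrix identity with the symbols acting on the left of the Jacobian. *)
Definition christoffel_mx i x : 'M[R]_m := \matrix_(j, k) christoffel G k i j x.

(** Let [T i j l] be the Euclidean product of the second derivative [d_i d_j f] with [d_l f]. It is
    symmetric in [i, j], and [d_k G_jl = T k j l + T k l j], so the three derivatives in the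
    Christoffel symbol add up to [2 T i j l]. Multiplying by the inverse of [G = J J^T] and then by
    [J] restores the second derivatives, as [J] is square and invertible. *)
Lemma christoffel_jacobian x i : U x -> 'J f x \in unitmx ->
  'D_(delta_mx 0 i) (jacobian f) x = christoffel_mx i x *m 'J f x.
Proof.
move=> Ux Ju.
have dJ v : derivable (jacobian f) x v.
  exact/diff_derivable/(differentiable_jacobian oU Ux C2).
have [B BE] : exists B : 'I_m -> 'M[R]_m,
    forall k, B k = 'D_(delta_mx 0 k) (jacobian f) x by eexists.
have [J JE] : exists J : 'M[R]_m, J = 'J f x by eexists.
have BS k j a : B k j a = B j k a.
  rewrite !BE; exact: (jacobian_derive_sym k j a oU Ux C2).
pose T i j l := (B i *m J^T) j l.
have TS k j l : T k j l = T j k l.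
  by rewrite /T !mxE; apply: eq_bigr => a _; rewrite BS.
have DG k : is_derive x (delta_mx 0 k) G (B k *m J^T + J *m (B k)^T).
  have dJt := is_derive_trmx (dJ (delta_mx 0 k)).
  have dGG := is_derive_mulmx (dJ (delta_mx 0 k)) (ex_derive (is_derive := dJt)).
  rewrite (derive_val (is_derive := dJt)) -BE -JE in dGG.
  apply: near_eq_is_derive dGG.
  by near=> y; rewrite GE//; near: y; exact: open_nbhs_nbhs.
have pG j l k : pd (fun y => G y j l) k x = T k j l + T k l j.
  rewrite /pd; have [d1 d2] := DG k.
  have := derive_mx d1; rewrite d2 => /matrixP /(_ j l); rewrite [RHS]mxE => <-.
  rewrite mxE; congr (_ + _).
  by rewrite /T !mxE; apply: eq_bigr => a _; rewrite !mxE mulrC.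
have -> : christoffel_mx i x = B i *m J^T *m (invmx (G x))^T.
  apply/matrixP => j k; rewrite [LHS]mxE /christoffel [RHS]mxE mulr_sumr.
  apply: eq_bigr => l _; rewrite !pG -/(T i j l) [X in _ = _ * X]mxE.
  rewrite (TS j i l) (TS i l j) (TS j l i).
  by field.
rewrite -BE -JE GE// -JE trmx_inv trmx_mul trmxK.
rewrite -JE in Ju.
have Jtu : J^T \in unitmx by rewrite unitmx_tr.
have GU : J *m J^T \in unitmx by rewrite unitmx_mul Ju.
have -> : invmx (J *m J^T) = invmx (J^T) *m invmx J.
  apply: (can_inj (mulKmx GU)); rewrite mulmxV// -mulmxA (mulmxA J^T) mulmxV//.
  by rewrite mul1mx mulmxV.
by rewrite !mulmxA mulmxK// mulmxKV.
Unshelve. all: by end_near. Qed.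

End Christoffel.

Definition convex_on (R : realType) (V : normedModType R) (A : set V) : Prop :=
  forall x y (t : R), A x -> A y -> 0 <= t <= 1 -> A (x + t *: (y - x)).

Section Rigidity.
Context {R : realType}.

Lemma invmx_mul n (A B : 'M[R]_n) : A \in unitmx -> B \in unitmx ->
  invmx (A *m B) = invmx B *m invmx A.
Proof.
move=> Au Bu; have ABu : A *m B \in unitmx by rewrite unitmx_mul Au.
apply: (can_inj (mulKmx ABu)); rewrite mulmxV// -mulmxA (mulmxA B) mulmxV//.
by rewrite mul1mx mulmxV.
Qed.

Lemma derive_all0 m (W : normedModType R) (f : 'rV[R]_m -> W) x v : differentiable f x ->
  (forall i, 'D_(delta_mx 0 i) f x = 0) -> 'D_v f x = 0.
Proof.
move=> df D; rewrite deriveE// [v]row_sum_delta linear_sum big1// => i _.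
by rewrite linearZ/= -deriveE// D scaler0.
Qed.

Lemma derive_mulmx_cst (V : normedModType R) m n p (f : V -> 'M[R]_(m, n)) (Q : 'M[R]_(n, p)) x v :
  derivable f x v -> is_derive x v (fun y => f y *m Q) ('D_v f x *m Q).
Proof.
move=> df; have dQ : derivable (cst Q : V -> _) x v.
  exact/diff_derivable/differentiable_cst.
apply: (is_derive_eq (is_derive_mulmx df dQ)).
by rewrite derive_cst mulmx0 addr0.
Qed.

Lemma differentiable_mulmx_cst (V : normedModType R) m n p (f : V -> 'M[R]_(m, n)) (Q : 'M[R]_(n, p)) x :
  differentiable f x -> differentiable (fun y => f y *m Q) x.
Proof.
move=> df; apply: differentiable_mx => i j.
have -> : (fun y => (f y *m Q) i j) = (fun y => \sum_k f y i k * Q k j).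
  by apply/funext => y; rewrite mxE.
apply: differentiable_bigsum => k; apply: differentiableM.
  exact: differentiable_entry.
exact: differentiable_cst.
Qed.

Lemma mx_cst_convex (V : normedModType R) m n (M : V -> 'M[R]_(m, n)) (U : set V) x y :
  convex_on U -> U x -> U y ->
  (forall z, U z -> differentiable M z) ->
  (forall z v, U z -> 'D_v M z = 0) -> M x = M y.
Proof.
move=> cU Ux Uy dM DM; apply/matrixP => i j.
apply: (@derive0_convex_cst R V (fun z => M z i j) U).
- by move=> t t01; exact: cU.
- by move=> z Uz; exact/differentiable_entry/dM.
- move=> z v Uz; have := DM z v Uz.
  rewrite derive_mx; last exact/diff_derivable/dM.
  by move=> /matrixP /(_ i j); rewrite !mxE.
Qed.

(* Both frames satisfy the same linear system [d_i J = Gamma_i J], so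
   [J1^-1 J2] has zero derivative. *)
Lemma parallel_frames_ratio m (U : set 'rV[R]_m) (J1 J2 : 'rV[R]_m -> 'M[R]_m)
    (Gamma : 'I_m -> 'rV[R]_m -> 'M[R]_m) (x0 : 'rV[R]_m) :
  open U -> convex_on U -> U x0 ->
  (forall y, U y -> differentiable J1 y) ->
  (forall y, U y -> differentiable J2 y) ->
  (forall y, U y -> J1 y \in unitmx) ->
  (forall i y, U y -> 'D_(delta_mx 0 i) J1 y = Gamma i y *m J1 y) ->
  (forall i y, U y -> 'D_(delta_mx 0 i) J2 y = Gamma i y *m J2 y) ->
  forall y, U y -> J2 y = J1 y *m (invmx (J1 x0) *m J2 x0).
Proof.
move=> oU cU Ux0 dJ1 dJ2 J1u D1 D2.
pose Q y := invmx (J1 y) *m J2 y.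
have JQ y : U y -> J1 y *m Q y = J2 y.
  by move=> Uy; rewrite /Q mulmxA mulmxV ?mul1mx ?J1u.
have dI y : U y -> differentiable (fun z => invmx (J1 z)) y.
  by move=> Uy; apply: differentiable_invmx; [exact: dJ1|exact: J1u].
have dQ y : U y -> differentiable Q y.
  move=> Uy; apply: differentiable_mx => i j.
  have -> : (fun z => Q z i j) = (fun z => \sum_k invmx (J1 z) i k * J2 z k j).
    by apply/funext => z; rewrite mxE.
  apply: differentiable_bigsum => k; apply: differentiableM.
    exact: (differentiable_entry i k (dI y Uy)).
  exact: (differentiable_entry k j (dJ2 y Uy)).
have DQ y v : U y -> 'D_v Q y = 0.
  move=> Uy; apply: derive_all0 => [|i]; first exact: dQ.
  have dJ1' := diff_derivable (v := delta_mx 0 i) (dJ1 y Uy).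
  have dQ' := diff_derivable (v := delta_mx 0 i) (dQ y Uy).
  have E := derive_val (is_derive := is_derive_mulmx dJ1' dQ').
  have N : \near y, J1 y *m Q y = J2 y.
    by near=> z; rewrite JQ//; near: z; exact: open_nbhs_nbhs.
  rewrite (near_eq_derive _ N) (D1 i y Uy) (D2 i y Uy) -mulmxA JQ// in E.
  have {}E : J1 y *m 'D_(delta_mx 0 i) Q y = 0.
    by apply: (addrI (Gamma i y *m J2 y)); rewrite -E addr0.
  by rewrite -[LHS](mulKmx (J1u y Uy)) E mulmx0.
move=> y Uy; rewrite -/(Q x0) -[Q x0](_ : Q y = _); first by rewrite JQ.
by apply: (@mx_cst_convex _ _ _ Q U) => // z Uz; exact: dQ.
Unshelve. all: by end_near. Qed.

Lemma derive_zero_affine m (U : set 'rV[R]_m) (f1 f2 : 'rV[R]_m -> 'rV[R]_m) Q x0 :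
  convex_on U -> U x0 ->
  (forall y, U y -> differentiable f1 y) ->
  (forall y, U y -> differentiable f2 y) ->
  (forall y, U y -> 'J f2 y = 'J f1 y *m Q) ->
  forall y, U y -> f2 y = f1 y *m Q + (f2 x0 - f1 x0 *m Q).
Proof.
move=> cU Ux0 d1 d2 J12 y Uy.
pose h y := f2 y - f1 y *m Q.
have : h y = h x0.
  apply: (@mx_cst_convex _ _ _ h U) => // z.
    move=> Uz; apply: differentiableB; first exact: d2.
    exact/differentiable_mulmx_cst/d1.
  move=> v Uz.
  have e1 := derive_mulmx_cst Q (diff_derivable (v := v) (d1 z Uz)).
  have e2 : is_derive z v f2 ('D_v f2 z).
    by apply: DeriveDef => //; exact/diff_derivable/d2.
  rewrite (derive_val (is_derive := is_deriveB e2 e1)).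
  rewrite (deriveEjacobian _ (d1 z Uz)) (deriveEjacobian _ (d2 z Uz)).
  by rewrite -mulmxA -(J12 z Uz) subrr.
by rewrite /h => <-; rewrite addrC subrK.
Qed.

(** Both Jacobians solve the linear system given by the Christoffel symbols of the common metric,
    hence differ by a constant right factor [Q]. Equality of the Gram matrices at one point makes
    [Q] orthogonal, and integration adds a translation. *)
Lemma rigidity_convex m (U : set 'rV[R]_m) (f1 f2 : 'rV[R]_m -> 'rV[R]_m) :
  open U -> convex_on U -> Ck 2 U f1 -> Ck 2 U f2 -> U !=set0 ->
  (forall y, U y -> 'J f1 y \in unitmx) ->
  (forall y, U y -> 'J f1 y *m ('J f1 y)^T = 'J f2 y *m ('J f2 y)^T) ->
  exists Q b, Q *m Q^T = 1%:M /\ forall y, U y -> f2 y = f1 y *m Q + b.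
Proof.
move=> oU cU C1 C2 [x0 Ux0] J1u JJ.
have J2u y : U y -> 'J f2 y \in unitmx.
  move=> Uy; have : 'J f2 y *m ('J f2 y)^T \in unitmx.
    by rewrite -(JJ y Uy) unitmx_mul unitmx_tr (J1u y Uy).
  by rewrite unitmx_mul => /andP[].
pose G y := 'J f1 y *m ('J f1 y)^T.
have dJ1 y : U y -> differentiable (jacobian f1) y.
  by move=> Uy; exact: differentiable_jacobian oU Uy C1.
have dJ2 y : U y -> differentiable (jacobian f2) y.
  by move=> Uy; exact: differentiable_jacobian oU Uy C2.
have D1 i y (Uy : U y) := @christoffel_jacobian _ _ U f1 G oU C1 (fun _ _ => erefl) y i Uy (J1u y Uy).
have D2 i y (Uy : U y) := @christoffel_jacobian _ _ U f2 G oU C2 JJ y i Uy (J2u y Uy).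
have J12 := parallel_frames_ratio oU cU Ux0 dJ1 dJ2 J1u D1 D2.
set Q := invmx _ *m _ in J12.
exists Q, (f2 x0 - f1 x0 *m Q); split; last first.
  exact: derive_zero_affine cU Ux0 C1.1 C2.1 J12.
have u1 := J1u x0 Ux0; have E := JJ x0 Ux0.
rewrite /Q; move: u1 E; move: ('J f1 x0) ('J f2 x0) => A B u1 E.
rewrite trmx_mul mulmxA -(mulmxA (invmx _)) -E !mulmxA mulVmx//.
by rewrite mul1mx trmx_inv mulmxV// unitmx_tr.
Qed.

(** In the flat coordinates [f] the level sets of [u] are parallel hyperplanes, so their normal is a
    constant vector there. Hence its covariant derivative vanishes in every direction. *)
Lemma parallel_second_fundamental_form m (U : set 'rV[R]_m)
    (f : 'rV[R]_m -> 'rV[R]_m) (G : 'rV[R]_m -> 'M[R]_m) (u : 'rV[R]_m -> R)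
    (v x X Y : 'rV[R]_m) :
  open U -> U x -> Ck 2 U f ->
  (forall y, U y -> G y = 'J f y *m ('J f y)^T) ->
  (forall y, U y -> 'J f y \in unitmx) ->
  (forall y, U y -> u y = (f y *m v^T) 0 0) ->
  second_fundamental_form G u x X Y = 0.
Proof.
move=> oU Ux C2 GE Ju uE.
have dJ : differentiable (jacobian f) x by exact: differentiable_jacobian oU Ux C2.
have CJ i := @christoffel_jacobian _ _ U f G oU C2 GE x i Ux (Ju x Ux).
have puE i y : U y -> pd u i y = (v *m ('J f y)^T) 0 i.
  move=> Uy.
  have N : \near y, (f y *m v^T) 0 0 = u y.
    by near=> z; rewrite uE//; near: z; exact: open_nbhs_nbhs.
  rewrite /pd -(near_eq_derive _ N).
  have dfy : derivable f y (delta_mx 0 i) by exact/diff_derivable/C2.1.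
  have [d1 d2] := derive_mulmx_cst v^T dfy.
  have := derive_mx d1; rewrite d2 => /matrixP /(_ 0 0); rewrite [RHS]mxE => <-.
  rewrite (deriveEjacobian _ (C2.1 y Uy)) -rowE.
  move: ('J f y) => A.
  by rewrite !mxE; apply: eq_bigr => k _; rewrite !mxE mulrC.
move: CJ GE Ju puE dJ; move: (jacobian f) => J CJ GE Ju puE dJ.
have gradE y : U y -> gradient G u y = v *m invmx (J y).
  move=> Uy; rewrite /gradient.
  have -> : \row_i pd u i y = v *m (J y)^T.
    by apply/rowP => i; rewrite [LHS]mxE puE.
  rewrite GE// invmx_mul ?unitmx_tr ?Ju// mulmxA -(mulmxA v) mulmxV ?unitmx_tr ?Ju//.
  by rewrite mulmx1.
(* The gradient is [v J^-1], and its length for [G = J J^T] is the Euclidean length of [v]; so the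
   normalizing factor does not depend on the point. *)
pose c := (Num.sqrt ((v *m v^T) 0 0))^-1.
pose N y := (c *: v) *m invmx (J y).
have nE y : U y -> unit_normal G u y = N y.
  move=> Uy; rewrite /unit_normal gradE// /N -scalemxAl /inner; congr (_ *: _).
  congr ((Num.sqrt _)^-1); rewrite GE// trmx_mul trmx_inv !mulmxA mulmxKV ?Ju//.
  by rewrite -[X in (X *m _) 0 0]mulmxA mulmxV ?unitmx_tr ?Ju// mulmx1.
suff cd0 : covariant_derivative G X (unit_normal G u) x = 0.
  by rewrite /second_fundamental_form cd0 /inner !mul0mx mxE oppr0.
have nN : \near x, N x = unit_normal G u x.
  by near=> z; rewrite nE//; near: z; exact: open_nbhs_nbhs.
have dN : differentiable N x.
  have dI : differentiable (fun z => invmx (J z)) x.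
    exact: differentiable_invmx dJ (Ju x Ux).
  apply: differentiable_mx => i j.
  have -> : (fun z => N z i j) = (fun z => \sum_k (c *: v) i k * invmx (J z) k j).
    by apply/funext => z; rewrite [LHS]mxE.
  apply: differentiable_bigsum => k; apply: differentiableM.
    exact: differentiable_cst.
  exact: (differentiable_entry k j dI).
(* Differentiate the constant [N J = c v] and replace the derivative of [J] by the Christoffel
   matrix times [J]; then cancel [J]. *)
have key i : 'D_(delta_mx 0 i) N x + N x *m christoffel_mx G i x = 0.
  have dN' := diff_derivable (v := delta_mx 0 i) dN.
  have dJ' := diff_derivable (v := delta_mx 0 i) dJ.
  have E := derive_val (is_derive := is_derive_mulmx dN' dJ').
  have nc : \near x, (N x *m J x) = cst (c *: v) x.
    near=> z; rewrite /N mulmxKV//; apply: Ju; near: z; exact: open_nbhs_nbhs.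
  rewrite (near_eq_derive _ nc) derive_cst CJ mulmxA -mulmxDl in E.
  by rewrite -[LHS](mulmxK (Ju x Ux)) -E mul0mx.
have pN i k : pd (fun y => unit_normal G u y 0 k) i x = 'D_(delta_mx 0 i) N x 0 k.
  have D := near_eq_is_derive nN (DeriveDef (diff_derivable (v := delta_mx 0 i) dN) erefl).
  rewrite -(derive_val (is_derive := D)) (derive_mx (ex_derive (is_derive := D))).
  by rewrite [RHS]mxE.
apply/rowP => k; rewrite [LHS]mxE [RHS]mxE big1// => i _.
have /matrixP /(_ 0 k) := key i; rewrite [LHS]mxE [RHS]mxE -pN => E.
suff -> : \sum_j christoffel G k i j x * unit_normal G u x 0 j = (N x *m christoffel_mx G i x) 0 k.
  by rewrite E mulr0.
rewrite [RHS]mxE; apply: eq_bigr => j _.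
by rewrite nE// mulrC [X in _ = _ * X]mxE.
Unshelve. all: by end_near. Qed.

End Rigidity.

(** * Flat maps on a Riemannian manifold with boundary *)

Section Within.
Context {R : realType} {m : nat}.
Implicit Types W : normedModType R.

Lemma half_space_pos (x v : 'rV[R]_m.+1) (t : R) : half_space R m x ->
  0 <= v ord0 ord0 -> 0 <= t -> half_space R m (x + t *: v).
Proof.
by move=> Hx v0 t0; rewrite /half_space /= !mxE addr_ge0 ?mulr_ge0.
Qed.

(** Vectors with nonnegative first coordinate point into the half-space, so the expansion along [A]
    determines the differential on them. Any other vector is the opposite of such a vector, and
    linearity finishes. *)
Lemma is_dwithin_unique W (A : set 'rV[R]_m.+1) (f : 'rV[R]_m.+1 -> W) x
    (L L' : {linear 'rV[R]_m.+1 -> W}) :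
  half_space R m x -> (\forall y \near x, half_space R m y -> A y) ->
  is_dwithin A f x L -> is_dwithin A f x L' -> forall v, L v = L' v.
Proof.
move=> Hx HA [Lc dL] [Lc' dL'].
suff P (v : 'rV[R]_m.+1) : 0 <= v ord0 ord0 -> L v = L' v.
  move=> v; case: (leP 0 (v ord0 ord0)) => [/P//|v0].
  apply: oppr_inj; rewrite -(linearN L) -(linearN L'); apply: P.
  by rewrite mxE oppr_ge0 ltW.
move=> v0; apply/eqP; rewrite -subr_eq0 -normr_le0.
have [->|vn0] := eqVneq v 0; first by rewrite (linear0 L) (linear0 L') subrr normr0.
have nv : 0 < `|v| by rewrite normr_gt0.
apply/ler_addgt0Pl => e e0; rewrite addr0.
have e2 : 0 < e / 2 / `|v| by rewrite !divr_gt0.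
have /nbhs_ballP[r /= r0 H] : nbhs x [set y | (half_space R m y -> A y) /\
    ((A y -> `|f y - f x - L (y - x)| <= e / 2 / `|v| * `|y - x|) /\
     (A y -> `|f y - f x - L' (y - x)| <= e / 2 / `|v| * `|y - x|))].
  have d1 : nbhs x [set y | A y -> `|f y - f x - L (y - x)| <= e / 2 / `|v| * `|y - x|].
    exact: dL.
  have d2 : nbhs x [set y | A y -> `|f y - f x - L' (y - x)| <= e / 2 / `|v| * `|y - x|].
    exact: dL'.
  by apply: filterS3 HA d1 d2.
(* The step [t v] stays in the ball, and each expansion errs by at most [t e / 2] on it. Dividing by
   [t] bounds the difference on [v] by [e]. *)
pose t := r / 2 / `|v|.
have t0 : 0 < t by rewrite !divr_gt0.
have xb : ball x r (x + t *: v).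
  rewrite -ball_normE /= opprD addrA subrr sub0r normrN normrZ gtr0_norm//.
  by rewrite divfK ?gt_eqF// ltr_pdivrMr// ltr_pMr// ltr1n.
have [hA [/= h1 h2]] := H _ xb.
have Ax := hA (half_space_pos Hx v0 (ltW t0)).
have {}h1 := h1 Ax; have {}h2 := h2 Ax.
have E : x + t *: v - x = t *: v by rewrite addrAC subrr add0r.
rewrite E in h1 h2.
have h : `|L (t *: v) - L' (t *: v)| <= t * e.
  set D := f _ - f x in h1 h2.
  have -> : L (t *: v) - L' (t *: v) = (D - L' (t *: v)) - (D - L (t *: v)).
    by rewrite opprB [RHS]addrC subrKA.
  apply: le_trans (ler_normB _ _) _.
  apply: le_trans (lerD h2 h1) _.
  rewrite normrZ gtr0_norm// mulrCA divfK ?gt_eqF//.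
  by rewrite -mulrDr -splitr.
have hL : L (t *: v) = t *: L v by rewrite linearZ.
have hL' : L' (t *: v) = t *: L' v by rewrite linearZ.
rewrite hL hL' -scalerBr normrZ gtr0_norm// in h.
by rewrite ler_pM2l in h.
Qed.

(** [dwithin] is obtained by choice; uniqueness allows computing it from any differentiable
    extension [F], boundary points included. *)
Lemma dwithinE W (A : set 'rV[R]_m.+1) (f F : 'rV[R]_m.+1 -> W) x v :
  half_space R m x -> (\forall y \near x, half_space R m y -> A y) ->
  differentiable F x -> (\forall y \near x, A y -> F y = f y) -> A x ->
  dwithin A f x v = 'd F x v.
Proof.
move=> Hx HA dF Ff Ax.
have D : is_dwithin A f x ('d F x).
  split; first by case: dF => [[]].
  move=> e e0; have h := diff_expansion dF e0.
  rewrite -(nbhs_singleton Ff Ax).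
  apply: filterS2 Ff h => y Fy hy Ay.
  by rewrite -(Fy Ay).
have : is_dwithin A f x (dwithin A f x) by apply: getPex; exists ('d F x).
by move=> /is_dwithin_unique/(_ D); exact.
Qed.

End Within.

Section Flat.
Context {R : realType} {m : nat} {E : smooth_manifold R m}.
Variable g : riemannian_metric E.
Implicit Types (c : chart R m E) (F : E -> 'rV[R]_m.+1) (W : set E).

(** Half-balls play the part of coordinate balls, which do not exist at boundary points. *)
Lemma chart_ball c e (N : set E) : @atlas R m E c -> cdom c e -> nbhs e N ->
  exists2 r : R, 0 < r & forall y, ball (cmap c e) r y -> half_space R m y ->
    cimg c y /\ N (cinv c y).
Proof.
move=> Ac ce Ne; have [oc [Ob [oO OE]] cK _ ic] := atlas_charts Ac.
have xc : cimg c (cmap c e) by exists e.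
have Ne' : nbhs (cinv c (cmap c e)) N by rewrite cK.
have := (subspace_continuousP _ _).1 ic _ xc _ Ne'; rewrite /within /=.
have xO : Ob (cmap c e) by move: xc; rewrite OE => -[].
have : nbhs (cmap c e) Ob by exact: open_nbhs_nbhs.
move=> h2 h1.
have /nbhs_ballP[r /= r0 H] : nbhs (cmap c e) (Ob `&` [set y | cimg c y -> N (cinv c y)]).
  by apply: filterI.
exists r => // y /H[/= Oy Ny] Hy.
have cy : cimg c y by rewrite OE.
by split=> //; exact: Ny.
Qed.

Lemma chart_half_space c e : @atlas R m E c -> cdom c e -> half_space R m (cmap c e).
Proof.
move=> Ac ce; have [oc [Ob [oO OE]] _ _ _] := atlas_charts Ac.
have : cimg c (cmap c e) by exists e.
by rewrite OE => -[].
Qed.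

Lemma chart_near c e (N : set 'rV[R]_m.+1) : @atlas R m E c -> cdom c e ->
  nbhs (cmap c e) N -> \forall e' \near e, cdom c e' /\ N (cmap c e').
Proof.
move=> Ac ce Nx; have [oc _ _ cc _] := atlas_charts Ac.
have h : nbhs e [set e' | cdom c e' -> N (cmap c e')].
  exact: (subspace_continuousP _ _).1 cc _ ce _ Nx.
have h2 : nbhs e (cdom c) by exact: open_nbhs_nbhs.
by apply: filterS2 h h2 => e' /= h' ce'; split=> //; exact: h'.
Qed.

(* [Phi] is a smooth extension of [F] read in the chart [c]; its jacobian gives
   the metric up to the boundary. *)
Definition flat_rep c (x : 'rV[R]_m.+1) (r : R) (Phi : 'rV[R]_m.+1 -> 'rV[R]_m.+1) F :=
  (forall k, Ck k (ball x r) Phi) /\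
  forall y, ball x r y -> half_space R m y ->
    [/\ cimg c y, Phi y = F (cinv c y) &
        gram g c y = 'J Phi y *m ('J Phi y)^T].

(** Local isometry to Euclidean space up to the boundary. Asking for extensions to full balls makes
    ordinary differential calculus available at boundary points. *)
Definition flat_on W F := open W /\
  forall e c, W e -> @atlas R m E c -> cdom c e ->
    exists r Phi, 0 < r /\ flat_rep c (cmap c e) r Phi F.

Lemma flat_on_sub W W' F : W' `<=` W -> open W' -> flat_on W F -> flat_on W' F.
Proof. by move=> WW oW' [oW h]; split=> // e c /WW; exact: h. Qed.

Lemma flat_rep_sub c x r r' Phi F : r' <= r ->
  flat_rep c x r Phi F -> flat_rep c x r' Phi F.
Proof.
move=> rr [h1 h2]; have s : ball x r' `<=` ball x r by exact: le_ball.
by split=> [k|y /s]; [exact: Ck_sub s (h1 k)|exact: h2].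
Qed.

Lemma flat_on_ext W F F' : (forall e, W e -> F e = F' e) ->
  flat_on W F -> flat_on W F'.
Proof.
move=> FF [oW h]; split=> // e c We Ac ce.
have [r [Phi [r0 H]]] := h e c We Ac ce.
have [r' r'0 H'] := chart_ball Ac ce (open_nbhs_nbhs (conj oW We)).
exists (Num.min r r'), Phi; split; first by rewrite lt_min r0.
have [h1 h2] : flat_rep c (cmap c e) (Num.min r r') Phi F.
  by apply: flat_rep_sub H; rewrite ge_min lexx.
split=> // y yb Hy; have [p1 p2 p3] := h2 y yb Hy; split=> //.
rewrite p2 FF//; apply: (H' y _ Hy).2.
by apply: le_ball yb; rewrite ge_min lexx orbT.
Qed.

Lemma mulmxr_continuous k p (Q : 'M[R]_(k, p)) :
  continuous (mulmxr Q : 'rV[R]_k -> 'rV[R]_p).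
Proof.
move=> x; apply: differentiable_continuous.
by apply: (@differentiable_mulmx_cst _ _ _ _ _ id).
Qed.

Lemma jacobian_affine k p (f : 'rV[R]_k -> 'rV[R]_p) q (Q : 'M[R]_(p, q)) b x :
  differentiable f x -> 'J (fun y => f y *m Q + b) x = 'J f x *m Q.
Proof.
move=> df; apply/row_matrixP => i; rewrite !rowE mulmxA.
have d1 := differentiable_mulmx_cst Q df.
have d2 : differentiable (fun y => f y *m Q + b) x.
  by apply: differentiableD => //; exact: differentiable_cst.
rewrite -(deriveEjacobian _ d2) -(deriveEjacobian _ df).
have D1 := derive_mulmx_cst Q (diff_derivable (v := delta_mx 0 i) df).
rewrite -(derive_val (is_derive := D1)).
have dc : derivable (cst b : 'rV[R]_k -> _) x (delta_mx 0 i).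
  exact/diff_derivable/differentiable_cst.
have := deriveD (ex_derive (is_derive := D1)) dc.
by rewrite derive_cst addr0.
Qed.

Lemma flat_on_affine W F Q b : Q *m Q^T = 1%:M -> flat_on W F ->
  flat_on W (fun e => F e *m Q + b).
Proof.
move=> QQ [oW h]; split=> // e c We Ac ce.
have [r [Phi [r0 [h1 h2]]]] := h e c We Ac ce.
exists r, (fun y => Phi y *m Q + b); split; first exact: r0.
split.
  move=> k; apply: Ck_addc; first exact: ball_open.
  apply: (@Ck_lin _ _ _ _ k _ Phi (mulmxr Q)); first exact: ball_open.
    exact: mulmxr_continuous.
  exact: h1.
move=> y yb Hy; have [p1 p2 p3] := h2 y yb Hy; split; first exact: p1.
  by rewrite p2.
rewrite (jacobian_affine Q b ((h1 1%N).1 y yb)) p3.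
by move: ('J Phi y) => J; rewrite trmx_mul mulmxA -(mulmxA J) QQ mulmx1.
Qed.

Lemma inner_delta k (G : 'M[R]_k) i j : inner G (delta_mx 0 i) (delta_mx 0 j) = G i j.
Proof. by rewrite /inner -rowE trmx_delta -colE !mxE. Qed.

(** The differential along the chart image is the Jacobian of a smooth extension, and testing the
    isometry condition on pairs of basis vectors gives the Gram matrix. *)
Lemma flat_on_of_isometry W F : open W -> smooth_from W F ->
  (forall c x (X Y : 'rV[R]_m.+1), @atlas R m E c -> (cmap c @` (W `&` cdom c)) x ->
     let L := dwithin (cmap c @` (W `&` cdom c)) (F \o cinv c) x in
     inner (gram g c x) X Y = inner 1%:M (L X) (L Y)) ->
  flat_on W F.
Proof.
move=> oW sF iF; split=> // e c We Ac ce.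
have [_ _ cK _ _] := atlas_charts Ac.
set A := cmap c @` (W `&` cdom c).
have AE y : cimg c y -> W (cinv c y) -> A y.
  by move=> [e' ce' <-]; rewrite cK// => We'; exists e'.
have xA : A (cmap c e) by exists e.
have [U [Phi [oU Ux CPhi PhiE]]] := sF c Ac (cmap c e) xA.
have [r1 r10 H1] := chart_ball Ac ce (open_nbhs_nbhs (conj oW We)).
have /nbhs_ballP[r2 /= r20 H2] := open_nbhs_nbhs (conj oU Ux).
exists (Num.min r1 r2), Phi; split; first by rewrite lt_min r10.
have s1 : ball (cmap c e) (Num.min r1 r2) `<=` ball (cmap c e) r1.
  by apply: le_ball; rewrite ge_min lexx.
have s2 : ball (cmap c e) (Num.min r1 r2) `<=` U.
  by apply: subset_trans H2; apply: le_ball; rewrite ge_min lexx orbT.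
split=> [k|y yb Hy]; first exact: Ck_sub s2 (CPhi k).
have [cy Wy] := H1 y (s1 _ yb) Hy.
have Ay := AE y cy Wy; split=> //; first by rewrite (PhiE y Ay (s2 _ yb)).
have dPhi : differentiable Phi y by apply: (CPhi 1%N).1; exact: s2.
have nb : \forall z \near y, ball (cmap c e) (Num.min r1 r2) z.
  by apply: open_nbhs_nbhs; split=> //; exact: ball_open.
have L X : dwithin A (F \o cinv c) y X = X *m 'J Phi y.
  rewrite (@dwithinE _ _ _ A (F \o cinv c) Phi)//.
  - by rewrite /jacobian mul_rV_lin1.
  - by apply: filterS nb => z /s1 /H1 h /h[]; exact: AE.
  - by apply: filterS nb => z /s2 Uz Az; exact: PhiE.
apply/matrixP => i j; rewrite -inner_delta iF// !L.
rewrite -[RHS]inner_delta /inner mulmx1 trmx_mul.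
by rewrite !mulmxA.
Qed.

(** A nonzero vector killed by [J] would have length zero for the metric. *)
Lemma unitmx_of_gram c x (J : 'M[R]_m.+1) : @atlas R m E c -> cimg c x ->
  gram g c x = J *m J^T -> J \in unitmx.
Proof.
move=> Ac cx GE; rewrite -row_free_unit; apply: inj_row_free => v vJ.
apply/eqP; apply/negPn/negP => v0.
have := gram_pos g Ac cx v0.
by rewrite GE /inner mulmxA vJ !mul0mx mxE ltxx.
Qed.

Lemma convex_ball (V : normedModType R) (x : V) (r : R) : convex_on (ball x r).
Proof.
move=> y z t; rewrite -ball_normE /= => yb zb /andP[t0 t1].
have -> : x - (y + t *: (z - y)) = (1 - t) *: (x - y) + t *: (x - z).
  rewrite [RHS](_ : _ = x - y + t *: (y - z)); last first.
    by rewrite scalerBl scale1r -addrA -scalerN -scalerDr opprB subrKA.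
  by rewrite opprD addrA -scalerN opprB.
have r0 : 0 < r by apply: le_lt_trans yb.
apply: le_lt_trans (ler_normD _ _) _; rewrite !normrZ.
rewrite (ger0_norm t0) ger0_norm ?subr_ge0//.
have [->|tn0] := eqVneq t 0; first by rewrite subr0 mul1r mul0r addr0.
have tp : 0 < t by rewrite lt_def tn0.
rewrite -[ltRHS](_ : (1 - t) * r + t * r = r); last by rewrite mulrBl mul1r subrK.
apply: ler_ltD; last by rewrite ltr_pM2l.
by apply: ler_wpM2l; [rewrite subr_ge0|exact: ltW].
Qed.

Lemma convex_onI (V : normedModType R) (A B : set V) :
  convex_on A -> convex_on B -> convex_on (A `&` B).
Proof.
by move=> cA cB x y t [Ax Bx] [Ay By] t01; split; [exact: cA|exact: cB].
Qed.

End Flat.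

Section FlatRigidity.
Context {R : realType} {m : nat} {E : smooth_manifold R m}.
Variable g : riemannian_metric E.
Implicit Types (c : chart R m E) (F : E -> 'rV[R]_m.+1) (W : set E).

Lemma small_step (V : normedModType R) (x v : V) (r : R) : 0 < r ->
  exists2 t : R, 0 < t & ball x r (x + t *: v).
Proof.
move=> r0; have d0 : 0 < `|v| + 1 by rewrite ltr_wpDl.
exists (r / 2 / (`|v| + 1)); first by rewrite !divr_gt0.
rewrite -ball_normE /= opprD addrA subrr sub0r normrN normrZ gtr0_norm ?divr_gt0//.
apply: (@le_lt_trans _ _ (r / 2)); last by rewrite ltr_pdivrMr// ltr_pMr// ltr1n.
by rewrite mulrAC ler_pdivrMr// ler_pM2l ?divr_gt0// lerDl.
Qed.

Definition upper : set 'rV[R]_m.+1 := [set z | 0 < z ord0 ord0].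

Lemma open_upper : open upper.
Proof.
have -> : upper = (fun z : 'rV[R]_m.+1 => z ord0 ord0 : R) @^-1` [set t | 0 < t] by [].
apply: open_comp; last exact: open_gt.
by move=> z _; exact: coord_continuous.
Qed.

Lemma convex_upper : convex_on upper.
Proof.
move=> x y t; rewrite /upper /= => x0 y0 /andP[t0 t1].
rewrite !mxE; move: (x ord0 ord0) (y ord0 ord0) x0 y0 => a b a0 b0.
have -> : a + t * (b - a) = (1 - t) * a + t * b by ring.
have [->|tn0] := eqVneq t 0; first by rewrite mul0r addr0 subr0 mul1r.
have tp : 0 < t by rewrite lt_def tn0.
by rewrite ltr_wpDl// ?mulr_gt0// mulr_ge0 ?subr_ge0// ltW.
Qed.

Lemma upper_half_space z : upper z -> half_space R m z.
Proof. exact: ltW. Qed.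

Lemma upper_step (y : 'rV[R]_m.+1) r : 0 < r -> half_space R m y ->
  exists2 z, ball y r z & upper z.
Proof.
move=> r0 Hy; have [t t0 b] := small_step y (delta_mx 0 0) r0.
exists (y + t *: delta_mx 0 0) => //.
by rewrite /upper /= !mxE !eqxx mulr1 ltr_wpDl.
Qed.

Lemma cvg0_upper (V : normedModType R) (D : 'rV[R]_m.+1 -> V) (U : set 'rV[R]_m.+1) y :
  open U -> U y -> half_space R m y -> {for y, continuous D} ->
  (forall z, U z -> upper z -> D z = 0) -> D y = 0.
Proof.
move=> oU Uy Hy cD D0; apply/eqP; rewrite -normr_le0.
apply/ler_addgt0Pl => e e0; rewrite addr0.
move/cvgrPdist_lt : cD => /(_ _ e0) nD.
have nU : nbhs y U by exact: open_nbhs_nbhs.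
have /nbhs_ballP[r /= r0 H] : nbhs y (U `&` [set z | `|D y - D z| < e]).
  exact: filterI.
have [z zb zu] := upper_step r0 Hy.
by have [Uz /= /ltW] := H z zb; rewrite (D0 z Uz zu) subr0.
Qed.

(** Outside the half-space the extensions [Phi1] and [Phi2] are unrelated to the metric. So rigidity
    is applied on the part of the ball with positive first coordinate, which is open, convex and
    nonempty, and the relation reaches the boundary points by continuity. *)
Lemma flat_rigid W1 W2 F1 F2 e : flat_on g W1 F1 -> flat_on g W2 F2 ->
  W1 e -> W2 e ->
  exists Q b, Q *m Q^T = 1%:M /\ \forall e' \near e, F2 e' = F1 e' *m Q + b.
Proof.
move=> [oW1 h1] [oW2 h2] W1e W2e.
have [c Ac ce] := atlas_cover e.
have [r1 [Phi1 [r10 R1]]] := h1 e c W1e Ac ce.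
have [r2 [Phi2 [r20 R2]]] := h2 e c W2e Ac ce.
pose r := Num.min r1 r2.
have r0 : 0 < r by rewrite lt_min r10.
have [S1 P1] : flat_rep g c (cmap c e) r Phi1 F1.
  by apply: flat_rep_sub R1; rewrite ge_min lexx.
have [S2 P2] : flat_rep g c (cmap c e) r Phi2 F2.
  by apply: flat_rep_sub R2; rewrite ge_min lexx orbT.
pose U := ball (cmap c e) r `&` upper.
have oB : open (ball (cmap c e) r) by exact: ball_open.
have oU : open U by apply: openI => //; exact: open_upper.
have cU : convex_on U by apply: convex_onI; [exact: convex_ball|exact: convex_upper].
have UB : U `<=` ball (cmap c e) r by move=> y [].
have U0 : U !=set0.
  have [z zb zu] := upper_step r0 (chart_half_space Ac ce).
  by exists z.
have J1u y : U y -> 'J Phi1 y \in unitmx.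
  move=> [yb /upper_half_space Hy]; have [p1 p2 p3] := P1 y yb Hy.
  exact: unitmx_of_gram Ac p1 p3.
have JJ y : U y -> 'J Phi1 y *m ('J Phi1 y)^T = 'J Phi2 y *m ('J Phi2 y)^T.
  move=> [yb /upper_half_space Hy]; have [_ _ p3] := P1 y yb Hy.
  by have [_ _ p3'] := P2 y yb Hy; exact: (etrans (esym p3) p3').
have [Q [b [QQ H]]] := rigidity_convex oU cU (Ck_sub UB (S1 2%N)) (Ck_sub UB (S2 2%N)) U0 J1u JJ.
exists Q, b; split; first exact: QQ.
have HB y : ball (cmap c e) r y -> half_space R m y -> Phi2 y = Phi1 y *m Q + b.
  move=> yb Hy; apply/eqP; rewrite -subr_eq0; apply/eqP.
  have c1 : differentiable Phi1 y by exact: (S1 1%N).1.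
  have c2 : differentiable Phi2 y by exact: (S2 1%N).1.
  have cD : {for y, continuous (fun z => Phi2 z - (Phi1 z *m Q + b))}.
    apply: differentiable_continuous; apply: differentiableB; first exact: c2.
    apply: differentiableD; first exact: differentiable_mulmx_cst.
    exact: differentiable_cst.
  apply: (cvg0_upper oB yb Hy cD) => z zb zu.
  by rewrite (H z (conj zb zu)) subrr.
have nb : nbhs (cmap c e) (ball (cmap c e) r) by exact: nbhsx_ballx.
have := chart_near Ac ce nb; apply: filterS => e' [ce' yb].
have Hy := chart_half_space Ac ce'.
have [_ _ cK _ _] := atlas_charts Ac.
have [_ q1 _] := P1 _ yb Hy; have [_ q2 _] := P2 _ yb Hy.
rewrite cK// in q1; rewrite cK// in q2.
by rewrite -q1 -q2; exact: HB.
Qed.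

Lemma row_mulmx_inj p q (A B : 'M[R]_(p, q)) :
  (forall v : 'rV[R]_p, v *m A = v *m B) -> A = B.
Proof. by move=> AB; apply/row_matrixP => i; rewrite !rowE. Qed.

Lemma near_eq_jacobian p q (f h : 'rV[R]_p -> 'rV[R]_q) y :
  differentiable f y -> (\near y, f y = h y) -> 'J f y = 'J h y.
Proof.
move=> df fh; have dh := near_eq_differentiable fh df.
have K (v : 'rV[R]_p) : v *m 'J f y = v *m 'J h y.
  have e1 := deriveEjacobian v df.
  have e2 := deriveEjacobian v dh.
  have e3 := @near_eq_derive R _ _ f h y v fh.
  exact: etrans (esym e1) (etrans e3 e2).
apply: row_mulmx_inj K.
Qed.

(** The germ of a flat map determines the rigid motion applied to it: compare Jacobians and cancel
    the invertible one of [F]. This is the freeness required by the gluing argument. *)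
Lemma flat_affine_inj W F e (Q Q' : 'M[R]_m.+1) b b' : flat_on g W F -> W e ->
  (\forall e' \near e, F e' *m Q + b = F e' *m Q' + b') -> Q = Q' /\ b = b'.
Proof.
move=> [oW h] We N.
suff QE : Q = Q'.
  by split=> //; have := nbhs_singleton N; rewrite /= QE; exact: addrI.
have [c Ac ce] := atlas_cover e.
have [r [Phi [r0 [S P]]]] := h e c We Ac ce.
have [r' r'0 H'] := chart_ball Ac ce N.
pose s := Num.min r r'.
have s0 : 0 < s by rewrite lt_min r0.
have sr : ball (cmap c e) s `<=` ball (cmap c e) r by apply: le_ball; rewrite ge_min lexx.
have sr' : ball (cmap c e) s `<=` ball (cmap c e) r'.
  by apply: le_ball; rewrite ge_min lexx orbT.
(* [e] may lie on the boundary, so the Jacobians are compared at a nearby point [y] with a full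
   neighbourhood inside the half-space. *)
have [y yb yu] := upper_step s0 (chart_half_space Ac ce).
have dPhi : differentiable Phi y by exact/(S 1%N).1/sr.
have ny : \near y, Phi y *m Q + b = Phi y *m Q' + b'.
  have n1 : nbhs y (ball (cmap c e) s) by apply: open_nbhs_nbhs; split=> //; exact: ball_open.
  have n2 : nbhs y upper by apply: open_nbhs_nbhs; split=> //; exact: open_upper.
  apply: filterS2 n1 n2 => z zs /upper_half_space Hz.
  have [_ -> _] := P z (sr _ zs) Hz.
  exact: (H' z (sr' _ zs) Hz).2.
have dA : differentiable (fun y => Phi y *m Q + b) y.
  by apply: differentiableD; [exact: differentiable_mulmx_cst|exact: differentiable_cst].
have := near_eq_jacobian dA ny; rewrite (jacobian_affine Q b dPhi) (jacobian_affine Q' b' dPhi).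
have [cy _ GE] := P y (sr _ yb) (upper_half_space yu).
have Ju := unitmx_of_gram Ac cy GE.
by move=> /(can_inj (mulKmx Ju)).
Qed.

Section HyperplaneFunction.
Variables (W : set E) (F : E -> 'rV[R]_m.+1) (v : 'rV[R]_m.+1) (u : E -> R).
Hypotheses (fF : flat_on g W F) (uE : forall e, W e -> u e = (F e *m v^T) 0 0).

Lemma Ck_form k (U : set 'rV[R]_m.+1) (Phi : 'rV[R]_m.+1 -> 'rV[R]_m.+1) : open U ->
  Ck k U Phi -> Ck k U (fun y => (Phi y *m v^T) 0 0).
Proof.
move=> oU C; apply: (@Ck_entry _ _ _ _ k U (fun y => Phi y *m v^T) 0 0 oU).
exact: (@Ck_lin _ _ _ _ k U Phi (mulmxr v^T) oU (@mulmxr_continuous _ _ _ _) C).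
Qed.

Lemma flat_form_rep c e : W e -> @atlas R m E c -> cdom c e ->
  exists r Phi, [/\ 0 < r, flat_rep g c (cmap c e) r Phi F &
    forall y, ball (cmap c e) r y -> half_space R m y ->
      [/\ W (cinv c y) & (Phi y *m v^T) 0 0 = u (cinv c y)]].
Proof.
move=> We Ac ce; have [oW h] := fF.
have [r [Phi [r0 RP]]] := h e c We Ac ce.
have [r' r'0 H'] := chart_ball Ac ce (open_nbhs_nbhs (conj oW We)).
exists (Num.min r r'), Phi.
have RP' : flat_rep g c (cmap c e) (Num.min r r') Phi F.
  by apply: flat_rep_sub RP; rewrite ge_min lexx.
split; [by rewrite lt_min r0|exact: RP'|move=> y yb Hy].
have Wy : W (cinv c y).
  apply: (H' y _ Hy).2; apply: le_ball yb; by rewrite ge_min lexx orbT.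
have [_ q _] := RP'.2 y yb Hy.
by split; [exact: Wy|rewrite q uE].
Qed.

Lemma flat_form_smooth : smooth_from W u.
Proof.
move=> c Ac x [e [We ce] <-].
have [r [Phi [r0 RP H]]] := flat_form_rep We Ac ce.
exists (ball (cmap c e) r), (fun y => (Phi y *m v^T) 0 0).
split; [exact: ball_open|exact: ballxx| |].
  by move=> k; apply: Ck_form; [exact: ball_open|exact: RP.1].
move=> y [e' [We' ce'] <-] yb.
exact: (H _ yb (chart_half_space Ac ce')).2.
Qed.

Lemma diff_form (Phi : 'rV[R]_m.+1 -> 'rV[R]_m.+1) x X : differentiable Phi x ->
  differentiable (fun y => (Phi y *m v^T) 0 0) x /\
  'd (fun y => (Phi y *m v^T) 0 0) x X = (X *m 'J Phi x *m v^T) 0 0.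
Proof.
move=> dP; have d1 := differentiable_mulmx_cst v^T dP.
have d2 := differentiable_entry 0 0 d1; split; first exact: d2.
rewrite -deriveE; last exact: d2.
have D := derive_mulmx_cst v^T (diff_derivable (v := X) dP).
rewrite -(deriveEjacobian _ dP) -(derive_val (is_derive := D)).
by rewrite (derive_mx (ex_derive (is_derive := D))) [RHS]mxE.
Qed.

Lemma flat_form_submersion c x : v != 0 -> @atlas R m E c ->
  (cmap c @` (W `&` cdom c)) x ->
  exists X, dwithin (cmap c @` (W `&` cdom c)) (u \o cinv c) x X != 0.
Proof.
move=> v0 Ac xA; have [e [We ce] ex] := xA.
have [_ _ cK _ _] := atlas_charts Ac.
have [r [Phi [r0 [S P] H]]] := flat_form_rep We Ac ce.
have Hx := chart_half_space Ac ce.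
have [cx _ GE] := P _ (ballxx _ r0) Hx.
have Ju := unitmx_of_gram Ac cx GE.
have dPhi : differentiable Phi (cmap c e) by apply: (S 1%N).1; exact: ballxx.
(* The differential of [Phi] sends this vector to [v], on which the linear form takes the value
   [v v^T], a nonzero sum of squares. *)
exists (v *m invmx ('J Phi (cmap c e))).
have nb : nbhs (cmap c e) (ball (cmap c e) r) by exact: nbhsx_ballx.
have [dF dE] := diff_form (v *m invmx ('J Phi (cmap c e))) dPhi.
rewrite -ex in xA *.
rewrite (dwithinE (F := fun y => (Phi y *m v^T) 0 0) _ Hx _ dF _ xA).
- rewrite dE mulmxKV//.
  apply: contra v0 => /eqP vv; apply/eqP/rowP => i; rewrite mxE.
  move: vv; rewrite mxE => /eqP; rewrite psumr_eq0 => [/allP/(_ i)|j _].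
    by rewrite mem_index_enum /= mxE -expr2 sqrf_eq0 => /(_ isT)/eqP.
  by rewrite mxE -expr2 sqr_ge0.
- apply: filterS nb => y yb Hy.
  have [[e' ce' e'y] _ _] := P y yb Hy.
  exists e' => //; split=> //.
  by have [+ _] := H y yb Hy; rewrite -e'y cK.
- apply: filterS nb => y yb [e' [We' ce'] e'y].
  rewrite -e'y in yb *.
  exact: (H _ yb (chart_half_space Ac ce')).2.
Qed.

Lemma flat_form_minimal c x : @atlas R m E c -> interior (cimg c) x ->
  W (cinv c x) -> mean_curvature_zero (gram g c) (u \o cinv c) x.
Proof.
move=> Ac xi Wx.
have [oc [Ob [oO OE]] cK _ _] := atlas_charts Ac.
have [e ce ex] := interior_subset xi.
rewrite -ex cK// in Wx; rewrite -ex in xi *.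
have [r [Phi [r0 [S P] H]]] := flat_form_rep Wx Ac ce.
have /nbhs_ballP[r' /= r'0 H'] := xi.
pose s := Num.min r r'.
have s0 : 0 < s by rewrite lt_min r0.
have sr : ball (cmap c e) s `<=` ball (cmap c e) r by apply: le_ball; rewrite ge_min lexx.
have sr' : ball (cmap c e) s `<=` ball (cmap c e) r'.
  by apply: le_ball; rewrite ge_min lexx orbT.
(* At an interior point of the chart image a full ball lies in the half-space, so the formula for
   the metric holds on an open set and may be differentiated. *)
have Hs y : ball (cmap c e) s y -> half_space R m y.
  by move=> /sr'/H'; rewrite OE => -[].
move=> f _; rewrite /frame_trace big1// => a _.
apply: (@parallel_second_fundamental_form R _ (ball (cmap c e) s) Phi _ _ v).
- exact: ball_open.
- exact: ballxx.
- exact: Ck_sub sr (S 2%N).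
- by move=> y yb; have [_ _ q] := P y (sr _ yb) (Hs _ yb); exact: q.
- move=> y yb; have [q1 _ q] := P y (sr _ yb) (Hs _ yb); exact: unitmx_of_gram Ac q1 q.
- by move=> y yb; have [_ q] := H y (sr _ yb) (Hs _ yb); rewrite /= -q.
Qed.

End HyperplaneFunction.
End FlatRigidity.

(** * Gluing on convex sets *)

Section LocallyConstant.
Context {R : realType}.

(** [T] carries no topology, so [h] is replaced by the real function that only tells whether [h t]
    equals [h 0]. It is locally constant on the segment, hence has zero derivative inside, and the
    mean value theorem applies. *)
Lemma locally_constant_segment (T : Type) (h : R -> T) :
  (forall t : R, 0 <= t <= 1 -> \forall s \near t, 0 <= s <= 1 -> h s = h t) ->
  h 0 = h 1.
Proof.
move=> H; pose f (t : R) : R := if `[< h t = h 0 >] then 0 else 1.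
have f0 : f 0 = 0 by rewrite /f asboolT.
have ff s t : h s = h t -> f s = f t by rewrite /f => ->.
have cf : {within `[0 : R, 1], continuous f}.
  apply/subspace_continuousP => t /=; rewrite in_itv/= => t01.
  apply: (@cvg_trans _ (nbhs (f t))); last exact: cvg_id.
  move=> A /nbhs_singleton At; rewrite /= nbhs_simpl /=.
  have := H t t01; apply: filterS => s hs; rewrite /= in_itv/= => s01.
  by have := At; rewrite -(ff _ _ (hs s01)).
have df (t : R) : t \in `]0, 1[%R -> is_derive t 1 f 0.
  rewrite in_itv/= => /andP[t0 t1].
  have t01 : 0 <= t <= 1 by rewrite !ltW.
  apply: (@near_eq_is_derive _ _ _ (cst (f t))).
    have n0 : \forall s \near t, 0 < s by apply: open_nbhs_nbhs; split=> //; exact: open_gt.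
    have n1 : \forall s \near t, s < 1 by apply: open_nbhs_nbhs; split=> //; exact: open_lt.
    apply: filterS3 (H t t01) n0 n1 => s hs s0 s1.
    by rewrite /= (ff s t)// hs// !ltW.
have [c _] := @MVT_segment R f (fun=> 0) 0 1 ler01 df cf.
rewrite f0 mul0r subr0 /f; case: asboolP => [->//|_ /eqP].
by rewrite oner_eq0.
Qed.

Lemma locally_constant_convex (V : normedModType R) (C : set V) (T : Type) (h : V -> T) x y :
  convex_on C -> (forall z, C z -> \forall w \near z, C w -> h w = h z) ->
  C x -> C y -> h x = h y.
Proof.
move=> cC H Cx Cy.
have := @locally_constant_segment _ (fun t => h (x + t *: (y - x))).
rewrite scale0r addr0 scale1r [x + (y - x)]addrC subrK; apply => t t01.
have Ct := cC x y t Cx Cy t01.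
have c : {for t, continuous (fun s : R => x + s *: (y - x))}.
  apply: continuousD; first exact: cst_continuous.
  exact: scalel_continuous.
have c' : nbhs t [set s : R | C (x + s *: (y - x)) ->
    h (x + s *: (y - x)) = h (x + t *: (y - x))].
  exact: c _ (H _ Ct).
apply: filterS c' => s hs s01.
by apply: hs; exact: cC.
Qed.

End LocallyConstant.

(* [loc x F] says that [F] is near [x] one of the admissible local objects; two
   of these differ near each point by a unique element [g] with [adm g].  Values
   are compared through [agree], which may ignore irrelevant data. *)
Section TorsorSheaf.
Context {R : realType} {V : normedModType R}.
Variables (Y G : Type) (K : set V) (agree : V -> Y -> Y -> Prop).
Variables (act : G -> Y -> Y) (adm : G -> Prop) (one : G) (loc : V -> (V -> Y) -> Prop).

Definition eqnear (x : V) (F F' : V -> Y) :=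
  \forall y \near x, K y -> agree y (F y) (F' y).

Hypotheses (agree_sym : forall x y z, agree x y z -> agree x z y)
  (agree_trans : forall x y z w, agree x y z -> agree x z w -> agree x y w)
  (agree_act : forall x g y z, agree x y z -> agree x (act g y) (act g z))
  (act_one : forall y, act one y = y)
  (loc_ext : forall x F F', K x -> loc x F -> eqnear x F F' -> loc x F')
  (loc_torsor : forall x F F', K x -> loc x F -> loc x F' ->
     exists2 g, adm g & eqnear x F' (fun y => act g (F y)))
  (loc_act : forall x F g, K x -> adm g -> loc x F -> loc x (fun y => act g (F y)))
  (loc_free : forall x F g g', K x -> loc x F ->
     eqnear x (fun y => act g (F y)) (fun y => act g' (F y)) -> g = g').

(** The element relating [F] to [F'] near a point also relates them near all neighbouring points; by
    freeness it is locally constant, hence constant on the convex set [C]. *)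
Lemma torsor_rigid (C : set V) (F F' : V -> Y) :
  C `<=` K -> convex_on C -> (forall x, C x -> loc x F) ->
  (forall x, C x -> loc x F') -> C !=set0 ->
  exists2 g, adm g & forall x, C x -> agree x (F' x) (act g (F x)).
Proof.
move=> CK cC lF lF' [x0 Cx0].
have [gam gamP] : exists gam : V -> G, forall x, C x ->
    adm (gam x) /\ eqnear x F' (fun y => act (gam x) (F y)).
  have : forall x, exists g, C x -> adm g /\ eqnear x F' (fun y => act g (F y)).
    move=> x; have [Cx|nCx] := pselect (C x); last by exists one.
    have [g ag ng] := loc_torsor (CK _ Cx) (lF x Cx) (lF' x Cx).
    by exists g.
  by move=> /choice[gam H]; exists gam.
have gc z : C z -> \forall w \near z, C w -> gam w = gam z.
  move=> Cz; have [_ nz] := gamP z Cz.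
  have := near_join nz; apply: filterS => w nw Cw.
  apply: (loc_free (CK w Cw) (lF w Cw)).
  have [_ nw'] := gamP w Cw.
  apply: filterS2 nw nw' => y h1 h2 Ky.
  exact: agree_trans (agree_sym (h2 Ky)) (h1 Ky).
exists (gam x0); first exact: (gamP x0 Cx0).1.
move=> x Cx; rewrite -(locally_constant_convex cC gc Cx Cx0).
exact: nbhs_singleton (gamP x Cx).2 (CK x Cx).
Qed.

(* Each point [y] of the larger ball gets the section near [y] that matches [F]
   on the smaller ball; [r] is a Lebesgue number, and the overlaps are convex
   and meet the smaller ball. *)
Lemma torsor_extend (x0 : V) (r t : R) (F : V -> Y) : convex_on K -> K x0 ->
  0 < r -> r <= t ->
  (forall x, K x -> exists F, forall y, K y -> `|x - y| < r -> loc y F) ->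
  (forall x, K x -> `|x0 - x| < t -> loc x F) ->
  exists F', forall x, K x -> `|x0 - x| < t + r / 2 -> loc x F'.
Proof.
move=> cK Kx0 r0 rt leb lF.
have cb (x : V) (s : R) : convex_on [set z | `|x - z| < s].
  by have := @convex_ball R V x s; rewrite -ball_normE.
have step y : K y -> `|x0 - y| < t + r / 2 ->
    exists z, [/\ K z, `|x0 - z| < t & `|y - z| < r * (3 / 4)].
  move=> Ky yt.
  have t0 : 0 < t by exact: lt_le_trans rt.
  have tr0 : 0 < t + r / 2 by rewrite addr_gt0// divr_gt0.
  (* Moving [y] towards [x0] by the fraction [l] covers less than [3 r / 4] and leaves less than
     [t - r / 4] to [x0]. As [3 r / 4 + r / 8 < r], the same [z] also serves all points within
     [r / 8] of [y]. *)
  pose l := r * (3 / 4) / (t + r / 2).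
  have l0 : 0 < l by rewrite divr_gt0// mulr_gt0.
  have lE : l * (t + r / 2) = r * (3 / 4) by rewrite divfK// gt_eqF.
  have l1 : l < 1 by rewrite ltr_pdivrMr// mul1r; lra.
  exists (y + l *: (x0 - y)); split.
  - by apply: cK => //; rewrite !ltW.
  - have -> : x0 - (y + l *: (x0 - y)) = (1 - l) *: (x0 - y).
      by rewrite opprD addrA scalerBl scale1r.
    rewrite normrZ gtr0_norm ?subr_gt0//.
    have : (1 - l) * `|x0 - y| < (1 - l) * (t + r / 2) by rewrite ltr_pM2l// subr_gt0.
    move/lt_trans; apply; rewrite mulrBl mul1r lE; lra.
  - rewrite opprD addrA subrr sub0r normrN normrZ gtr0_norm// -lE.
    by rewrite ltr_pM2l.
have [Gs GsP] : exists Gs : V -> V -> Y, forall y, K y -> `|x0 - y| < t + r / 2 ->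
    (forall z, K z -> `|y - z| < r -> loc z (Gs y)) /\
    (forall z, K z -> `|y - z| < r -> `|x0 - z| < t -> agree z (Gs y z) (F z)).
  have : forall y, exists Gy : V -> Y, K y -> `|x0 - y| < t + r / 2 ->
    (forall z, K z -> `|y - z| < r -> loc z Gy) /\
    (forall z, K z -> `|y - z| < r -> `|x0 - z| < t -> agree z (Gy z) (F z)).
    move=> y; have [[Ky yt]|no] := pselect (K y /\ `|x0 - y| < t + r / 2); last first.
      by exists F => Ky yt; exfalso; apply: no.
    have [Fy lFy] := leb y Ky.
    pose C := K `&` [set z | `|y - z| < r] `&` [set z | `|x0 - z| < t].
    have [z [Kz zt zr]] := step y Ky yt.
    have zr' : `|y - z| < r by apply: lt_trans zr _; lra.
    have [g ag gP] : exists2 g, adm g & forall x, C x -> agree x (F x) (act g (Fy x)).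
      apply: torsor_rigid.
      - by move=> w [[]].
      - by apply: convex_onI; [apply: convex_onI => //|].
      - by move=> w [[Kw wr] wt]; exact: lFy.
      - by move=> w [[Kw wr] wt]; exact: lF.
      - by exists z.
    exists (fun w => act g (Fy w)) => _ _; split.
      by move=> w Kw wr; apply: loc_act => //; exact: lFy.
    by move=> w Kw wr wt; apply: agree_sym; apply: gP.
  by move=> /choice[Gs H]; exists Gs.
(* The extension is the diagonal of the chosen sections. It remains to see that those chosen for
   nearby [y] and [y'] agree around [y]. *)
exists (fun y => Gs y y) => y Ky yt.
have [lG aG] := GsP y Ky yt.
apply: (loc_ext Ky (lG y Ky _)); first by rewrite subrr normr0.
have n1 : \forall y' \near y, `|x0 - y'| < t + r / 2.
  have : nbhs y (ball x0 (t + r / 2)).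
    by apply: open_nbhs_nbhs; split; [exact: ball_open|rewrite -ball_normE].
  by rewrite -ball_normE.
have n2 : \forall y' \near y, `|y - y'| < r / 8.
  have : nbhs y (ball y (r / 8)) by apply: nbhsx_ballx; rewrite divr_gt0.
  by rewrite -ball_normE.
apply: filterS2 n1 n2 => y' y't yy' Ky'.
have [lG' aG'] := GsP y' Ky' y't.
have [z [Kz zt zr]] := step y Ky yt.
have zr' : `|y - z| < r by apply: lt_trans zr _; lra.
have zy' : `|y' - z| < r.
  have := ler_distD y y' z; rewrite (distrC y' y) => h.
  apply: le_lt_trans h _; lra.
pose C := K `&` [set z | `|y - z| < r] `&` [set z | `|y' - z| < r].
have [h _ hP] : exists2 h, adm h & forall x, C x -> agree x (Gs y' x) (act h (Gs y x)).
  apply: torsor_rigid.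
  - by move=> w [[]].
  - by apply: convex_onI; [apply: convex_onI => //|].
  - by move=> w [[Kw wr] wt]; exact: lG.
  - by move=> w [[Kw wr] wt]; exact: lG'.
  - by exists z.
(* Both sections match [F] near the common point [z] of the smaller ball, so freeness at [z] leaves
   only the neutral element. *)
have h1 : h = one.
  apply: (loc_free Kz (lF z Kz zt)).
  have opn (x : V) s : `|x - z| < s -> \forall w \near z, `|x - w| < s.
    move=> xs; have : nbhs z (ball x s).
      by apply: open_nbhs_nbhs; split; [exact: ball_open|rewrite -ball_normE].
    by rewrite -ball_normE.
  apply: filterS3 (opn _ _ zt) (opn _ _ zr') (opn _ _ zy') => w w1 w2 w3 Kw.
  rewrite act_one.
  have q1 := aG w Kw w2 w1; have q2 := aG' w Kw w3 w1.
  have q3 : agree w (Gs y' w) (act h (Gs y w)) by apply: hP.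
  apply: agree_trans q2; apply: agree_trans (agree_sym q3).
  exact: agree_act (agree_sym q1).
have := hP y'; rewrite h1 act_one => q; apply: agree_sym; apply: q.
split; [split=> //|]; last by rewrite /= subrr normr0.
by apply: lt_trans yy' _; lra.
Qed.

(** The ball carrying a section starts with radius [r] and grows by [r / 2] at each extension, so it
    contains the bounded set [K] after finitely many of them. *)
Lemma torsor_global (x0 : V) (r M : R) : convex_on K -> K x0 -> 0 < r ->
  (forall x, K x -> `|x0 - x| < M) ->
  (forall x, K x -> exists F, forall y, K y -> `|x - y| < r -> loc y F) ->
  exists F, forall x, K x -> loc x F.
Proof.
move=> cK Kx0 r0 KM leb.
have P n : exists F, forall x, K x -> `|x0 - x| < r + (r / 2) *+ n -> loc x F.
  elim: n => [|n [F lF]]; first by rewrite mulr0n addr0; exact: leb.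
  rewrite mulrSr addrA; apply: (@torsor_extend x0 r (r + r / 2 *+ n) F) => //.
  by rewrite lerDl mulrn_wge0// divr_ge0// ltW.
have r20 : 0 < r / 2 by rewrite divr_gt0.
have [n Mn] : exists n, M <= (r / 2) *+ n.
  exists (Num.truncn (M / (r / 2))).+1.
  rewrite -mulr_natr mulrC -ler_pdivrMr// ltW//; exact: truncnS_gt.
have [F lF] := P n; exists F => x Kx; apply: lF => //.
apply: lt_le_trans (KM x Kx) _; apply: le_trans Mn _.
by rewrite lerDr ltW.
Qed.

End TorsorSheaf.

(** * Parametrized tubes around the fibres *)

Section Circle.
Context {R : realType}.

Definition ang (s : R) : 'rV[R]_2 := \row_i (if i == 0 then cos s else sin s).

Lemma inner1E m (X Y : 'rV[R]_m) : inner 1%:M X Y = \sum_i X 0 i * Y 0 i.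
Proof. by rewrite /inner mulmx1 mxE; apply: eq_bigr => i _; rewrite mxE. Qed.

Lemma circleE (z : 'rV[R]_2) : circle R z <-> z 0 0 ^+ 2 + z 0 1 ^+ 2 = 1.
Proof.
rewrite /circle /= inner1E big_ord_recl big_ord1 -!expr2.
by have -> : lift ord0 ord0 = 1 :> 'I_2 by apply/val_inj.
Qed.

Lemma row2P (z w : 'rV[R]_2) : z 0 0 = w 0 0 -> z 0 1 = w 0 1 -> z = w.
Proof.
move=> h0 h1; apply/rowP => i; case: i => -[|[|//]] li.
  by have -> : Ordinal li = 0 by apply/val_inj.
by have -> : Ordinal li = 1 by apply/val_inj.
Qed.

Lemma ang0 s : ang s 0 0 = cos s. Proof. by rewrite mxE. Qed.
Lemma ang1 s : ang s 0 1 = sin s. Proof. by rewrite mxE. Qed.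

Lemma ang_circle s : circle R (ang s).
Proof. by apply/circleE; rewrite ang0 ang1 cos2Dsin2. Qed.

Lemma angD2pi s : ang (s + pi *+ 2) = ang s.
Proof. by apply: row2P; rewrite ?ang0 ?ang1 ?cosD2pi ?sinD2pi. Qed.

(** The interval is open at [0] and closed at [2 pi] so as to lie inside the open [(0, 3 pi)]; the
    point of angle zero therefore gets the angle [2 pi]. *)
Lemma ang_surj z : circle R z -> exists2 s, 0 < s <= pi *+ 2 & ang s = z.
Proof.
move=> /circleE zE; have pi0 := pi_gt0 R.
set a := z 0 0 in zE *; set b := z 0 1 in zE *.
have a1 : -1 <= a <= 1.
  by have := sqr_ge0 b; have := sqr_ge0 a; move=> ? ?; apply/andP; split; nra.
have bE : Num.sqrt (1 - a ^+ 2) = `|b|.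
  by rewrite -zE addrAC subrr add0r sqrtr_sqr.
have ca := acosK (x := a); rewrite in_itv/= a1 in ca; have {}ca := ca isT.
have sa := sin_acos a1; rewrite bE in sa.
have g0 := acos_ge0 a1; have lp := acos_lepi a1.
have [b0|b0] := leP 0 b.
  have [s0|s0] := eqVneq (acos a) 0.
    exists (pi *+ 2); first by rewrite lexx pmulrn_rgt0// pi0.
    rewrite s0 cos0 in ca; rewrite s0 sin0 (ger0_norm b0) in sa.
    by apply: row2P; rewrite ?ang0 ?ang1 ?cos2pi ?sin2pi.
  exists (acos a).
    by rewrite lt_def s0 g0/= mulr2n; lra.
  by apply: row2P; rewrite ?ang0 ?ang1// sa ger0_norm.
exists (pi *+ 2 - acos a).
  by rewrite mulr2n; lra.
apply: row2P; rewrite ?ang0 ?ang1 addrC.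
  by rewrite cosD2pi cosN.
by rewrite sinD2pi sinN sa ltr0_norm// opprK.
Qed.

Lemma sin_eq0_2pi (x : R) : 0 <= x < pi *+ 2 -> sin x = 0 -> x = 0 \/ x = pi.
Proof.
move=> /andP[x0 x2] sx; have pi0 := pi_gt0 R.
have [->|xn0] := eqVneq x 0; first by left.
have xp : 0 < x by rewrite lt_def xn0.
case: (ltgtP x pi) => [xpi|xpi|->]; last by right.
  by have := @sin_gt0_pi R x; rewrite xp xpi sx ltxx => /(_ isT).
have := @sin_gt0_pi R (x - pi).
rewrite subr_gt0 xpi/= ltrBlDr -mulr2n x2 => /(_ isT).
have -> : sin (x - pi) = - sin x by rewrite sinB sinpi cospi mulr0 subr0 mulrN1.
by rewrite sx oppr0 ltxx.
Qed.

(** The difference has cosine one, so its half has sine zero and lies in [[0, 2 pi)]: the half is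
    [0] or [pi]. *)
Lemma ang_eq_ge (s s' : R) : ang s = ang s' -> 0 <= s - s' < pi *+ 4 ->
  s = s' \/ s = s' + pi *+ 2.
Proof.
move=> E d04; pose d := (s - s') / 2.
have c1 : cos (s - s') = 1.
  rewrite cosB -!ang0 -!ang1 E; have := ang_circle s' => /circleE.
  by rewrite !expr2.
have sd : sin d = 0.
  have : cos (d *+ 2) = 1 by rewrite -mulr_natr /d divfK ?pnatr_eq0.
  rewrite cos_mulr2n cos2sin2 => h; apply/eqP; rewrite -sqrf_eq0; apply/eqP.
  rewrite mulr2n in h; lra.
have [] := @sin_eq0_2pi d _ sd.
- rewrite /d; move: d04 => /andP[d0 d4]; rewrite divr_ge0//= ltr_pdivrMr//.
  by move: d4; rewrite -!(mulr_natr pi) => d4; lra.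
- by rewrite /d => h; left; lra.
- by rewrite /d => h; right; rewrite mulr2n; lra.
Qed.

Lemma ang_eq (s s' : R) : ang s = ang s' -> `|s - s'| < pi *+ 4 ->
  [\/ s = s', s = s' + pi *+ 2 | s' = s + pi *+ 2].
Proof.
move=> E d4; have [d0|d0] := leP 0 (s - s').
  rewrite ger0_norm// in d4.
  have [|->|->] := ang_eq_ge E; first by rewrite d0.
    exact: Or31.
  exact: Or32.
rewrite ltr0_norm// opprB in d4.
have [|->|->] := ang_eq_ge (esym E).
- by rewrite d4 andbT; lra.
- exact: Or31.
- exact: Or33.
Qed.

Lemma ang_lift (s0 eta : R) : 0 < eta -> exists (N : set 'rV[R]_2) (l : 'rV[R]_2 -> R),
  [/\ open N, N (ang s0), l (ang s0) = s0 &
    forall z, N z -> [/\ {for z, continuous l}, `|l z - s0| < eta &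
      circle R z -> ang (l z) = z]].
Proof.
move=> eta0.
(* [x] and [y] are the coordinates of [z] after rotation by [- s0]. Where [x] is positive, [asin] of
   [y] is the angle measured from [s0]. *)
pose x (z : 'rV[R]_2) : R := z 0 0 * cos s0 + z 0 1 * sin s0.
pose y (z : 'rV[R]_2) : R := z 0 1 * cos s0 - z 0 0 * sin s0.
pose l z := s0 + asin (y z).
have cx : continuous x.
  move=> z; apply: differentiable_continuous.
  by apply: differentiableD; (apply: differentiableM;
    [exact: differentiable_coord|exact: differentiable_cst]).
have cy : continuous y.
  move=> z; apply: differentiable_continuous.
  by apply: differentiableB; (apply: differentiableM;
    [exact: differentiable_coord|exact: differentiable_cst]).
have x0 : x (ang s0) = 1.
  by rewrite /x ang0 ang1 -!expr2 cos2Dsin2.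
have y0 : y (ang s0) = 0 by rewrite /y ang0 ang1 mulrC subrr.
have as0 : asin 0 = 0 :> R by rewrite -[X in asin X]sin0 sinK// in_itv/=; have := pi_gt0 R; lra.
have l0 : l (ang s0) = s0 by rewrite /l y0 as0 addr0.
have cl z : -1 < y z < 1 -> {for z, continuous l}.
  move=> yz; apply: continuousD; first exact: cst_continuous.
  by apply: continuous_comp; [exact: cy|exact: continuous_asin].
pose P := [set z | [/\ 0 < x z, -1 < y z < 1 & `|l z - s0| < eta]].
have nP : nbhs (ang s0) P.
  have n1 : \forall z \near ang s0, 0 < x z.
    have := cx (ang s0); rewrite /continuous_at x0 => h.
    by apply: (h [set t | 0 < t]); apply: open_nbhs_nbhs; split; [exact: open_gt|rewrite /=].
  have n2 : \forall z \near ang s0, -1 < y z.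
    have := cy (ang s0); rewrite /continuous_at y0 => h.
    by apply: (h [set t | -1 < t]); apply: open_nbhs_nbhs; split; [exact: open_gt|rewrite /= ltrN10].
  have n3 : \forall z \near ang s0, y z < 1.
    have := cy (ang s0); rewrite /continuous_at y0 => h.
    by apply: (h [set t | t < 1]); apply: open_nbhs_nbhs; split; [exact: open_lt|rewrite /=].
  have n4 : \forall z \near ang s0, `|l z - s0| < eta.
    have h : {for ang s0, continuous l} by apply: cl; rewrite y0 ltr01 ltrN10.
    move/cvgrPdist_lt : h => /(_ _ eta0); rewrite l0; apply: filterS => z.
    by rewrite distrC.
  near=> z; split; [near: z; exact: n1| |near: z; exact: n4].
  by apply/andP; split; near: z; [exact: n2|exact: n3].
exists (interior P), l; split; [exact: open_interior|exact: nP|exact: l0|].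
move=> z /interior_subset[xz yz lz]; split; [exact: cl|exact: lz|].
move=> /circleE zE.
have cs := cos2Dsin2 s0.
have xyE : x z ^+ 2 + y z ^+ 2 = 1.
  rewrite -[RHS]zE /x /y -[RHS]mulr1 -cs; ring.
have yz' : -1 <= y z <= 1 by case/andP: yz => *; rewrite !ltW.
have sE : sin (asin (y z)) = y z by apply: asinK; rewrite in_itv.
have cE : cos (asin (y z)) = x z.
  by rewrite cos_asin// -xyE addrK sqrtr_sqr gtr0_norm.
apply: row2P; rewrite ?ang0 ?ang1 /l ?cosD ?sinD sE cE /x /y.
  by rewrite -[RHS]mulr1 -cs; ring.
by rewrite -[RHS]mulr1 -cs; ring.
Unshelve. all: by end_near. Qed.

Lemma continuous_mx (T : topologicalType) m n (M : T -> 'M[R]_(m, n)) (x : T) :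
  (forall i j, {for x, continuous (fun y => M y i j : R)}) -> {for x, continuous M}.
Proof.
move=> H; apply/cvgrPdist_le => /= e e0.
near=> y.
rewrite /Num.Def.normr/= mx_normrE (bigmax_le _ (ltW e0))//= => i _.
rewrite !mxE/=.
move: i; near: y; apply: filter_forall => /= i.
exact: ((cvgrPdist_le _ _).1 (H i.1 i.2)).
Unshelve. all: by end_near. Qed.

End Circle.

(** * Coordinates (angle, point of the disc) and their slabs *)

Section Cylinder.
Context {R : realType} {n : nat}.

Definition angle (w : 'rV[R]_(1 + n)) : R := w 0 (lshift n 0).

(* [w = (s, x)] goes to [((cos s, sin s), x)]. *)
Definition cyl (w : 'rV[R]_(1 + n)) : 'rV[R]_(2 + n) := row_mx (ang (angle w)) (rsubmx w).

Lemma differentiable_row_mx (V : normedModType R) p q (f : V -> 'rV[R]_p) (h : V -> 'rV[R]_q) x :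
  differentiable f x -> differentiable h x -> differentiable (fun y => row_mx (f y) (h y)) x.
Proof.
move=> df dh; apply: differentiable_mx => i j.
case E : (fintype.split j) => [k|k].
  have -> : (fun y => row_mx (f y) (h y) i j) = (fun y => f y i k).
    by apply/funext => y; rewrite mxE E.
  exact: differentiable_entry.
have -> : (fun y => row_mx (f y) (h y) i j) = (fun y => h y i k).
  by apply/funext => y; rewrite mxE E.
exact: differentiable_entry.
Qed.

Lemma differentiable_angle w : differentiable angle w.
Proof. exact: differentiable_coord. Qed.

Lemma continuous_angle : continuous angle.
Proof. by move=> w; exact/differentiable_continuous/differentiable_angle. Qed.

Lemma differentiable_ang s : differentiable (@ang R) s.
Proof.
apply: differentiable_mx => i j.
have -> : (fun s : R => ang s i j) = (if j == 0 then cos else sin).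
  by apply/funext => y; rewrite mxE; case: (j == 0).
by apply/derivable1_diffP; case: (j == 0); [exact: derivable_cos|exact: derivable_sin].
Qed.

Lemma continuous_ang : continuous (@ang R).
Proof. by move=> s; exact/differentiable_continuous/differentiable_ang. Qed.

Lemma differentiable_cyl w : differentiable cyl w.
Proof.
apply: differentiable_row_mx.
  by apply: differentiable_comp; [exact: differentiable_angle|exact: differentiable_ang].
exact: differentiable_rsubmx.
Qed.

Lemma continuous_cyl : continuous cyl.
Proof. by move=> w; exact/differentiable_continuous/differentiable_cyl. Qed.

Lemma disc_convex : convex_on (disc R n).
Proof.
move=> x y t; rewrite /disc /= !inner1E => x1 y1 /andP[t0 t1].
have : \sum_i ((1 - t) * (x 0 i * x 0 i) + t * (y 0 i * y 0 i)) <= 1.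
  rewrite big_split/= -!mulr_sumr.
  have a1 : (1 - t) * \sum_i x 0 i * x 0 i <= (1 - t) * 1 by apply: ler_wpM2l => //; rewrite subr_ge0.
  have a2 : t * \sum_i y 0 i * y 0 i <= t * 1 by apply: ler_wpM2l.
  by apply: le_trans (lerD a1 a2) _; rewrite !mulr1 subrK.
apply: le_trans; apply: ler_sum => i _; rewrite !mxE.
move: (x 0 i) (y 0 i) => a b.
rewrite -subr_ge0.
have -> : (1 - t) * (a * a) + t * (b * b) - (a + t * (b - a)) * (a + t * (b - a)) = t * (1 - t) * (a - b) ^+ 2 by ring.
by rewrite mulr_ge0 ?sqr_ge0// mulr_ge0// subr_ge0.
Qed.

Lemma disc_entry (x : 'rV[R]_n) i : disc R n x -> `|x 0 i| <= 1.
Proof.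
rewrite /disc /= inner1E => x1.
rewrite -[leRHS]sqrtr1 -sqrtr_sqr ler_sqrt//; apply: le_trans x1.
rewrite (bigD1 i)//= -expr2 lerDl; apply: sumr_ge0 => j _.
by rewrite -expr2 sqr_ge0.
Qed.

Lemma disc0 : disc R n 0.
Proof. by rewrite /disc /= inner1E big1// => i _; rewrite mxE mul0r. Qed.

Lemma continuous_inner1 (V : normedModType R) (f : V -> 'rV[R]_n) x :
  differentiable f x -> differentiable (fun y => inner 1%:M (f y) (f y)) x.
Proof.
move=> df.
have -> : (fun y => inner 1%:M (f y) (f y)) = (fun y => \sum_i f y 0 i * f y 0 i).
  by apply/funext => y; rewrite inner1E.
by apply: differentiable_bigsum => i; apply: differentiableM; exact: differentiable_entry.
Qed.

Definition slab (s0 d : R) : set 'rV[R]_(1 + n) :=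
  [set w | `|angle w - s0| < d /\ disc R n (rsubmx w)].

Definition closed_slab (s0 d : R) : set 'rV[R]_(1 + n) :=
  [set w | `|angle w - s0| <= d /\ disc R n (rsubmx w)].

Lemma angle_line w v (t : R) : angle (w + t *: v) = angle w + t * angle v.
Proof. by rewrite /angle !mxE. Qed.

Lemma slab_convex s0 d : convex_on (slab s0 d).
Proof.
move=> x y t [x1 x2] [y1 y2] t01; split; last first.
  have -> : rsubmx (x + t *: (y - x)) = rsubmx x + t *: (rsubmx y - rsubmx x).
    by apply/rowP => i; rewrite !mxE.
  exact: disc_convex.
rewrite angle_line; have -> : angle (y - x) = angle y - angle x by rewrite /angle !mxE.
have := @convex_ball R R s0 d (angle x) (angle y) t; rewrite -ball_normE /= => H.
rewrite distrC; apply: H => //; by rewrite distrC.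
Qed.

Lemma row_entry_bound (w : 'rV[R]_(1 + n)) M : `|angle w| <= M ->
  (forall i, `|rsubmx w 0 i| <= M) -> `|w| <= M.
Proof.
move=> h1 h2; have M0 : 0 <= M by apply: le_trans h1.
rewrite /Num.Def.normr/= mx_normrE; apply: bigmax_le => //= -[i j] _ /=.
rewrite (ord1 i); case: (splitP j) => k E.
  by have -> : j = lshift n 0 by apply/val_inj; rewrite /= E (ord1 k).
by have := h2 k; rewrite mxE; have -> : j = rshift 1 k by apply/val_inj.
Qed.

Lemma closed_slab_bound s0 d w : closed_slab s0 d w -> `|w| <= `|s0| + `|d| + 1.
Proof.
move=> [h1 h2]; apply: row_entry_bound.
  have := ler_normD (angle w - s0) s0; rewrite subrK.
  have := ler_norm d; lra.
move=> i; apply: le_trans (disc_entry i h2) _.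
by rewrite lerDr addr_ge0.
Qed.

Lemma closed_slab_compact s0 d : compact (closed_slab s0 d).
Proof.
apply: bounded_closed_compact.
  exists (`|s0| + `|d| + 1); split; first exact: num_real.
  move=> M MM w /closed_slab_bound wM /=; exact: le_trans wM (ltW MM).
have -> : closed_slab s0 d = (fun w => `|angle w - s0|) @^-1` [set t | t <= d] `&`
   (fun w => inner 1%:M (rsubmx w) (rsubmx w)) @^-1` [set t | t <= 1] by [].
apply: closedI; apply: closed_comp.
- move=> w _; apply: (@continuous_comp _ _ _ (fun w => angle w - s0) (fun x : R => `|x|)).
    apply: differentiable_continuous; apply: differentiableB; first exact: differentiable_angle.
    exact: differentiable_cst.
  exact: norm_continuous.
- exact: closed_le.
- move=> w _; apply: differentiable_continuous; apply: continuous_inner1.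
  exact: differentiable_rsubmx.
- exact: closed_le.
Qed.

End Cylinder.

(** The property is asked only on [K], while compactness is that of [C]. In the applications [C] is
    [K] with its end angles added, which gives a radius uniform up to the ends. *)
Lemma lebesgue_number (R : realType) (V : normedModType R) (K C : set V)
    (T : Type) (P : T -> V -> Prop) : compact C ->
  (forall x, C x -> exists F, \forall y \near x, K y -> P F y) ->
  exists2 r : R, 0 < r & forall x, C x -> exists F, forall y, K y -> `|x - y| < r -> P F y.
Proof.
move=> /compact_near_coveringP cC H.
have : \forall r \near (0 : R)^'+, C `<=` (fun x => exists F, forall y, K y -> `|x - y| < r -> P F y).
  apply: (cC R (0 : R)^'+ (fun r x => exists F, forall y, K y -> `|x - y| < r -> P F y)).
  move=> x Cx; have [F /nbhs_ballP[e /= e0 He]] := H x Cx.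
  near=> x' r.
  exists F => y Ky yr; apply: He => //; rewrite -ball_normE /=.
  have h1 : `|x - x'| < e / 2.
    near: x'; have : nbhs x (ball x (e / 2)) by apply: nbhsx_ballx; rewrite divr_gt0.
    by rewrite -ball_normE.
  have h2 : r < e / 2 by near: r; apply: nbhs_right_lt; rewrite divr_gt0.
  rewrite (splitr e); apply: le_lt_trans (ler_distD x' x y) _.
  by apply: ltrD; [exact: h1|exact: lt_trans yr h2].
move=> H'.
have h0 : \forall r \near (0 : R)^'+, 0 < r by exact: nbhs_right_gt.
have [r [r0 Hr]] := filter_ex (filterI h0 H').
by exists r.
Unshelve. all: by end_near. Qed.

(** * Flat maps around a whole fibre *)

Section Bundle.
Context {R : realType} {n : nat} {E : smooth_manifold R n}.
Variables (g : riemannian_metric E) (p : E -> 'rV[R]_2).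
Hypotheses (Hp : is_disc_bundle n p) (Hg : locally_flat g).
Implicit Types (t : trivialization n E) (w : 'rV[R]_(1 + n)).

Lemma smooth_from_continuous (m : nat) (M : smooth_manifold R m)
    (W : normedModType R) (A : set M) (f : M -> W) e :
  open A -> A e -> smooth_from A f -> {for e, continuous f}.
Proof.
move=> oA Ae sf N Nfe.
have [c Ac ce] := atlas_cover e.
have [_ _ cK _ _] := atlas_charts Ac.
have xA : (cmap c @` (A `&` cdom c)) (cmap c e) by exists e.
have [U [F [oU Ux CF FE]]] := sf c Ac _ xA.
have Fx : F (cmap c e) = f e by rewrite (FE _ xA Ux) /= cK.
have cF : {for cmap c e, continuous F} := CF 0%N _ Ux.
have n1 : nbhs (cmap c e) [set x | N (F x)] by apply: cF; rewrite Fx.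
have n2 : nbhs (cmap c e) U by exact: open_nbhs_nbhs.
have n12 : nbhs (cmap c e) ([set x | N (F x)] `&` U) by exact: filterI.
have n3 := chart_near Ac ce n12.
have n4 : nbhs e A by exact: open_nbhs_nbhs.
have n5 : \forall e' \near e, N (f e').
  apply: filterS2 n3 n4 => e' [ce' [/= Ne' Ue']] Ae'.
  have xA' : (cmap c @` (A `&` cdom c)) (cmap c e') by exists e'.
  by move: Ne'; rewrite (FE _ xA' Ue') /= cK.
exact: n5.
Qed.

Lemma continuous_p : continuous p.
Proof.
move=> e; have [_ sp _] := Hp.
exact: (smooth_from_continuous openT (I : setT e) sp).
Qed.

Lemma open_tube (N : set 'rV[R]_2) : open N -> open (p @^-1` N).
Proof. by move=> oN; apply: open_comp => // e _; exact: continuous_p. Qed.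

Definition param t w : E := tinv t (cyl w).

Lemma cyl_tprod t w : tbase t (ang (angle w)) -> disc R n (rsubmx w) -> tprod t (cyl w).
Proof.
by move=> tw dw; rewrite /tprod /cyl /= row_mxKl row_mxKr; split=> //; exact: ang_circle.
Qed.

Section OneTrivialization.
Variable t : trivialization n E.
Hypothesis Ht : is_trivialization p t.

Lemma param_p w : tbase t (ang (angle w)) -> disc R n (rsubmx w) -> p (param t w) = ang (angle w).
Proof.
move=> tw dw; have [_ _ h _ _] := Ht.
by rewrite /param (h _ (cyl_tprod tw dw)).1 /cyl row_mxKl.
Qed.

Lemma tmap_param w : tbase t (ang (angle w)) -> disc R n (rsubmx w) -> tmap t (param t w) = cyl w.
Proof. by move=> tw dw; have [_ _ h _ _] := Ht; have [] := h _ (cyl_tprod tw dw). Qed.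

Lemma continuous_tmap e : tbase t (p e) -> {for e, continuous (tmap t)}.
Proof.
move=> te; have [ot _ _ st _] := Ht.
exact: smooth_from_continuous (open_tube ot) te st.
Qed.

Lemma near_tbase w : tbase t (ang (angle w)) -> \forall w' \near w, tbase t (ang (angle w')).
Proof.
move=> tw; have [ot _ _ _ _] := Ht.
have c : {for w, continuous (fun w => ang (angle w))}.
  by apply: continuous_comp; [exact: continuous_angle|exact: continuous_ang].
by apply: c; exact: open_nbhs_nbhs.
Qed.

Lemma param_near w (N : set E) : tbase t (ang (angle w)) -> disc R n (rsubmx w) ->
  nbhs (param t w) N -> \forall w' \near w, disc R n (rsubmx w') -> N (param t w').
Proof.
move=> tw dw Nw; have [_ _ _ _ [ct _]] := Ht.
have h : nbhs (cyl w) [set z | tprod t z -> N (tinv t z)].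
  exact: (subspace_continuousP _ _).1 ct _ (cyl_tprod tw dw) _ Nw.
have h' : nbhs w [set w' | tprod t (cyl w') -> N (tinv t (cyl w'))].
  exact: continuous_cyl _ _ h.
apply: filterS2 h' (near_tbase tw) => w' h1 h2 dw'.
by apply: h1; exact: cyl_tprod.
Qed.

(** A local inverse of [param t], single-valued because a branch of the angle near [s0] is fixed;
    the fibre coordinate comes from [tmap t]. *)
Lemma tube_coordinates (s0 eta : R) : tbase t (ang s0) -> 0 < eta ->
  exists (N : set 'rV[R]_2) (ka : E -> 'rV[R]_(1 + n)),
  [/\ open N, N (ang s0),
   (forall e, N (p e) -> [/\ tbase t (p e), {for e, continuous ka}, slab s0 eta (ka e),
      ang (angle (ka e)) = p e & param t (ka e) = e]) &
   (forall w, angle w = s0 -> disc R n (rsubmx w) -> ka (param t w) = w)].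
Proof.
move=> ts0 eta0; have [N [l [oN Ns ls H]]] := ang_lift s0 eta0.
have [ot h1 h2 _ _] := Ht.
exists (N `&` tbase t), (fun e => row_mx (l (p e))%:M (rsubmx (tmap t e))).
split; first exact: openI.
- by [].
- move=> e [Ne te]; have [cl lb lE] := H _ Ne.
  have [[q1 q2 q3] q4 q5] := h1 e te.
  have pc : circle R (p e) by have [h _ _] := Hp; exact: h.
  have hdE : angle (row_mx (l (p e))%:M (rsubmx (tmap t e))) = l (p e).
    by rewrite /angle row_mxEl mxE.
  split=> //.
  + apply: continuous_mx => i j; case Ej : (fintype.split j) => [k|k].
      have -> : (fun e => row_mx (l (p e))%:M (rsubmx (tmap t e)) i j) = (fun e => l (p e)).
        by apply/funext => y; rewrite mxE Ej mxE (ord1 i) (ord1 k).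
      by apply: continuous_comp; [exact: continuous_p|exact: cl].
    have -> : (fun e => row_mx (l (p e))%:M (rsubmx (tmap t e)) i j) =
      (fun e => tmap t e i (rshift 2 k)).
      by apply/funext => y; rewrite mxE Ej mxE.
    apply: (@continuous_comp _ _ _ (tmap t) (fun z : 'rV[R]_(2 + n) => z i (rshift 2 k) : R)).
      exact: continuous_tmap.
    exact: coord_continuous.
  + by split; [rewrite hdE|rewrite row_mxKr].
  + by rewrite hdE lE.
  + rewrite /param /cyl hdE row_mxKr lE// -q4 hsubmxK; exact: q5.
- move=> w hw dw; have tw : tbase t (ang (angle w)) by rewrite hw.
  rewrite param_p// tmap_param// hw ls /cyl row_mxKr -[RHS]hsubmxK; congr row_mx.
  by apply/rowP => i; rewrite (ord1 i) !mxE -hw /angle.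
Qed.

(** Transports identities of germs from the parameters back to [E], which is needed to apply
    [flat_affine_inj]. *)
Lemma param_open w (N : set 'rV[R]_(1 + n)) : tbase t (ang (angle w)) ->
  disc R n (rsubmx w) -> nbhs w N ->
  \forall e \near param t w, exists w', [/\ N w', disc R n (rsubmx w') & param t w' = e].
Proof.
move=> tw dw Nw; have [M [ka [oM Mw H kaK]]] := tube_coordinates tw ltr01.
have Mp : M (p (param t w)) by rewrite param_p.
have [_ cka _ _ _] := H _ Mp.
have n1 : nbhs (param t w) [set e | N (ka e)] by apply: cka; rewrite kaK.
have n2 : nbhs (param t w) (p @^-1` M).
  by apply: open_nbhs_nbhs; split=> //; exact: open_tube.
apply: filterS2 n1 n2 => e /= Ne Me; exists (ka e).
by have [_ _ [_ d] _ q] := H _ Me.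
Qed.

Definition iso_grp := ('M[R]_n.+1 * 'rV[R]_n.+1)%type.
Definition iso_act (h : iso_grp) (y : 'rV[R]_n.+1) := y *m h.1 + h.2.
Definition iso_adm (h : iso_grp) := h.1 *m h.1^T = 1%:M.
Definition iso_one : iso_grp := (1%:M, 0).

Lemma iso_act1 y : iso_act iso_one y = y.
Proof. by rewrite /iso_act mulmx1 addr0. Qed.

Section Slab.
Variables (s0 d : R).
Hypothesis Hd : forall s, `|s - s0| < d -> tbase t (ang s).

(** The admissible sections for the first gluing: flat maps read through [param t]. Slabs are convex
    because the disc is. *)
Definition loc1 w (F : 'rV[R]_(1 + n) -> 'rV[R]_n.+1) := exists W f,
  [/\ flat_on g W f, W (param t w) &
      \forall w' \near w, slab s0 d w' -> F w' = f (param t w')].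

Let agree1 (w : 'rV[R]_(1 + n)) (y y' : 'rV[R]_n.+1) := y = y'.

Lemma loc1_ext w F F' : slab s0 d w -> loc1 w F ->
  eqnear (slab s0 d) agree1 w F F' -> loc1 w F'.
Proof.
move=> Kw [W [f [fW Ww H]]] FF; exists W, f; split=> //.
by apply: filterS2 H FF => w' h1 h2 Kw'; rewrite -h2// h1.
Qed.

Lemma loc1_torsor w F F' : slab s0 d w -> loc1 w F -> loc1 w F' ->
  exists2 h, iso_adm h & eqnear (slab s0 d) agree1 w F' (fun y => iso_act h (F y)).
Proof.
move=> [w1 w2] [W [f [fW Ww H]]] [W' [f' [fW' Ww' H']]].
have [Q [b [QQ N]]] := flat_rigid fW fW' Ww Ww'.
exists (Q, b) => //.
have n1 := param_near (Hd w1) w2 N.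
apply: filterS3 H H' n1 => w' h1 h2 h3 Kw'.
by rewrite /agree1 /iso_act /= h2// h3 ?h1//; case: Kw'.
Qed.

Lemma loc1_act w F h : slab s0 d w -> iso_adm h -> loc1 w F ->
  loc1 w (fun y => iso_act h (F y)).
Proof.
move=> Kw ah [W [f [fW Ww H]]]; exists W, (fun e => f e *m h.1 + h.2); split=> //.
  exact: flat_on_affine.
by apply: filterS H => w' h1 Kw'; rewrite /iso_act h1.
Qed.

Lemma loc1_free w F h h' : slab s0 d w -> loc1 w F ->
  eqnear (slab s0 d) agree1 w (fun y => iso_act h (F y)) (fun y => iso_act h' (F y)) ->
  h = h'.
Proof.
move=> [w1 w2] [W [f [fW Ww H]]] N.
have n0 : nbhs w [set w' | `|angle w' - s0| < d].
  have nb : nbhs (angle w) (ball s0 d).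
    by apply: open_nbhs_nbhs; split; [exact: ball_open|rewrite -ball_normE /= distrC].
  have nw : nbhs w [set w' | ball s0 d (angle w')] by exact: continuous_angle.
  by apply: filterS nw => w'; rewrite -ball_normE /= distrC.
have n1 : nbhs w [set w' | [/\ slab s0 d w' -> F w' = f (param t w'),
   slab s0 d w' -> iso_act h (F w') = iso_act h' (F w') & `|angle w' - s0| < d]].
  by apply: filterS3 H N n0 => w' *; split.
have n2 := param_open (Hd w1) w2 n1.
have n3 : \forall e \near param t w, f e *m h.1 + h.2 = f e *m h'.1 + h'.2.
  apply: filterS n2 => e [w' [[q1 q2 q3] dw' <-]].
  have Kw' : slab s0 d w' by [].
  by have := q2 Kw'; rewrite /iso_act q1.
have [] := flat_affine_inj fW Ww n3.
by case: h h' {N n1 n2 n3} => [Q b] [Q' b'] /= -> ->.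
Qed.

Lemma slab_rigid C F F' : C `<=` slab s0 d -> convex_on C -> (forall x, C x -> loc1 x F) ->
  (forall x, C x -> loc1 x F') -> C !=set0 ->
  exists2 h, iso_adm h & forall x, C x -> F' x = iso_act h (F x).
Proof.
move=> CK cC lF lF' C0.
apply: (@torsor_rigid R _ _ iso_grp (slab s0 d) agree1 iso_act iso_adm iso_one loc1
   _ _ _ _ C F F') => //.
- by move=> x y z w -> ->.
- exact: loc1_torsor.
- exact: loc1_free.
Qed.

End Slab.

Lemma flat_exists (e : E) : exists W f, flat_on g W f /\ W e.
Proof.
have [W [f [k [[oW We] _ sf _ iF]]]] := Hg e.
exists W, f; split=> //; exact: flat_on_of_isometry.
Qed.

Lemma flat_on_local W f : open W ->
  (forall e, W e -> exists W1 f1, [/\ flat_on g W1 f1, W1 e & \forall e' \near e, f1 e' = f e']) ->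
  flat_on g W f.
Proof.
move=> oW H; split=> // e c We Ac ce.
have [W1 [f1 [fW1 W1e N]]] := H e We.
have fl : flat_on g (interior [set e' | f1 e' = f e'] `&` W1) f.
  apply: (@flat_on_ext _ _ _ _ _ f1).
    by move=> e' [/interior_subset].
  apply: (flat_on_sub _ _ fW1); first by move=> e' [].
  by apply: openI; [exact: open_interior|exact: fW1.1].
by apply: fl.2.
Qed.

(** Local flat maps are glued over a slab around the fibre, and the result is carried to [E] by the
    inverse of the parametrization. *)
Lemma tube_flat_triv s0 : tbase t (ang s0) ->
  exists N f, [/\ open N, N (ang s0) & flat_on g (p @^-1` N) f].
Proof.
move=> ts0; have [ot _ _ _ _] := Ht.
(* The inequality is not strict because the compact closed slab must also be parametrized by [t]. *)
have [d d0 Hd] : exists2 d : R, 0 < d & forall s, `|s - s0| <= d -> tbase t (ang s).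
  have : nbhs s0 [set s | tbase t (ang s)] by apply: continuous_ang; exact: open_nbhs_nbhs.
  move=> /nbhs_ballP[r /= r0 Hr]; exists (r / 2); first by rewrite divr_gt0.
  move=> s sr; apply: Hr; rewrite -ball_normE /= distrC; apply: le_lt_trans sr _.
  by rewrite ltr_pdivrMr// ltr_pMr// ltr1n.
have Hd' s : `|s - s0| < d -> tbase t (ang s) by move/ltW; exact: Hd.
have [F lF] : exists F, forall w, slab s0 d w -> loc1 s0 d w F.
  have lex w : closed_slab s0 d w -> exists F, \forall w' \near w, slab s0 d w' -> loc1 s0 d w' F.
    move=> [w1 w2]; have [W [f [fW Ww]]] := flat_exists (param t w).
    exists (fun w => f (param t w)).
    have n1 := param_near (Hd _ w1) w2 (open_nbhs_nbhs (conj fW.1 Ww)).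
    apply: filterS n1 => w' h Kw'; exists W, f; split=> //.
      by apply: h; case: Kw'.
    by apply: filterE.
  have [r r0 Hr] := @lebesgue_number R _ (slab s0 d) _ _ (fun F y => loc1 s0 d y F)
    (@closed_slab_compact R n s0 d) lex.
  pose w0 : 'rV[R]_(1 + n) := row_mx s0%:M 0.
  have K0 : slab s0 d w0.
    split; last by rewrite row_mxKr; exact: disc0.
    by rewrite /angle row_mxEl mxE subrr normr0.
  apply: (@torsor_global R _ _ iso_grp (slab s0 d) (fun _ y y' => y = y') iso_act iso_adm
    iso_one (loc1 s0 d) _ _ _ _ _ _ _ _ w0 r (`|w0| + (`|s0| + `|d| + 1) + 1)) => //.
  - by move=> x y z w -> ->.
  - by move=> x h y z ->.
  - exact: iso_act1.
  - exact: loc1_ext.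
  - exact: loc1_torsor.
  - exact: loc1_act.
  - exact: loc1_free.
  - exact: slab_convex.
  - move=> w [w1 w2]; apply: le_lt_trans (ler_normB _ _) _.
    have : `|w| <= `|s0| + `|d| + 1 by apply: (@closed_slab_bound _ _ s0 d w); split=> //; exact: ltW.
    by move=> h; apply: le_lt_trans (lerD (lexx _) h) _; rewrite ltrDl.
  - move=> w [w1 w2]; apply: Hr; split=> //; exact: ltW.
have [N [ka [oN Ns H _]]] := tube_coordinates ts0 d0.
exists N, (fun e => F (ka e)); split=> //.
apply: flat_on_local; first exact: open_tube.
move=> e Ne; have [_ cka Ke _ psiK] := H e Ne.
have [W [f [fW We Nf]]] := lF _ Ke.
rewrite psiK in We.
exists W, f; split=> //.
have n1 : nbhs e [set e' | slab s0 d (ka e') -> F (ka e') = f (param t (ka e'))].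
  exact: cka _ Nf.
have n2 : nbhs e (p @^-1` N) by apply: open_nbhs_nbhs; split=> //; exact: open_tube.
apply: filterS2 n1 n2 => e' h1 /= Ne'.
by have [_ _ Ke' _ psiK'] := H e' Ne'; rewrite h1// psiK'.
Qed.

Lemma tube_rigid_triv s0 N f N' f' : tbase t (ang s0) ->
  open N -> open N' -> N (ang s0) -> N' (ang s0) ->
  flat_on g (p @^-1` N) f -> flat_on g (p @^-1` N') f' ->
  exists2 h, iso_adm h & \forall z \near ang s0, forall e, p e = z -> f' e = iso_act h (f e).
Proof.
move=> ts0 oN oN' Ns Ns' fN fN'; have [ot _ _ _ _] := Ht.
have [d d0 Hd] : exists2 d : R, 0 < d & forall s, `|s - s0| < d ->
    [/\ tbase t (ang s), N (ang s) & N' (ang s)].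
  have n1 : nbhs s0 [set s | tbase t (ang s)] by apply: continuous_ang; exact: open_nbhs_nbhs.
  have n2 : nbhs s0 [set s | N (ang s)] by apply: continuous_ang; exact: open_nbhs_nbhs.
  have n3 : nbhs s0 [set s | N' (ang s)] by apply: continuous_ang; exact: open_nbhs_nbhs.
  have /nbhs_ballP[r /= r0 Hr] : nbhs s0 [set s | [/\ tbase t (ang s), N (ang s) & N' (ang s)]].
    by apply: filterS3 n1 n2 n3 => s; split.
  exists r => // s sr; apply: Hr; by rewrite -ball_normE /= distrC.
have Hd' s : `|s - s0| < d -> tbase t (ang s) by move=> /Hd[].
have lf M k : (forall s, `|s - s0| < d -> M (ang s)) -> flat_on g (p @^-1` M) k ->
    forall w, slab s0 d w -> loc1 s0 d w (fun w => k (param t w)).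
  move=> HM fk w [w1 w2]; exists (p @^-1` M), k; split=> //.
    by rewrite /= param_p//; [exact: HM|exact: Hd'].
  by apply: filterE.
have [h ah hP] : exists2 h, iso_adm h & forall w, slab s0 d w ->
    f' (param t w) = iso_act h (f (param t w)).
  apply: (@slab_rigid s0 d Hd' (slab s0 d) (fun w => f (param t w)) (fun w => f' (param t w))) => //.
  - exact: slab_convex.
  - by apply: (lf N) => // s /Hd[].
  - by apply: (lf N') => // s /Hd[].
  - exists (row_mx s0%:M 0); split; last by rewrite row_mxKr; exact: disc0.
    by rewrite /angle row_mxEl mxE subrr normr0.
exists h => //.
have [M [ka [oM Ms H _]]] := tube_coordinates ts0 d0.
have n1 : nbhs (ang s0) M by exact: open_nbhs_nbhs.
apply: filterS n1 => z Mz e pe.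
have Me : M (p e) by rewrite pe.
by have [_ _ Ke _ <-] := H e Me; exact: hP.
Qed.

End OneTrivialization.

Lemma triv_at s : exists t, is_trivialization p t /\ tbase t (ang s).
Proof. by have [_ _ h] := Hp; apply: h; exact: ang_circle. Qed.

Lemma tube_flat s0 : exists N f, [/\ open N, N (ang s0) & flat_on g (p @^-1` N) f].
Proof. by have [t [Ht ts]] := triv_at s0; exact: tube_flat_triv Ht _ ts. Qed.

Lemma tube_rigid s0 N f N' f' :
  open N -> open N' -> N (ang s0) -> N' (ang s0) ->
  flat_on g (p @^-1` N) f -> flat_on g (p @^-1` N') f' ->
  exists2 h, iso_adm h & \forall z \near ang s0, forall e, p e = z -> f' e = iso_act h (f e).
Proof. by have [t [Ht ts]] := triv_at s0; exact: tube_rigid_triv Ht _ _ _ _ _ ts. Qed.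

End Bundle.

(** * The developing map and its holonomy *)

Section Developing.
Context {R : realType} {n : nat} {E : smooth_manifold R n}.
Variables (g : riemannian_metric E) (p : E -> 'rV[R]_2).
Hypotheses (Hp : is_disc_bundle n p) (Hg : locally_flat g).

(** The local sections for the second gluing, over angles: flat maps on a neighbourhood of an entire
    fibre. *)
Definition tube_germ (s : R) (f : E -> 'rV[R]_n.+1) :=
  exists N, [/\ open N, N (ang s) & flat_on g (p @^-1` N) f].

Definition over (s : R) (y y' : E -> 'rV[R]_n.+1) := forall e, p e = ang s -> y e = y' e.

(* [F] takes the angle as an extra argument because the developing map is
   multivalued on [E]; only the values [F s e] with [p e = ang s] matter. *)
Definition develops (s : R) (F : R -> E -> 'rV[R]_n.+1) :=
  exists2 f, tube_germ s f & \forall s' \near s, over s' (F s') f.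

Definition act_fun (h : iso_grp) (y : E -> 'rV[R]_n.+1) : E -> 'rV[R]_n.+1 :=
  fun e => iso_act h (y e).

Lemma tube_germ_near s f : tube_germ s f -> \forall s' \near s, tube_germ s' f.
Proof.
move=> [N [oN Ns fN]].
have ns : nbhs s [set s' | N (ang s')].
  by apply: continuous_ang; exact: open_nbhs_nbhs.
by apply: filterS ns => s' Ns'; exists N.
Qed.

Lemma tube_germ_torsor s f f' : tube_germ s f -> tube_germ s f' ->
  exists2 h, iso_adm h & \forall s' \near s, over s' f' (act_fun h f).
Proof.
move=> [N [oN Ns fN]] [N' [oN' Ns' fN']].
have [h ah H] := tube_rigid Hp oN oN' Ns Ns' fN fN'.
exists h => //.
have ns : nbhs s [set s' | forall e, p e = ang s' -> f' e = iso_act h (f e)].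
  exact: continuous_ang _ _ H.
exact: ns.
Qed.

(** Agreement over all angles near [s] is agreement near a point of the fibre, here the centre of
    its disc, where [flat_affine_inj] applies. *)
Lemma tube_germ_free s f h h' : tube_germ s f ->
  (\forall s' \near s, over s' (act_fun h f) (act_fun h' f)) -> h = h'.
Proof.
move=> [N [oN Ns fN]] H.
have [t [Ht ts]] := triv_at Hp s.
pose w : 'rV[R]_(1 + n) := row_mx s%:M 0.
have hw : angle w = s by rewrite /angle row_mxEl mxE.
have tw : tbase t (ang (angle w)) by rewrite hw.
have dw : disc R n (rsubmx w) by rewrite row_mxKr; exact: disc0.
have pe : p (param t w) = ang s by rewrite param_p// hw.
have /nbhs_ballP[d /= d0 Hd] := H.
have [M [l [oM Ms ls lP]]] := ang_lift s d0.
have n1 : nbhs (param t w) (p @^-1` M).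
  apply: open_nbhs_nbhs; split; first exact: open_tube.
  by rewrite /= pe.
have n2 : \forall e \near param t w, f e *m h.1 + h.2 = f e *m h'.1 + h'.2.
  apply: filterS n1 => e Me; have [_ lb lE] := lP _ Me.
  have cp : circle R (p e) by have [q _ _] := Hp; exact: q.
  by apply: (Hd (l (p e))); [rewrite -ball_normE /= distrC|rewrite lE].
have We : (p @^-1` N) (param t w) by rewrite /= pe.
have [] := flat_affine_inj fN We n2.
by case: h h' {H Hd n2} => [Q b] [Q' b'] /= -> ->.
Qed.

Definition itvo (a b : R) : set R := [set s | a < s < b].

Lemma itvo_near a b s : itvo a b s -> \forall s' \near s, itvo a b s'.
Proof.
move=> /andP[sa sb].
have n1 : \forall s' \near s, a < s' by apply: open_nbhs_nbhs; split=> //; exact: open_gt.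
have n2 : \forall s' \near s, s' < b by apply: open_nbhs_nbhs; split=> //; exact: open_lt.
by apply: filterS2 n1 n2 => s' h1 h2; apply/andP.
Qed.

Lemma itvo_convex a b : convex_on (itvo a b).
Proof.
move=> x y t /andP[x1 x2] /andP[y1 y2] /andP[t0 t1]; apply/andP.
have e : x + t *: (y - x) = (1 - t) * x + t * y by rewrite -[t *: _]/(t * _); ring.
rewrite e; have [->|tn0] := eqVneq t 0; first by rewrite mul0r addr0 subr0 mul1r.
have tp : 0 < t by rewrite lt_def tn0.
have u0 : 0 <= 1 - t by rewrite subr_ge0.
have h1 : (1 - t) * a <= (1 - t) * x by apply: ler_wpM2l => //; exact: ltW.
have h2 : (1 - t) * x <= (1 - t) * b by apply: ler_wpM2l => //; exact: ltW.
have h3 : t * a < t * y by rewrite ltr_pM2l.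
have h4 : t * y < t * b by rewrite ltr_pM2l.
split; nra.
Qed.

Section Interval.
Variables (a b : R).

Lemma develops_ext s F F' : itvo a b s -> develops s F ->
  eqnear (itvo a b) over s F F' -> develops s F'.
Proof.
move=> Ks [f fs H] FF; exists f => //.
apply: filterS3 H FF (itvo_near Ks) => s' h1 h2 Ks' e pe.
by rewrite -(h2 Ks' e pe) h1.
Qed.

Lemma develops_torsor s F F' : itvo a b s -> develops s F -> develops s F' ->
  exists2 h, iso_adm h & eqnear (itvo a b) over s F' (fun y => act_fun h (F y)).
Proof.
move=> Ks [f fs H] [f' fs' H']; have [h ah hP] := tube_germ_torsor fs fs'.
exists h => //; apply: filterS3 H H' hP => s' h1 h2 h3 _ e pe.
by rewrite (h2 e pe) (h3 e pe) /act_fun (h1 e pe).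
Qed.

Lemma develops_act s F h : itvo a b s -> iso_adm h -> develops s F ->
  develops s (fun y => act_fun h (F y)).
Proof.
move=> Ks ah [f [N [oN Ns fN]] H]; exists (act_fun h f).
  by exists N; split=> //; exact: flat_on_affine.
by apply: filterS H => s' h1 e pe; rewrite /act_fun (h1 e pe).
Qed.

Lemma develops_free s F h h' : itvo a b s -> develops s F ->
  eqnear (itvo a b) over s (fun y => act_fun h (F y)) (fun y => act_fun h' (F y)) ->
  h = h'.
Proof.
move=> Ks [f fs H] N; apply: (tube_germ_free fs).
apply: filterS3 H N (itvo_near Ks) => s' h1 h2 Ks' e pe.
by have := h2 Ks' e pe; rewrite /act_fun (h1 e pe).
Qed.

Lemma develops_rigid F F' : a < b -> (forall s, itvo a b s -> develops s F) ->
  (forall s, itvo a b s -> develops s F') ->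
  exists2 h, iso_adm h & forall s e, itvo a b s -> p e = ang s -> F' s e = iso_act h (F s e).
Proof.
move=> ab dF dF'.
have [h ah hP] : exists2 h, iso_adm h & forall x, itvo a b x -> over x (F' x) (act_fun h (F x)).
  apply: (@torsor_rigid R _ _ iso_grp (itvo a b) over act_fun iso_adm iso_one develops
     _ _ _ _ (itvo a b) F F') => //.
  - by move=> x y z yz e pe; rewrite yz.
  - by move=> x y z w yz zw e pe; rewrite yz// zw.
  - exact: develops_torsor.
  - exact: develops_free.
  - exact: itvo_convex.
  - by exists ((a + b) / 2); apply/andP; split; lra.
by exists h => // s e Ks; exact: hP.
Qed.

(** The second gluing. Tubes exist around the fibre of every real angle, also at [a] and [b], so the
    Lebesgue radius comes from the compact interval [[a, b]]. *)
Lemma develops_global : a < b -> exists F, forall s, itvo a b s -> develops s F.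
Proof.
move=> ab.
have lex s : `[a, b]%classic s ->
    exists F, \forall s' \near s, itvo a b s' -> develops s' F.
  move=> _; have [N [f [oN Ns fN]]] := tube_flat Hp Hg s.
  exists (fun=> f).
  have sf : tube_germ s f by exists N.
  apply: filterS (tube_germ_near sf) => s' fs' _; exists f => //.
  by apply: filterE => s'' e.
have [r r0 Hr] := @lebesgue_number R _ (itvo a b) _ _ (fun F s => develops s F)
    (@segment_compact R a b) lex.
pose x0 := (a + b) / 2.
have K0 : itvo a b x0 by apply/andP; split; rewrite /x0; lra.
apply: (@torsor_global R _ _ iso_grp (itvo a b) over act_fun iso_adm
    iso_one develops _ _ _ _ _ _ _ _ x0 r (b - a)) => //.
- by move=> x y z yz e pe; rewrite yz.
- by move=> x y z w yz zw e pe; rewrite yz// zw.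
- by move=> x h y z yz e pe; rewrite /act_fun yz.
- by move=> y; apply/funext => e; exact: iso_act1.
- exact: develops_ext.
- exact: develops_torsor.
- exact: develops_act.
- exact: develops_free.
- exact: itvo_convex.
- move=> x /andP[x1 x2]; rewrite ltr_norml /x0; apply/andP; split; lra.
- move=> x /andP[x1 x2]; apply: Hr; rewrite /= in_itv /=; apply/andP; split; exact: ltW.
Qed.

End Interval.

(* Every point of the circle has an angle in [(0, 3 pi)], and two such angles of
   the same point differ by [2 pi] exactly when the smaller is in [(0, pi)]. *)
Lemma developing_map : exists F h, [/\ iso_adm h,
  forall s, itvo 0 (pi *+ 3) s -> develops s F &
  forall s e, itvo 0 pi s -> p e = ang s -> F (s + pi *+ 2) e = iso_act h (F s e)].
Proof.
have pi0 := pi_gt0 R.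
have p3 : 0 < pi *+ 3 :> R by rewrite pmulrn_rgt0.
have [F dF] := develops_global p3.
have d1 s : itvo 0 pi s -> develops s F.
  move=> /andP[s0 s1]; apply: dF; apply/andP; split=> //.
  by rewrite !mulrS mulr0n; lra.
(* Since [ang] has period [2 pi], the translate is a second development over [(0, pi)]; rigidity
   then yields the holonomy. *)
have d2 s : itvo 0 pi s -> develops s (fun s => F (s + pi *+ 2)).
  move=> /andP[s0 s1].
  have [|f [N [oN Ns fN]] H] := dF (s + pi *+ 2).
    by apply/andP; split; rewrite !mulrS mulr0n; lra.
  exists f; first by exists N; split=> //; rewrite -angD2pi.
  have c : {for s, continuous (fun s : R => s + pi *+ 2)}.
    by apply: continuousD; [exact: cvg_id|exact: cst_continuous].
  have H' : nbhs s [set s' | over (s' + pi *+ 2) (F (s' + pi *+ 2)) f] by exact: c _ H.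
  by apply: filterS H' => s' h e pe; apply: h; rewrite angD2pi.
have [h ah hP] := develops_rigid pi0 d1 d2.
by exists F, h.
Qed.

End Developing.

(** * The foliation by parallel hyperplanes *)

Section RealAffine.
Context {R : realType}.

Lemma is_derive_affine (a c t v : R) :
  is_derive t v (fun s : R => a * s + c) (a * v).
Proof.
have d1 : is_derive t v (a *: (id : R -> R)) (a *: v).
  by apply: is_deriveZ; exact: is_derive_id.
have d2 : is_derive t v (cst c : R -> R) 0 by exact: is_derive_cst.
by have := is_deriveD d1 d2; rewrite addr0.
Qed.

Lemma Ck_affine (a c : R) k (U : set R) : open U -> Ck k U (fun s : R => a * s + c).
Proof.
move=> oU.
have dh t : differentiable (fun s : R => a * s + c) t.
  apply: differentiableD; last exact: differentiable_cst.
  exact: (@differentiableZ _ _ _ id).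
case: k => [|k]; first by move=> x _; exact/differentiable_continuous.
split=> [x _|v]; first exact: dh.
apply: (@Ck_ext _ _ _ k U (cst (a * v))) => //; last exact: Ck_cst.
by move=> x _; rewrite (derive_val (is_derive := is_derive_affine a c x v)).
Qed.

Lemma smooth_on_affine (a c : R) (A : set R) : smooth_on A (fun s : R => a * s + c).
Proof.
move=> x _; exists setT, (fun s => a * s + c); split=> //; first exact: openT.
by move=> k; apply: Ck_affine; exact: openT.
Qed.

Lemma derive1_affine (a c t : R) : derive1 (fun s : R => a * s + c) t = a.
Proof.
by rewrite derive1E (derive_val (is_derive := is_derive_affine a c t 1)) mulr1.
Qed.

End RealAffine.

(* [Q^T + 1 = Q^T (1 + Q)] and [det Q = -1] give [det (Q^T + 1) = - det (Q^T + 1)]. *)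
Lemma orthogonal_eigenvector (R : realType) k (Q : 'M[R]_k) :
  Q *m Q^T = 1%:M -> \det Q != 1 -> exists2 v : 'rV[R]_k, v != 0 & v *m Q^T = - v.
Proof.
move=> QQ dQ1.
have dQ : \det Q = -1.
  have : \det Q ^+ 2 = 1 by rewrite expr2 -[X in _ * X]det_tr -det_mulmx QQ det1.
  by move=> /eqP; rewrite sqrf_eq1 (negbTE dQ1)/= => /eqP.
have : \det (Q^T + 1%:M) = 0.
  have E : Q^T + 1%:M = Q^T *m (Q^T + 1%:M)^T.
    by rewrite linearD/= trmxK trmx1 mulmxDr mulmx1 (mulmx1C QQ) addrC.
  have : \det (Q^T + 1%:M) = - \det (Q^T + 1%:M).
    by rewrite {1}E det_mulmx det_tr dQ mulN1r det_tr.
  by lra.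
move=> /eqP/det0P[v v0 vE]; exists v => //.
by apply/eqP; rewrite -addr_eq0 -[X in _ + X]mulmx1 -mulmxDr vE.
Qed.

Section Foliate.
Context {R : realType} {n : nat} {E : smooth_manifold R n}.
Variables (g : riemannian_metric E) (p : E -> 'rV[R]_2).
Hypotheses (Hp : is_disc_bundle n p).
Variables (F : R -> E -> 'rV[R]_n.+1) (h : @iso_grp R n) (v : 'rV[R]_n.+1).
Hypotheses (dF : forall s, itvo 0 (pi *+ 3) s -> develops g p s F)
  (hP : forall s e, itvo 0 pi s -> p e = ang s -> F (s + pi *+ 2) e = iso_act h (F s e))
  (v0 : v != 0) (vE : v *m h.1^T = - v).

Definition leaf_form (y : 'rV[R]_n.+1) : R := (y *m v^T) 0 0.

Lemma leaf_form_act y : leaf_form (iso_act h y) = - leaf_form y + leaf_form h.2.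
Proof.
rewrite /leaf_form /iso_act mulmxDl mxE -mulmxA.
have -> : h.1 *m v^T = - v^T by rewrite -[h.1]trmxK -trmx_mul vE linearN.
by rewrite mulmxN mxE.
Qed.

(** The continuous angle [sigma] records which branch of the multivalued developing map [f] comes
    from; overlaps are compared through it. *)
Definition leaf_chart (Uu : set E * (E -> R)) := exists f sigma,
  flat_on g Uu.1 f /\ forall e, Uu.1 e ->
    [/\ {for e, continuous sigma}, itvo 0 (pi *+ 3) (sigma e), p e = ang (sigma e),
        F (sigma e) e = f e & Uu.2 e = leaf_form (f e)].

Lemma leaf_chart_cover e : exists U u, leaf_chart (U, u) /\ U e.
Proof.
have pi0 := pi_gt0 R.
have [cp _ _] := Hp; have [s /andP[s0 s2] sE] := ang_surj (cp e).
have s3 : s < pi *+ 3 by apply: le_lt_trans s2 _; rewrite !mulrS mulr0n; lra.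
have Ks : itvo 0 (pi *+ 3) s by apply/andP.
have [f [N [oN Ns fN]] H] := dF Ks.
have /nbhs_ballP[d /= d0 Hd] : nbhs s [set s' | over p s' (F s') f /\ itvo 0 (pi *+ 3) s'].
  by apply: filterS2 H (itvo_near Ks) => s' h1 h2; split.
have [M [l [oM Ms ls lP]]] := ang_lift s d0.
exists (p @^-1` (N `&` M)), (fun e => leaf_form (f e)); split; last by rewrite /= -sE.
exists f, (l \o p); split.
  apply: (flat_on_sub _ _ fN); first by move=> e' [].
  by apply: (open_tube Hp); exact: openI.
move=> e' [/= Ne' Me']; have [cl lb lE] := lP _ Me'.
have lE' := lE (cp e').
have [|ho Kl] := Hd (l (p e')); first by rewrite -ball_normE /= distrC.
split=> //.
  by apply: continuous_comp; [exact: continuous_p Hp _|exact: cl].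
by apply: ho; rewrite lE'.
Qed.

(** The two angles of a point differ by [0], [2 pi] or [- 2 pi]. Near [e] this difference varies by
    less than [pi], so it is constant. It is zero when the functions coincide; in both other cases
    the holonomy gives [f' = - f + c] with the same constant, since this relation is its own
    inverse. *)
Lemma leaf_chart_compat U f U' f' e : leaf_chart (U, f) -> leaf_chart (U', f') ->
  U e -> U' e -> exists (I : set R) (k : R -> R),
    [/\ open I, smooth_on I k, (forall t, I t -> derive1 k t != 0) &
      \forall y \near e, I (f y) /\ f' y = k (f y)].
Proof.
move=> [f1 [sg [fU H]]] [f2 [sg' [fU' H']]] Ue U'e.
rewrite /= in fU fU' H H'.
have pi0 := pi_gt0 R.
suff [a [c [a0 N]]] : exists a c, a != 0 /\ \forall y \near e, f' y = a * f y + c.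
  exists setT, (fun t => a * t + c); split; first exact: openT.
  - exact: smooth_on_affine.
  - by move=> t _; rewrite derive1_affine.
  - by apply: filterS N => y.
have [c1 k1 p1 _ _] := H e Ue; have [c2 k2 p2 _ _] := H' e U'e.
have n1 : nbhs e U by apply: open_nbhs_nbhs; split=> //; exact: fU.1.
have n2 : nbhs e U' by apply: open_nbhs_nbhs; split=> //; exact: fU'.1.
have pi2 : 0 < pi / 2 :> R by rewrite divr_gt0.
have n3 : \forall y \near e, `|sg e - sg y| < pi / 2 by move/cvgrPdist_lt : c1; exact.
have n4 : \forall y \near e, `|sg' e - sg' y| < pi / 2 by move/cvgrPdist_lt : c2; exact.
have n5 : \forall y \near e, [/\ U y, U' y & `|(sg e - sg' e) - (sg y - sg' y)| < pi].
  apply: filterS3 n1 n2 (filterI n3 n4) => y Uy U'y [/= h1 h2]; split=> //.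
  have -> : sg e - sg' e - (sg y - sg' y) = (sg e - sg y) - (sg' e - sg' y) by ring.
  apply: le_lt_trans (ler_normB _ _) _; rewrite [ltRHS]splitr; exact: ltrD.
have cases y : U y -> U' y -> [\/ sg y = sg' y, sg y = sg' y + pi *+ 2 | sg' y = sg y + pi *+ 2].
  move=> Uy U'y; have [_ /andP[q1 q2] q3 _ _] := H y Uy; have [_ /andP[r1 r2] r3 _ _] := H' y U'y.
  apply: ang_eq; first by rewrite -q3 -r3.
  rewrite ltr_norml; apply/andP; move: q2 r2; rewrite !mulrS mulr0n => q2 r2; split; lra.
have pp : pi *+ 2 = pi + pi :> R by rewrite mulr2n.
have p3 : pi *+ 3 = pi + pi + pi :> R by rewrite !mulrS mulr0n addr0 addrA.
case: (cases e Ue U'e) => De.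
- exists 1, 0; split; first exact: oner_neq0.
  apply: filterS n5 => y [Uy U'y]; rewrite De subrr sub0r normrN => b.
  have [_ _ _ q4 q5] := H y Uy; have [_ _ _ r4 r5] := H' y U'y.
  rewrite mul1r addr0 q5 r5 -q4 -r4.
  case: (cases y Uy U'y) => Dy; first by rewrite Dy.
    by exfalso; move: b; rewrite Dy pp ltr_norml => /andP[]; lra.
  by exfalso; move: b; rewrite Dy pp ltr_norml => /andP[]; lra.
- exists (-1), (leaf_form h.2); split; first by rewrite oppr_eq0 oner_neq0.
  apply: filterS n5 => y [Uy U'y]; rewrite De => b.
  have [_ /andP[_ q2] _ q4 q5] := H y Uy; have [_ /andP[r1 r2] r3 r4 r5] := H' y U'y.
  rewrite q5 r5 -q4 -r4.
  case: (cases y Uy U'y) => Dy.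
  + by exfalso; move: b; rewrite Dy pp ltr_norml => /andP[]; lra.
  + rewrite Dy hP//; last by apply/andP; split=> //; move: q2; rewrite Dy pp p3; lra.
    rewrite leaf_form_act; lra.
  + by exfalso; move: b; rewrite Dy pp ltr_norml => /andP[]; lra.
- exists (-1), (leaf_form h.2); split; first by rewrite oppr_eq0 oner_neq0.
  apply: filterS n5 => y [Uy U'y]; rewrite De => b.
  have [_ /andP[q1 q2] q3 q4 q5] := H y Uy; have [_ /andP[r1 r2] _ r4 r5] := H' y U'y.
  rewrite q5 r5 -q4 -r4.
  case: (cases y Uy U'y) => Dy.
  + by exfalso; move: b; rewrite Dy pp ltr_norml => /andP[]; lra.
  + by exfalso; move: b; rewrite Dy pp ltr_norml => /andP[]; lra.
  + rewrite Dy hP//; last by apply/andP; split=> //; move: r2; rewrite Dy pp p3; lra.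
    rewrite leaf_form_act; lra.
Qed.

Lemma leaf_chart_flat U u : leaf_chart (U, u) ->
  exists f, flat_on g U f /\ forall e, U e -> u e = (f e *m v^T) 0 0.
Proof. by move=> [f [sg [fU H]]]; exists f; split=> // e /H[]. Qed.

Lemma hyperplane_foliation : exists Fol : foliation E, minimal_leaves g Fol.
Proof.
have D1 U u : leaf_chart (U, u) -> open U.
  by move=> /leaf_chart_flat[f [[]]].
have D2 U u : leaf_chart (U, u) -> smooth_from U u.
  by move=> /leaf_chart_flat[f [fU uE]]; exact: flat_form_smooth fU uE.
have D3 U u c x : leaf_chart (U, u) -> @atlas R n E c -> (cmap c @` (U `&` cdom c)) x ->
    exists X : 'rV[R]_n.+1, dwithin (cmap c @` (U `&` cdom c)) (u \o cinv c) x X != 0.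
  by move=> /leaf_chart_flat[f [fU uE]] Ac; exact: flat_form_submersion fU uE _ _ v0 Ac.
exists (@Foliation R n E leaf_chart D1 leaf_chart_cover D2 D3 leaf_chart_compat).
move=> U u c x /= /leaf_chart_flat[f [fU uE]] Ac xi Ux.
exact: flat_form_minimal fU uE _ _ Ac xi Ux.
Qed.

End Foliate.

(** * Orientation of the fibres *)

Section JacobianTools.
Context {R : realType}.

Lemma jacobian_comp a b c (f : 'rV[R]_a -> 'rV[R]_b) (h : 'rV[R]_b -> 'rV[R]_c) x :
  differentiable f x -> differentiable h (f x) ->
  'J (h \o f) x = 'J f x *m 'J h (f x).
Proof.
move=> df dh; apply: row_mulmx_inj => v.
rewrite /jacobian mulmxA !mul_rV_lin1.
by have := diff_comp df dh => /(congr1 (fun k => k v)).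
Qed.

Lemma continuous_bigsum (T : topologicalType) (I : Type) (r : seq I) (F : I -> T -> R) (x : T) :
  (forall i, {for x, continuous (F i)}) ->
  {for x, continuous (fun y => \sum_(i <- r) F i y)}.
Proof.
move=> d; elim: r => [|i r IH].
  have -> : (fun y => \sum_(i <- [::]) F i y) = cst 0.
    by apply/funext => y; rewrite big_nil.
  exact: cst_continuous.
have -> : (fun y => \sum_(i <- i :: r) F i y) = F i + (fun y => \sum_(i <- r) F i y).
  by apply/funext => y; rewrite big_cons.
exact: continuousD.
Qed.

Lemma continuous_entry (T : topologicalType) a b (M : T -> 'M[R]_(a, b)) x i j :
  {for x, continuous M} -> {for x, continuous (fun y => M y i j : R)}.
Proof.
move=> cM; apply: (@continuous_comp _ _ _ M (fun N : 'M[R]_(a, b) => N i j : R)) => //.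
exact: coord_continuous.
Qed.

Lemma continuous_mulmx (T : topologicalType) a b c (M : T -> 'M[R]_(a, b))
    (N : T -> 'M[R]_(b, c)) x :
  {for x, continuous M} -> {for x, continuous N} ->
  {for x, continuous (fun y => M y *m N y)}.
Proof.
move=> cM cN; apply: continuous_mx => i j.
have -> : (fun y => (M y *m N y) i j) = (fun y => \sum_k M y i k * N y k j).
  by apply/funext => y; rewrite mxE.
apply: continuous_bigsum => k; apply: continuousM; exact: continuous_entry.
Qed.

Lemma continuous_det (T : topologicalType) a (M : T -> 'M[R]_a) x :
  {for x, continuous M} -> {for x, continuous (fun y => \det (M y))}.
Proof.
move=> cM; apply: (@continuous_comp _ _ _ M (fun N : 'M[R]_a => \det N)) => //.
by apply: differentiable_continuous; apply: (@differentiable_det _ _ _ id).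
Qed.

Lemma near_eq_continuous (T U : topologicalType) (f h : T -> U) x :
  (\near x, f x = h x) -> {for x, continuous f} -> {for x, continuous h}.
Proof.
move=> fh cf N; rewrite -(nbhs_singleton fh) => Nh.
have nf : \forall y \near x, N (f y) by exact: cf.
have nh : \forall y \near x, N (h y) by apply: filterS2 fh nf => y ->.
exact: nh.
Qed.

Lemma local_max_diff (V : normedModType R) (q : V -> R) x v : differentiable q x ->
  (\forall y \near x, q y <= q x) -> 'd q x v = 0.
Proof.
move=> dq mq.
suff le0 u : 'd q x u <= 0.
  apply/eqP; rewrite eq_le le0 /=; have := le0 (- v).
  by rewrite linearN oppr_le0.
have [->|u0] := eqVneq u 0; first by rewrite linear0.
have nu : 0 < `|u| by rewrite normr_gt0.
apply/ler_addgt0Pl => e e0; rewrite addr0.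
have e1 : 0 < e / `|u| by rewrite divr_gt0.
have H := diff_expansion dq e1.
have /nbhs_ballP[r /= r0 Hr] : nbhs x [set y | `|q y - q x - 'd q x (y - x)| <= e / `|u| * `|y - x| /\ q y <= q x].
  by apply: filterS2 H mq => y; split.
have [t t0 tb] := small_step x u r0.
have [h1 h2] := Hr _ tb.
have E : x + t *: u - x = t *: u by rewrite addrAC subrr add0r.
rewrite E in h1.
have Z : 'd q x (t *: u) = t * 'd q x u by rewrite linearZ.
rewrite Z normrZ gtr0_norm// mulrCA divfK ?gt_eqF// in h1.
move: h1; rewrite ler_norml => /andP[h1 _].
have : t * 'd q x u <= t * e by move: h1 h2; move: ('d q x u) => D h1 h2; lra.
by rewrite ler_pM2l.
Qed.

End JacobianTools.

Section CylJacobian.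
Context {R : realType} {n : nat}.

Lemma derive_ang (s : R) : 'D_1 ang s = ang (s + pi / 2).
Proof.
have d : derivable (@ang R) s 1 by exact/diff_derivable/differentiable_ang.
rewrite derive_mx//; apply: row2P; rewrite mxE ?ang0 ?ang1.
  have -> : (fun t : R => ang t 0 0) = cos by apply/funext => t; rewrite ang0.
  by rewrite cosDpihalf (derive_val (is_derive := is_derive_cos s)).
have -> : (fun t : R => ang t 0 1) = sin by apply/funext => t; rewrite ang1.
by rewrite sinDpihalf (derive_val (is_derive := is_derive_sin s)).
Qed.

Lemma diff_cyl (w v : 'rV[R]_(1 + n)) :
  'd cyl w v = row_mx (angle v *: ang (angle w + pi / 2)) (rsubmx v).
Proof.
have dc := differentiable_cyl w.
rewrite -deriveE// derive_mx; last exact: diff_derivable.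
apply/rowP => j; rewrite [LHS]mxE [RHS]mxE; case Ej : (fintype.split j) => [k|k].
  have -> : (fun y => @cyl R n y 0 j) = (fun t => ang t 0 k) \o angle.
    by apply/funext => y; rewrite /= /cyl mxE Ej.
  have dh : differentiable angle w := differentiable_angle w.
  have da : differentiable (fun t : R => ang t 0 k) (angle w).
    exact/differentiable_entry/differentiable_ang.
  rewrite deriveE; last exact: differentiable_comp.
  rewrite diff_comp//=.
  have hdv : 'd angle w v = angle v.
    have @l : {linear 'rV[R]_(1 + n) -> R}.
      by exists angle; do 2![eexists]; do ?[constructor];
        rewrite /angle ?mxE// => ? *; rewrite ?mxE//; move=> ?; rewrite !mxE.
    by rewrite (_ : angle = l)// diff_lin//; exact: continuous_angle.
  rewrite hdv.
  have -> : 'd (fun t : R => ang t 0 k) (angle w) (angle v) = angle v *: 'd (fun t : R => ang t 0 k) (angle w) 1.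
    by rewrite -linearZ /= [angle v *: 1]mulr1.
  rewrite -deriveE// [RHS]mxE; congr (_ * _).
  rewrite -derive_ang derive_mx ?mxE//.
  exact/diff_derivable/differentiable_ang.
have -> : (fun y => @cyl R n y 0 j) = (fun y => rsubmx y 0 k).
  by apply/funext => y; rewrite /cyl mxE Ej.
have dr : derivable (rsubmx : 'rV[R]_(1 + n) -> 'rV[R]_n) w v.
  exact/diff_derivable/differentiable_rsubmx.
have := derive_mx dr => /matrixP /(_ 0 k); rewrite [RHS]mxE => <-.
rewrite deriveE; last exact: differentiable_rsubmx.
by rewrite diff_lin//; move=> z; exact/differentiable_continuous/differentiable_rsubmx.
Qed.

(** The derivative of [ang] is again a point of the unit circle, a quarter turn ahead, hence
    nonzero. *)
Lemma cyl_jacobian_inj (w v : 'rV[R]_(1 + n)) : v *m 'J cyl w = 0 -> v = 0.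
Proof.
rewrite /jacobian mul_rV_lin1 diff_cyl => H.
have h1 : angle v *: ang (angle w + pi / 2) = 0.
  by have := congr1 lsubmx H; rewrite row_mxKl linear0.
have h2 : rsubmx v = 0 by have := congr1 rsubmx H; rewrite row_mxKr linear0.
have hv : angle v = 0.
  have /circleE c := ang_circle (angle w + pi / 2).
  move/rowP : h1 => h1; have := h1 0; have := h1 1; rewrite mxE [RHS]mxE => a1; rewrite mxE [RHS]mxE => a0.
  rewrite -[LHS]mulr1 -c mulrDr !expr2 !mulrA.
  by rewrite a0 a1 !mul0r addr0.
rewrite -[v]hsubmxK h2; have -> : lsubmx v = 0.
  by apply/rowP => i; rewrite (ord1 i) !mxE.
exact: row_mx0.
Qed.

Lemma continuous_cyl_jacobian w : {for w, continuous (jacobian (@cyl R n))}.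
Proof.
apply: continuous_mx => i j.
have -> : (fun y => 'J (@cyl R n) y i j) =
  (fun y => row_mx (angle (delta_mx 0 i) *: ang (angle y + pi / 2)) (rsubmx (delta_mx 0 i)) 0 j).
  apply/funext => y; rewrite -diff_cyl.
  by rewrite jacobianE ?deriveE//; exact: differentiable_cyl.
apply: differentiable_continuous.
apply: differentiable_entry; apply: differentiable_row_mx; last exact: differentiable_cst.
apply: differentiableZ; apply: differentiable_comp; last exact: differentiable_ang.
by apply: differentiableD; [exact: differentiable_angle|exact: differentiable_cst].
Qed.

End CylJacobian.

Section Orientation.
Context {R : realType} {n : nat} {E : smooth_manifold R n}.
Variables (g : riemannian_metric E) (p : E -> 'rV[R]_2).
Hypotheses (Hp : is_disc_bundle n p).
Variables (F : R -> E -> 'rV[R]_n.+1).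
Hypotheses (dF : forall s, itvo 0 (pi *+ 3) s -> develops g p s F).
Implicit Types (t : trivialization n E) (w : 'rV[R]_(1 + n)).

Definition dev_param t w : 'rV[R]_n.+1 := F (angle w) (param t w).

(* Restricting to the open disc makes [dev_param] differentiable in the ordinary sense. *)
Definition good t w :=
  [/\ itvo 0 (pi *+ 3) (angle w), tbase t (ang (angle w)) & open_disc R n (rsubmx w)].

Lemma open_disc_disc (x : 'rV[R]_n) : open_disc R n x -> disc R n x.
Proof. exact: ltW. Qed.

Lemma near_open_disc w : open_disc R n (rsubmx w) ->
  \forall w' \near w, open_disc R n (rsubmx w').
Proof.
move=> dw.
have c : {for w, continuous (fun w' : 'rV[R]_(1 + n) => inner 1%:M (rsubmx w') (rsubmx w') : R)}.
  by apply: differentiable_continuous; apply: continuous_inner1; exact: differentiable_rsubmx.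
have := c [set s | s < 1]; apply.
by apply: open_nbhs_nbhs; split; [exact: open_lt|exact: dw].
Qed.

Section MuLocal.
Variables (t : trivialization n E) (w : 'rV[R]_(1 + n)).
Hypotheses (Ht : is_trivialization p t) (tw : tbase t (ang (angle w))) (dw : disc R n (rsubmx w)).

Lemma tmap_extension c : @atlas R n E c -> cdom c (param t w) ->
  exists (U : set 'rV[R]_n.+1) (K : 'rV[R]_n.+1 -> 'rV[R]_(2 + n)),
  [/\ open U, U (cmap c (param t w)), (forall k, Ck k U K) &
    forall e, tbase t (p e) -> cdom c e -> U (cmap c e) -> K (cmap c e) = tmap t e].
Proof.
move=> Ac ce; have [_ _ _ st _] := Ht.
have [_ _ cK _ _] := atlas_charts Ac.
have te : tbase t (p (param t w)) by rewrite (param_p Ht).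
have xA : (cmap c @` (p @^-1` tbase t `&` cdom c)) (cmap c (param t w)) by exists (param t w).
have [U [K [oU Ux CK KE]]] := st c Ac _ xA.
exists U, K; split=> // e te' ce' Ue.
by rewrite KE//=; [rewrite cK|exists e].
Qed.

Lemma tinv_extension c : @atlas R n E c -> cdom c (param t w) ->
  exists (U : set 'rV[R]_(2 + n)) (H : 'rV[R]_(2 + n) -> 'rV[R]_n.+1),
  [/\ open U, U (cyl w), (forall k, Ck k U H) &
    \forall w' \near w, disc R n (rsubmx w') ->
      [/\ U (cyl w'), cdom c (param t w'), tbase t (ang (angle w')) & H (cyl w') = cmap c (param t w')]].
Proof.
move=> Ac ce; have [_ _ _ _ [_ st]] := Ht.
have [oc _ _ _ _] := atlas_charts Ac.
have zA : (tprod t `&` tinv t @^-1` cdom c) (cyl w) by split; [exact: cyl_tprod|].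
have [U [H [oU Uz CH HE]]] := st c Ac _ zA.
exists U, H; split=> //.
have n1 : nbhs w [set w' | U (cyl w')] by apply: continuous_cyl; exact: open_nbhs_nbhs.
have n2 := param_near Ht tw dw (open_nbhs_nbhs (conj oc ce)).
apply: filterS3 n1 n2 (near_tbase Ht tw) => w' h1 h2 h3 dw'.
have h4 := h2 dw'; split=> //.
by apply: HE => //; split; [exact: cyl_tprod|].
Qed.

End MuLocal.

(* [K], which extends [tmap t], is a left inverse of [Psi], so that the derivative
   of [Psi \o cyl] is injective. *)
Lemma dev_param_factor t w : is_trivialization p t -> good t w ->
  exists (Psi : 'rV[R]_(2 + n) -> 'rV[R]_n.+1) (Phi : 'rV[R]_n.+1 -> 'rV[R]_n.+1)
    (K : 'rV[R]_n.+1 -> 'rV[R]_(2 + n)) U V,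
  [/\ [/\ open U, U (cyl w), Ck 2 U Psi, open V & V (Psi (cyl w))],
     Ck 2 V Phi, 'J Phi (Psi (cyl w)) \in unitmx,
     (differentiable K (Psi (cyl w)) /\ \forall w' \near w, K (Psi (cyl w')) = cyl w') &
     \forall w' \near w, Phi (Psi (cyl w')) = dev_param t w'].
Proof.
move=> Ht Gw; have [w1 w2 w3] := Gw; have w3' := open_disc_disc w3.
have [c Ac ce] := atlas_cover (param t w).
have [oc _ cK _ _] := atlas_charts Ac.
have [U1 [K [oU1 U1x CK KE]]] := tmap_extension Ht w2 w3' Ac ce.
have [U2 [H [oU2 U2z CH HE]]] := tinv_extension Ht w2 w3' Ac ce.
have [f [N [oN Ns fN]] dN] := dF w1.
have pw : p (param t w) = ang (angle w) by rewrite (param_p Ht).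
have Ne : (p @^-1` N) (param t w) by rewrite /= pw.
have [r [Phi [r0 [S P]]]] := fN.2 _ c Ne Ac ce.
have Hx : H (cyl w) = cmap c (param t w) by have [_ _ _ ->] := nbhs_singleton HE w3'.
have [cx _ GE] := P _ (ballxx _ r0) (chart_half_space Ac ce).
exists H, Phi, K, U2, (ball (cmap c (param t w)) r); rewrite Hx; split.
- split=> //; [exact: ball_open|exact: ballxx].
- exact: S.
- exact: unitmx_of_gram Ac cx GE.
- split; first exact: (CK 1%N).1.
  have n1 : nbhs w [set w' | U1 (H (cyl w'))].
    have cH : {for cyl w, continuous H} by exact: (CH 0%N).
    have c1 : {for w, continuous (H \o cyl)} by apply: continuous_comp => //; exact: continuous_cyl.
    by apply: c1; rewrite /= Hx; exact: open_nbhs_nbhs.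
  apply: filterS3 n1 HE (near_open_disc w3) => w' /= h1 h2 h3.
  have [q1 q2 q3 q4] := h2 (open_disc_disc h3).
  rewrite q4 KE//; first by rewrite (tmap_param Ht) //; exact: open_disc_disc.
    by rewrite (param_p Ht)//; exact: open_disc_disc.
  by rewrite -q4.
- have n1 : nbhs w [set w' | ball (cmap c (param t w)) r (H (cyl w'))].
    have cH : {for cyl w, continuous H} by exact: (CH 0%N).
    have c1 : {for w, continuous (H \o cyl)} by apply: continuous_comp => //; exact: continuous_cyl.
    by apply: c1; rewrite /= Hx; exact: nbhsx_ballx.
  have n2 : nbhs w [set w' | over p (angle w') (F (angle w')) f] by exact: continuous_angle _ _ dN.
  have n12 : nbhs w [set w' | ball (cmap c (param t w)) r (H (cyl w')) /\ over p (angle w') (F (angle w')) f].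
    by apply: filterS2 n1 n2 => w'; split.
  apply: filterS3 n12 HE (near_open_disc w3) => w' /= [h1 h1'] h2 h3.
  have [q1 q2 q3 q4] := h2 (open_disc_disc h3).
  rewrite q4 in h1 *.
  have [_ -> _] := P _ h1 (chart_half_space Ac q2).
  rewrite cK// /dev_param h1'// (param_p Ht)//; exact: open_disc_disc.
Qed.

Lemma row_free_cyl w a (A : 'M[R]_(2 + n, a)) (K : 'M[R]_(a, 2 + n)) :
  'J (@cyl R n) w *m A *m K = 'J (@cyl R n) w -> row_free ('J (@cyl R n) w *m A).
Proof.
move=> H; apply: inj_row_free => v vA; apply: (@cyl_jacobian_inj _ _ w).
by rewrite -H mulmxA vA mul0mx.
Qed.

(** By the chain rule the Jacobian is that of [Psi \o cyl], which is square although its two factors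
    are not, times that of [Phi]. The former is injective because [K] undoes [Psi] on the image of
    [cyl], the latter because [Phi] induces the metric. *)
Lemma dev_param_regular t w : is_trivialization p t -> good t w ->
  [/\ differentiable (dev_param t) w,
      \det ('J (dev_param t) w) != 0 &
      {for w, continuous (fun w' => \det ('J (dev_param t) w'))}].
Proof.
move=> Ht Gw.
have [Psi [Phi [K [U [V [[oU Uw CPsi oV Vw] CPhi Ju [dK nK] nmu]]]]]] := dev_param_factor Ht Gw.
have c0 : {for w, continuous (Psi \o @cyl R n)}.
  apply: continuous_comp; first exact: continuous_cyl.
  exact/differentiable_continuous/CPsi.1.
have nU : nbhs w [set w' | U (cyl w')] by apply: continuous_cyl; exact: open_nbhs_nbhs.
have nV : nbhs w [set w' | V (Psi (cyl w'))] by apply: c0; exact: open_nbhs_nbhs.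
have dcomp w' : U (cyl w') -> differentiable (Psi \o @cyl R n) w'.
  by move=> Uw'; apply: differentiable_comp; [exact: differentiable_cyl|exact: CPsi.1].
have dmu' w' : U (cyl w') -> V (Psi (cyl w')) -> differentiable (Phi \o (Psi \o @cyl R n)) w'.
  by move=> Uw' Vw'; apply: differentiable_comp; [exact: dcomp|exact: CPhi.1].
pose JJ w' : 'M[R]_(1 + n, n.+1) :=
  'J (@cyl R n) w' *m 'J Psi (cyl w') *m 'J Phi (Psi (cyl w')).
have JE w' : U (cyl w') -> V (Psi (cyl w')) ->
    'J (Phi \o (Psi \o @cyl R n)) w' = JJ w'.
  move=> Uw' Vw'; rewrite (jacobian_comp (dcomp w' Uw') (CPhi.1 _ Vw')).
  by rewrite (jacobian_comp (differentiable_cyl w') (CPsi.1 _ Uw')).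
have nJ : \forall w' \near w, JJ w' = 'J (dev_param t) w'.
  have := near_join nmu => nmu'.
  apply: filterS3 nU nV nmu' => w' Uw' Vw' nw'.
  have e1 := JE w' Uw' Vw'.
  have d1 := dmu' w' Uw' Vw'.
  have e2 := near_eq_jacobian d1 nw'.
  exact: (etrans (esym e1) e2).
have JK : 'J (@cyl R n) w *m 'J Psi (cyl w) *m 'J K (Psi (cyl w)) = 'J (@cyl R n) w.
  have e1 := jacobian_comp (differentiable_cyl w) (CPsi.1 _ Uw).
  have e2 := jacobian_comp (dcomp w Uw) dK.
  have d3 : differentiable (K \o (Psi \o @cyl R n)) w.
    by apply: differentiable_comp; [exact: dcomp|exact: dK].
  have e3 := near_eq_jacobian d3 nK.
  exact: (etrans (congr1 (mulmx^~ _) (esym e1)) (etrans (esym e2) e3)).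
split.
- exact: (near_eq_differentiable nmu (dmu' w Uw Vw)).
- rewrite -(nbhs_singleton nJ) /=.
  rewrite det_mulmx mulf_neq0//; last by rewrite -unitfE -unitmxE.
  have := row_free_cyl JK; rewrite row_free_unit unitmxE unitfE; exact.
- have cdet : {for w, continuous (fun w' => \det (JJ w') : R)}.
    apply: continuous_det; apply: continuous_mulmx; first apply: continuous_mulmx.
    + exact: continuous_cyl_jacobian.
    + apply: (@continuous_comp _ _ _ (@cyl R n) (jacobian Psi)); first exact: continuous_cyl.
      exact/differentiable_continuous/(differentiable_jacobian oU Uw CPsi).
    + apply: (@continuous_comp _ _ _ (Psi \o @cyl R n) (jacobian Phi)); first exact: c0.
      exact/differentiable_continuous/(differentiable_jacobian oV Vw CPhi).
  apply: (near_eq_continuous _ cdet).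
  by apply: filterS nJ => w' ->.
Qed.

Lemma open_disc_convex : convex_on (open_disc R n).
Proof.
move=> x y t; rewrite /open_disc /= !inner1E => x1 y1 /andP[t0 t1].
have : \sum_i ((1 - t) * (x 0 i * x 0 i) + t * (y 0 i * y 0 i)) < 1.
  rewrite big_split/= -!mulr_sumr.
  have [->|tn0] := eqVneq t 0; first by rewrite subr0 mul1r mul0r addr0.
  have tp : 0 < t by rewrite lt_def tn0.
  have a1 : (1 - t) * \sum_i x 0 i * x 0 i <= (1 - t) * 1.
    by apply: ler_wpM2l; [rewrite subr_ge0|exact: ltW].
  have a2 : t * \sum_i y 0 i * y 0 i < t * 1 by rewrite ltr_pM2l.
  by apply: lt_le_trans (ler_ltD a1 a2) _; rewrite !mulr1 subrK.
apply: le_lt_trans; apply: ler_sum => i _; rewrite !mxE.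
move: (x 0 i) (y 0 i) => a b.
rewrite -subr_ge0.
have -> : (1 - t) * (a * a) + t * (b * b) - (a + t * (b - a)) * (a + t * (b - a)) = t * (1 - t) * (a - b) ^+ 2 by ring.
by rewrite mulr_ge0 ?sqr_ge0// mulr_ge0// subr_ge0.
Qed.

Definition open_slab (s0 d : R) : set 'rV[R]_(1 + n) :=
  [set w | `|angle w - s0| < d /\ open_disc R n (rsubmx w)].

Lemma open_slab_convex s0 d : convex_on (open_slab s0 d).
Proof.
move=> x y t [x1 x2] [y1 y2] t01; split; last first.
  have -> : rsubmx (x + t *: (y - x)) = rsubmx x + t *: (rsubmx y - rsubmx x).
    by apply/rowP => i; rewrite !mxE.
  exact: open_disc_convex.
by have [] := @slab_convex R n s0 d x y t (conj x1 (open_disc_disc x2)) (conj y1 (open_disc_disc y2)) t01.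
Qed.

Lemma sign_near (V : normedModType R) (f : V -> R) z : f z != 0 ->
  {for z, continuous f} -> \forall y \near z, (0 < f y) = (0 < f z).
Proof.
move=> f0 c; have [fp|fn|fE] := ltgtP 0 (f z); last by rewrite -fE eqxx in f0.
  have := c [set x | 0 < x]; rewrite /= => cc.
  have n1 : \forall y \near z, 0 < f y.
    by apply: cc; apply: open_nbhs_nbhs; split; [exact: open_gt|exact: fp].
  by apply: filterS n1 => y ->.
have := c [set x | x < 0]; rewrite /= => cc.
have n1 : \forall y \near z, f y < 0.
  by apply: cc; apply: open_nbhs_nbhs; split; [exact: open_lt|exact: fn].
by apply: filterS n1 => y yn; apply/negbTE; rewrite -leNgt ltW.
Qed.

Lemma det_sign_const t s0 d : is_trivialization p t ->
  (forall w, open_slab s0 d w -> good t w) ->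
  forall w w', open_slab s0 d w -> open_slab s0 d w' ->
  (0 < \det ('J (dev_param t) w)) = (0 < \det ('J (dev_param t) w')).
Proof.
move=> Ht HG w w' Kw Kw'.
apply: (@locally_constant_convex R _ (open_slab s0 d) bool (fun w => 0 < \det ('J (dev_param t) w))) => //.
  exact: open_slab_convex.
move=> z Kz; have [_ d0 c] := dev_param_regular Ht (HG z Kz).
have N := @sign_near _ (fun w' => \det ('J (dev_param t) w')) z d0 c.
by apply: filterS N => y yE _; exact: yE.
Qed.

End Orientation.

Section JacobianLinear.
Context {R : realType}.

Lemma differentiable_linear a b (Q : 'M[R]_(a, b)) (c : 'rV[R]_b) x :
  differentiable (fun y : 'rV[R]_a => y *m Q + c) x.
Proof.
apply: differentiableD; last exact: differentiable_cst.
exact: (@differentiable_mulmx_cst _ _ _ _ _ id).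
Qed.

Lemma jacobian_linear a b (Q : 'M[R]_(a, b)) (c : 'rV[R]_b) x :
  'J (fun y : 'rV[R]_a => y *m Q + c) x = Q.
Proof.
have di : differentiable (id : 'rV[R]_a -> 'rV[R]_a) x by [].
have e1 : 'J (id : 'rV[R]_a -> 'rV[R]_a) x = 1%:M.
  apply: row_mulmx_inj => v; rewrite -(deriveEjacobian _ di) mulmx1.
  exact: derive_id.
have e2 := jacobian_affine Q c di.
exact: (etrans e2 (etrans (congr1 (mulmx^~ Q) e1) (mul1mx Q))).
Qed.

End JacobianLinear.

Section Mk.
Context {R : realType} {n : nat}.

Definition cyl_point (s : R) (x : 'rV[R]_n) : 'rV[R]_(1 + n) := row_mx s%:M x.

Lemma angle_cyl_point s x : angle (cyl_point s x) = s.
Proof. by rewrite /angle row_mxEl mxE. Qed.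

Lemma rsubmx_cyl_point s x : rsubmx (cyl_point s x) = x.
Proof. exact: row_mxKr. Qed.

Lemma cyl_point_eta w : cyl_point (angle w) (rsubmx w) = w.
Proof.
rewrite -[RHS]hsubmxK /cyl_point; congr row_mx; apply/rowP => i.
by rewrite (ord1 i) !mxE.
Qed.

Lemma cyl_cyl_point s x : cyl (cyl_point s x) = row_mx (ang s) x.
Proof. by rewrite /cyl angle_cyl_point rsubmx_cyl_point. Qed.

Lemma differentiable_cyl_point (V : normedModType R) (f : V -> R) (h : V -> 'rV[R]_n) x :
  differentiable f x -> differentiable h x -> differentiable (fun y => cyl_point (f y) (h y)) x.
Proof.
move=> df dh; apply: differentiable_row_mx => //.
apply: differentiable_mx => i j.
have -> : (fun y => (f y)%:M i j) = f by apply/funext => y; rewrite mxE (ord1 i) (ord1 j).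
exact: df.
Qed.

Lemma disc_inner_le1 (x y : 'rV[R]_n) : disc R n x -> disc R n y -> inner 1%:M x y <= 1.
Proof.
rewrite /disc /= !inner1E => dx dy.
have : \sum_i x 0 i * y 0 i <= \sum_i ((x 0 i * x 0 i) / 2 + (y 0 i * y 0 i) / 2).
  apply: ler_sum => i _; move: (x 0 i) (y 0 i) => a b.
  have := sqr_ge0 (a - b); rewrite expr2 => h; lra.
rewrite big_split/= -!mulr_suml; lra.
Qed.

End Mk.

(** * Changes of trivialization in cylinder coordinates *)

Section Transition.
Context {R : realType} {n : nat} {E : smooth_manifold R n}.
Variables (g : riemannian_metric E) (p : E -> 'rV[R]_2).
Hypotheses (Hp : is_disc_bundle n p).
Variables (F : R -> E -> 'rV[R]_n.+1).
Hypotheses (dF : forall s, itvo 0 (pi *+ 3) s -> develops g p s F).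
Implicit Types (t : trivialization n E) (w : 'rV[R]_(1 + n)).

Definition change_param t t' w : 'rV[R]_(1 + n) := cyl_point (angle w) (rsubmx (tmap t' (param t w))).

Lemma angle_change_param t t' w : angle (change_param t t' w) = angle w.
Proof. exact: angle_cyl_point. Qed.

Lemma kapP t t' w : is_trivialization p t -> is_trivialization p t' ->
  tbase t (ang (angle w)) -> tbase t' (ang (angle w)) -> disc R n (rsubmx w) ->
  disc R n (rsubmx (change_param t t' w)) /\ param t' (change_param t t' w) = param t w.
Proof.
move=> Ht Ht' tw tw' dw; have pe := param_p Ht tw dw.
have [_ h _ _ _] := Ht'.
have [|[_ _ q1] q2 q3] := h (param t w); first by rewrite pe.
split; first by rewrite rsubmx_cyl_point.
by rewrite {1}/param /change_param cyl_cyl_point -pe -q2 hsubmxK.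
Qed.

(** At this stage the image of [w] might lie on the boundary sphere, where the reverse change of
    trivialization is not known to be differentiable in the ordinary sense. Hence the left inverse
    is built from smooth extensions. *)
Lemma change_param_regular t t' w : is_trivialization p t -> is_trivialization p t' ->
  tbase t (ang (angle w)) -> tbase t' (ang (angle w)) -> open_disc R n (rsubmx w) ->
  differentiable (change_param t t') w /\ 'J (change_param t t') w \in unitmx.
Proof.
move=> Ht Ht' tw tw' ow; have dw := open_disc_disc ow.
have [dk psik] := kapP Ht Ht' tw tw' dw.
have hk := angle_change_param t t' w.
have [c Ac ce] := atlas_cover (param t w).
have ce' : cdom c (param t' (change_param t t' w)) by rewrite psik.
have tk : tbase t' (ang (angle (change_param t t' w))) by rewrite hk.
have [U1 [K [oU1 U1x CK KE]]] := tmap_extension Ht tw dw Ac ce.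
have [U2 [H [oU2 U2z CH HE]]] := tinv_extension Ht tw dw Ac ce.
have [U3 [K' [oU3 U3x CK' KE']]] := tmap_extension Ht' tk dk Ac ce'.
have [U4 [H' [oU4 U4z CH' HE']]] := tinv_extension Ht' tk dk Ac ce'.
rewrite psik in U3x.
have Hw : H (cyl w) = cmap c (param t w) by have [_ _ _ ->] := nbhs_singleton HE dw.
have Hw' : H' (cyl (change_param t t' w)) = cmap c (param t w).
  by rewrite -psik; have [_ _ _ ->] := nbhs_singleton HE' dk.
have dH : differentiable (H \o @cyl R n) w.
  by apply: differentiable_comp; [exact: differentiable_cyl|exact: (CH 1%N).1].
have cH : {for w, continuous (H \o @cyl R n)} by exact: differentiable_continuous.
have n3 : nbhs w [set w' | U3 (H (cyl w'))].
  by apply: cH; rewrite /= Hw; exact: open_nbhs_nbhs.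
have nk : \forall w' \near w, cyl_point (angle w') (rsubmx (K' (H (cyl w')))) = change_param t t' w'.
  have n35 : nbhs w [set w' | U3 (H (cyl w')) /\ tbase t' (ang (angle w'))].
    by apply: filterS2 n3 (near_tbase Ht' tw') => w'; split.
  apply: filterS3 n35 HE (near_open_disc ow) => w' /= [h1 h2'] h2 h3.
  have [q1 q2 q3 q4] := h2 (open_disc_disc h3).
  rewrite q4 in h1 *; rewrite KE'//.
  by rewrite (param_p Ht)//; exact: open_disc_disc.
have dk0 : differentiable (fun w' => cyl_point (angle w') (rsubmx (K' (H (cyl w'))))) w.
  apply: differentiable_cyl_point; first exact: differentiable_angle.
  apply: (@differentiable_comp _ _ _ _ (fun w' => K' (H (cyl w'))) (rsubmx : 'rV[R]_(2 + n) -> 'rV[R]_n)).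
    apply: (@differentiable_comp _ _ _ _ (H \o @cyl R n) K'); first exact: dH.
    by apply: (CK' 1%N).1; rewrite /= Hw.
  exact: differentiable_rsubmx.
have dkap : differentiable (change_param t t') w by exact: (near_eq_differentiable nk dk0).
split; first exact: dkap.
(* An extension of the reverse change of trivialization; it needs to undo [change_param] only at
   points coming from the open disc. *)
pose k2 (z : 'rV[R]_(1 + n)) := cyl_point (angle z) (rsubmx (K (H' (cyl z)))).
have dk2 : differentiable k2 (change_param t t' w).
  apply: differentiable_cyl_point; first exact: differentiable_angle.
  apply: (@differentiable_comp _ _ _ _ (fun w' => K (H' (cyl w'))) (rsubmx : 'rV[R]_(2 + n) -> 'rV[R]_n)).
    apply: (@differentiable_comp _ _ _ _ (H' \o @cyl R n) K).
      by apply: differentiable_comp; [exact: differentiable_cyl|exact: (CH' 1%N).1].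
    by apply: (CK 1%N).1; rewrite /= Hw'.
  exact: differentiable_rsubmx.
have ckap : {for w, continuous (change_param t t')} by exact: differentiable_continuous.
have n4 : nbhs w [set w' | disc R n (rsubmx (change_param t t' w')) ->
    [/\ U4 (cyl (change_param t t' w')), cdom c (param t' (change_param t t' w')),
      tbase t' (ang (angle (change_param t t' w'))) & H' (cyl (change_param t t' w')) = cmap c (param t' (change_param t t' w'))]].
  exact: (ckap _ HE').
have n1 : nbhs w [set w' | U1 (H (cyl w'))].
  by apply: cH; rewrite /= Hw; exact: open_nbhs_nbhs.
have n145 : nbhs w [set w' | [/\ U1 (H (cyl w')), (disc R n (rsubmx (change_param t t' w')) ->
    [/\ U4 (cyl (change_param t t' w')), cdom c (param t' (change_param t t' w')),
      tbase t' (ang (angle (change_param t t' w'))) & H' (cyl (change_param t t' w')) = cmap c (param t' (change_param t t' w'))]) &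
    tbase t' (ang (angle w'))]].
  by apply: filterS3 n1 n4 (near_tbase Ht' tw') => w'; split.
have nid : \forall w' \near w, (k2 \o change_param t t') w' = w' *m 1%:M + 0.
  apply: filterS3 n145 HE (near_open_disc ow) => w' /= [h1 h4 h2'] h2 h3.
  have dw' := open_disc_disc h3.
  have [q1 q2 q3 q4] := h2 dw'.
  have [r1 r2] := kapP Ht Ht' q3 h2' dw'.
  have [_ _ _ s4] := h4 r1; rewrite r2 in s4.
  rewrite mulmx1 addr0 /k2 s4 angle_change_param KE//; last by rewrite -q4.
    by rewrite (tmap_param Ht)// /cyl row_mxKr cyl_point_eta.
  by rewrite (param_p Ht).
have dcomp : differentiable (k2 \o change_param t t') w by exact: differentiable_comp.
have e1 := near_eq_jacobian dcomp nid.
have e2 := jacobian_comp dkap dk2.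
have e3 := jacobian_linear 1%:M (0 : 'rV[R]_(1 + n)) w.
have JJ : 'J (change_param t t') w *m 'J k2 (change_param t t' w) = 1%:M.
  exact: (etrans (esym e2) (etrans e1 e3)).
exact: (mulmx1_unit JJ).1.
Qed.

(* If an interior point went to a point [y] of the boundary sphere, the linear
   form [<_, y>] of the fibre coordinate would be maximal there, contradicting
   the invertibility of the derivative. *)
Lemma change_param_open_disc t t' w : is_trivialization p t -> is_trivialization p t' ->
  tbase t (ang (angle w)) -> tbase t' (ang (angle w)) -> open_disc R n (rsubmx w) ->
  open_disc R n (rsubmx (change_param t t' w)).
Proof.
move=> Ht Ht' tw tw' ow; have dw := open_disc_disc ow.
have [dkap uJ] := change_param_regular Ht Ht' tw tw' ow.
have [dk _] := kapP Ht Ht' tw tw' dw.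
apply/negPn/negP => nok.
set y := rsubmx (change_param t t' w) in dk nok.
have y1 : inner 1%:M y y = 1.
  apply/eqP; rewrite eq_le; apply/andP; split; first exact: dk.
  rewrite leNgt; exact: nok.
pose v : 'rV[R]_(1 + n) := row_mx 0 y.
have qE w' : (change_param t t' w' *m v^T) 0 0 = inner 1%:M (rsubmx (change_param t t' w')) y.
  rewrite -[X in X *m _]hsubmxK /v tr_row_mx mul_row_col trmx0 mulmx0 add0r.
  by rewrite /inner mulmx1.
have [dq dqE] := @diff_form R n v (change_param t t') w (v *m invmx ('J (change_param t t') w)) dkap.
have mq : \forall w' \near w, (change_param t t' w' *m v^T) 0 0 <= (change_param t t' w *m v^T) 0 0.
  apply: filterS3 (near_tbase Ht tw) (near_tbase Ht' tw') (near_open_disc ow) => w' h1 h2 h3; rewrite !qE -/y y1; apply: disc_inner_le1 => //.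
  by have [] := kapP Ht Ht' h1 h2 (open_disc_disc h3).
have := local_max_diff (v *m invmx ('J (change_param t t') w)) dq mq.
rewrite dqE mulmxKV//.
have vv : (v *m v^T) 0 0 = 1.
  rewrite /v tr_row_mx mul_row_col trmx0 mulmx0 add0r.
  by move: y1; rewrite /inner mulmx1.
move=> v0; have := etrans (esym vv) v0.
by apply/eqP; rewrite oner_neq0.
Qed.

(** The angle is preserved, so the Jacobian is block triangular with corner [1], and its other
    diagonal block is the Jacobian of the fibre transition. *)
Lemma change_param_jacobian t t' s (x : 'rV[R]_n) :
  is_trivialization p t -> is_trivialization p t' ->
  tbase t (ang s) -> tbase t' (ang s) -> open_disc R n x ->
  \det ('J (change_param t t') (cyl_point s x)) = \det ('J (fibre_transition t t' (ang s)) x).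
Proof.
move=> Ht Ht' tw tw' ow.
have [dkap _] : differentiable (change_param t t') (cyl_point s x) /\ 'J (change_param t t') (cyl_point s x) \in unitmx.
  by apply: change_param_regular; rewrite ?angle_cyl_point ?rsubmx_cyl_point.
pose i2 : 'M[R]_(n, 1 + n) := row_mx 0 1%:M.
pose r2 : 'M[R]_(1 + n, n) := col_mx 0 1%:M.
pose l2 : 'M[R]_(1 + n, 1) := col_mx 1%:M 0.
have mkE (y : 'rV[R]_n) : cyl_point s y = y *m i2 + cyl_point s 0.
  by rewrite /cyl_point mul_mx_row mulmx0 mulmx1 add_row_mx add0r addr0.
have rE (z : 'rV[R]_(1 + n)) : rsubmx z = z *m r2 + 0.
  by rewrite -[in RHS](hsubmxK z) mul_row_col mulmx0 mulmx1 add0r addr0.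
have lE (z : 'rV[R]_(1 + n)) : lsubmx z = z *m l2 + 0.
  by rewrite -[in RHS](hsubmxK z) mul_row_col mulmx0 mulmx1 !addr0.
have phiE : fibre_transition t t' (ang s) =
    (fun z => z *m r2 + 0) \o (change_param t t' \o (fun y => y *m i2 + cyl_point s 0)).
  apply/funext => y /=; rewrite -mkE -rE rsubmx_cyl_point.
  by rewrite /fibre_transition /param cyl_cyl_point.
have d1 := differentiable_linear i2 (cyl_point s 0) x.
have dkap' : differentiable (change_param t t') (x *m i2 + cyl_point s 0) by rewrite -mkE.
have d2 : differentiable (change_param t t' \o (fun y => y *m i2 + cyl_point s 0)) x.
  exact: differentiable_comp.
have e1 := jacobian_comp d1 dkap'.
have e2 := jacobian_comp d2 (differentiable_linear r2 0 _).
rewrite jacobian_linear e1 jacobian_linear in e2.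
rewrite -mkE -phiE in e2.
(* Differentiating this identity determines the first column of the Jacobian. *)
have lk : (fun z => z *m l2 + 0) \o change_param t t' = (fun z => z *m l2 + 0).
  apply/funext => w; rewrite /= -!lE; apply/rowP => i.
  by rewrite [LHS]mxE [RHS]mxE (ord1 i); exact: angle_change_param.
have e3 := jacobian_comp dkap (differentiable_linear l2 0 _).
rewrite lk !jacobian_linear in e3.
rewrite e2; move: ('J (change_param t t') (cyl_point s x)) e3 => J e3.
rewrite -[J]submxK mul_block_col !mulmx1 !mulmx0 !addr0 in e3.
have [u1 d0] := eq_col_mx e3.
rewrite -[J]submxK -u1 -d0 det_ublock det1 mul1r.
by rewrite mul_row_block !mul0mx !mul1mx !add0r mul_row_col mulmx0 mulmx1 add0r.
Qed.

Lemma gt0_factorl (a b c : R) : a = b * c -> 0 < a -> 0 < c -> 0 < b.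
Proof. by move=> -> bc c0; rewrite pmulr_lgt0 in bc. Qed.

(** The developing map in the coordinates of [t] is the one of [t'] composed with the change of
    parameters, so determinants multiply and the remaining factor must be positive. *)
Lemma transition_positive t t' s (x : 'rV[R]_n) :
  is_trivialization p t -> is_trivialization p t' -> itvo 0 (pi *+ 3) s ->
  tbase t (ang s) -> tbase t' (ang s) -> open_disc R n x ->
  (forall w, good t w -> 0 < \det ('J (dev_param F t) w)) ->
  (forall w, good t' w -> 0 < \det ('J (dev_param F t') w)) ->
  0 < \det ('J (fibre_transition t t' (ang s)) x).
Proof.
move=> Ht Ht' Is tw tw' ow P P'.
rewrite -(change_param_jacobian Ht Ht')//.
set w := cyl_point s x.
have hw : angle w = s by exact: angle_cyl_point.
have rw : rsubmx w = x by exact: rsubmx_cyl_point.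
rewrite -hw in Is tw tw'; rewrite -rw in ow.
have Gw : good t w by [].
have Gk : good t' (change_param t t' w).
  by split; rewrite ?angle_change_param//; exact: change_param_open_disc.
have [dkap _] := change_param_regular Ht Ht' tw tw' ow.
have [dmu' _ _] := dev_param_regular dF Ht' Gk.
have nm : \forall w' \near w, (dev_param F t' \o change_param t t') w' = dev_param F t w'.
  apply: filterS3 (near_tbase Ht tw) (near_tbase Ht' tw') (near_open_disc ow) => w' h1 h2 h3; rewrite /= /dev_param angle_change_param.
  by have [_ ->] := kapP Ht Ht' h1 h2 (open_disc_disc h3).
have dc : differentiable (dev_param F t' \o change_param t t') w by exact: differentiable_comp.
have e1 := near_eq_jacobian dc nm.
have e2 := jacobian_comp dkap dmu'.
have e3 : \det ('J (dev_param F t) w) = \det ('J (change_param t t') w) * \det ('J (dev_param F t') (change_param t t' w)).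
  have e4 := congr1 (fun A : 'M[R]_n.+1 => \det A) (etrans (esym e1) e2).
  exact: (etrans e4 (det_mulmx _ _)).
exact: (gt0_factorl e3 (P w Gw) (P' _ Gk)).
Qed.

End Transition.

(** * Choosing trivializations compatible with the developing map *)

Section Flip.
Context {R : realType} {n : nat} {E : smooth_manifold R n}.
Variables (g : riemannian_metric E) (p : E -> 'rV[R]_2).
Hypotheses (Hp : is_disc_bundle n p).
Implicit Types (t : trivialization n E) (w : 'rV[R]_(1 + n)).

Lemma smooth_on_sub (V W : normedModType R) (A B : set V) (f : V -> W) :
  B `<=` A -> smooth_on A f -> smooth_on B f.
Proof.
move=> BA sf x /BA Ax; have [U [G [oU Ux CG GE]]] := sf x Ax.
by exists U, G; split=> // y /BA; exact: GE.
Qed.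

Definition restrict_triv (N : set 'rV[R]_2) t : trivialization n E :=
  Trivialization (N `&` tbase t) (tmap t) (tinv t).

Lemma restrict_trivP N t : open N -> is_trivialization p t ->
  is_trivialization p (restrict_triv N t).
Proof.
move=> oN [ot h1 h2 h3 [h4 h5]].
have sub : tprod (restrict_triv N t) `<=` tprod t by move=> z [[_ tz] cz dz]; split.
split.
- exact: openI.
- by move=> e [Ne te]; have [[q1 q2 q3] q4 q5] := h1 e te; split=> //; split=> //; rewrite /= q4.
- by move=> z /sub /h2.
- move=> c Ac; apply: smooth_on_sub (h3 c Ac).
  by move=> x [e [[Ne te] ce] <-]; exists e.
- split; first exact: continuous_subspaceW sub h4.
  move=> c Ac; apply: smooth_on_sub (h5 c Ac).
  by move=> z [/sub zt zc].
Qed.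

Section FlipBy.
Variable M : 'M[R]_n.
Hypotheses (MM : M *m M = 1%:M) (MT : M *m M^T = 1%:M) (dM : \det M = -1).

Let B : 'M[R]_(2 + n) := block_mx 1%:M 0 0 M.
Let B1 : 'M[R]_(1 + n) := block_mx 1%:M 0 0 M.

Lemma mulB (a : nat) (x : 'rV[R]_a) (y : 'rV[R]_n) :
  row_mx x y *m block_mx 1%:M 0 0 M = row_mx x (y *m M).
Proof. by rewrite mul_row_block mulmx1 !mulmx0 addr0 add0r. Qed.

Lemma lsubmx_mulB (a : nat) (z : 'rV[R]_(a + n)) :
  lsubmx (z *m block_mx 1%:M 0 0 M) = lsubmx z.
Proof. by rewrite -[z]hsubmxK mulB !row_mxKl. Qed.

Lemma rsubmx_mulB (a : nat) (z : 'rV[R]_(a + n)) :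
  rsubmx (z *m block_mx 1%:M 0 0 M) = rsubmx z *m M.
Proof. by rewrite -[z]hsubmxK mulB !row_mxKr. Qed.

Lemma mulBB (a : nat) (z : 'rV[R]_(a + n)) :
  z *m block_mx 1%:M 0 0 M *m block_mx 1%:M 0 0 M = z.
Proof. by rewrite -[z]hsubmxK !mulB -mulmxA MM mulmx1. Qed.

Lemma inner_mulM (x : 'rV[R]_n) : inner 1%:M (x *m M) (x *m M) = inner 1%:M x x.
Proof. by rewrite /inner !mulmx1 trmx_mul mulmxA -(mulmxA x) MT mulmx1. Qed.

(** [M] is an involution, so one matrix [B] serves both for the map and for its inverse; being
    orthogonal, it preserves the disc. *)
Definition flip_triv t : trivialization n E :=
  Trivialization (tbase t) (fun e => tmap t e *m B) (fun z => tinv t (z *m B)).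

Lemma flip_tprod t z : tprod (flip_triv t) z <-> tprod t (z *m B).
Proof.
by rewrite /tprod /= lsubmx_mulB rsubmx_mulB /disc /= inner_mulM.
Qed.

Lemma flip_trivP t : is_trivialization p t -> is_trivialization p (flip_triv t).
Proof.
move=> [ot h1 h2 h3 [h4 h5]]; split=> //.
- move=> e te; have [q1 q2 q3] := h1 e te.
  split; first by apply/flip_tprod; rewrite /= mulBB.
    by rewrite /= lsubmx_mulB.
  by rewrite /= mulBB.
- move=> z /flip_tprod zt; have [q1 q2] := h2 _ zt.
  by split; rewrite /=; [rewrite q1 lsubmx_mulB|rewrite q2 mulBB].
- move=> c Ac x xA; have [U [G [oU Ux CG GE]]] := h3 c Ac x xA.
  exists U, (mulmxr B \o G); split=> //.
    by move=> k; apply: Ck_lin => //; exact: mulmxr_continuous.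
  by move=> y yA Uy; rewrite /= GE.
- split.
    apply/subspace_continuousP => z zt N Nz.
    have zt' := (flip_tprod t z).1 zt.
    have m1 : nbhs (z *m B) [set y | tprod t y -> N (tinv t y)].
      exact: (subspace_continuousP _ _).1 h4 _ zt' _ Nz.
    have m2 : nbhs z [set y | tprod t (y *m B) -> N (tinv t (y *m B))].
      exact: (mulmxr_continuous m1).
    have m3 : nbhs z [set y | tprod (flip_triv t) y -> N (tinv (flip_triv t) y)].
      by apply: filterS m2 => y h /flip_tprod; exact: h.
    exact: m3.
  move=> c Ac z [zt zc].
  have [|U [G [oU Uz CG GE]]] := h5 c Ac (z *m B).
    by split=> //; exact: (flip_tprod t z).1 zt.
  exists (mulmxr B @^-1` U), (G \o mulmxr B); split=> //.
  + by apply: open_comp => // y _; exact: mulmxr_continuous.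
  + by move=> k; apply: Ck_prelin => //; exact: mulmxr_continuous.
  + move=> y [yt yc] Uy; rewrite /= GE//.
    by split=> //; exact: (flip_tprod t y).1 yt.
Qed.

Lemma param_flip t w : param (flip_triv t) w = param t (w *m B1).
Proof.
rewrite /param /=; congr tinv; rewrite /cyl mulB rsubmx_mulB; congr (row_mx (ang _) _).
by rewrite /angle -[in RHS](hsubmxK w) mulB row_mxEl mxE.
Qed.

Lemma angle_mulB w : angle (w *m B1) = angle w.
Proof. by rewrite /angle -[in LHS](hsubmxK w) mulB row_mxEl mxE. Qed.

Lemma good_flip t w : good (flip_triv t) w -> good t (w *m B1).
Proof.
move=> [h1 h2 h3]; split; rewrite ?angle_mulB//.
by rewrite rsubmx_mulB /open_disc /= inner_mulM.
Qed.

Variable F : R -> E -> 'rV[R]_n.+1.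
Hypotheses (dF : forall s, itvo 0 (pi *+ 3) s -> develops g p s F).

Lemma det_flip t w : is_trivialization p t -> good (flip_triv t) w ->
  \det ('J (dev_param F (flip_triv t)) w) = - \det ('J (dev_param F t) (w *m B1)).
Proof.
move=> Ht /good_flip Gw; have [dmu _ _] := dev_param_regular dF Ht Gw.
have muE : dev_param F (flip_triv t) = dev_param F t \o (fun y => y *m B1 + 0).
  by apply/funext => y; rewrite /= addr0 /dev_param param_flip angle_mulB.
have d1 := differentiable_linear B1 0 w.
rewrite -[w *m B1]addr0 in dmu.
have e := jacobian_comp d1 dmu.
rewrite jacobian_linear -muE addr0 in e.
have e4 := congr1 (fun A : 'M[R]_n.+1 => \det A) e.
have dB : \det B1 = -1 by rewrite /B1 det_ublock det1 mul1r.
have e5 : \det (B1 *m 'J (dev_param F t) (w *m B1)) = - \det ('J (dev_param F t) (w *m B1)).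
  by rewrite [LHS]det_mulmx dB mulN1r.
exact: (etrans e4 e5).
Qed.

End FlipBy.

Variables (F : R -> E -> 'rV[R]_n.+1) (h : @iso_grp R n).
Hypotheses (dF : forall s, itvo 0 (pi *+ 3) s -> develops g p s F)
  (hP : forall s e, itvo 0 pi s -> p e = ang s -> F (s + pi *+ 2) e = iso_act h (F s e))
  (dh : \det h.1 = 1).

Lemma good_shift t w : itvo 0 pi (angle w) -> good t w -> good t (w + cyl_point (pi *+ 2) 0).
Proof.
move=> /andP[w0 wpi] [h1 h2 h3].
have hE : angle (w + cyl_point (pi *+ 2) 0) = angle w + pi *+ 2.
  by rewrite -[X in _ = _ + X](angle_cyl_point (pi *+ 2) (0 : 'rV[R]_n)) /angle !mxE.
have rE : rsubmx (w + cyl_point (pi *+ 2) 0) = rsubmx w.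
  by rewrite linearD /= rsubmx_cyl_point addr0.
split; rewrite ?hE ?rE ?angD2pi//.
have pi0 := pi_gt0 R.
by apply/andP; rewrite !mulrS !mulr0n; split; lra.
Qed.

(** Translation by [2 pi] composes the developing map with the holonomy, whose linear part has
    determinant [1]. This makes the sign well defined on [E] although the developing map is
    multivalued. *)
Lemma det_shift t w : is_trivialization p t -> itvo 0 pi (angle w) -> good t w ->
  \det ('J (dev_param F t) (w + cyl_point (pi *+ 2) 0)) = \det ('J (dev_param F t) w).
Proof.
move=> Ht Iw Gw; have [dmu _ _] := dev_param_regular dF Ht Gw.
have Gs := good_shift Iw Gw.
have [dmus _ _] := dev_param_regular dF Ht Gs.
pose c : 'rV[R]_(1 + n) := cyl_point (pi *+ 2) 0.
have d1 := differentiable_linear (1%:M : 'M[R]_(1 + n)) c w.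
have wE : w *m 1%:M + c = w + cyl_point (pi *+ 2) 0 by rewrite mulmx1.
rewrite -wE in dmus.
have e := jacobian_comp d1 dmus.
rewrite jacobian_linear mul1mx wE in e.
have hE y : angle (y + c) = angle y + pi *+ 2.
  by rewrite -[X in _ = _ + X](angle_cyl_point (pi *+ 2) (0 : 'rV[R]_n)) /angle !mxE.
have rE y : rsubmx (y + c) = rsubmx y by rewrite linearD /= rsubmx_cyl_point addr0.
have [_ w2 w3] := Gw.
have n1 : nbhs w [set y | itvo 0 pi (angle y)] by exact: continuous_angle _ _ (itvo_near Iw).
have nm : \forall y \near w, dev_param F t y *m h.1 + h.2 = (dev_param F t \o (fun y => y *m 1%:M + c)) y.
  apply: filterS3 n1 (near_tbase Ht w2) (near_open_disc w3) => y y1 y2 y3.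
  rewrite /= mulmx1 /dev_param hE.
  have -> : param t (y + c) = param t y by rewrite /param /cyl hE rE angD2pi.
  have pE : p (param t y) = ang (angle y) by exact: (param_p Ht y2 (open_disc_disc y3)).
  exact: (esym (hP y1 pE)).
have da : differentiable (fun y => dev_param F t y *m h.1 + h.2) w.
  by apply: differentiableD; [exact: differentiable_mulmx_cst|exact: differentiable_cst].
have e1 := near_eq_jacobian da nm.
have e2 := jacobian_affine h.1 h.2 dmu.
have e3 := etrans (esym e) (etrans (esym e1) e2).
have e4 := congr1 (fun A : 'M[R]_n.+1 => \det A) e3.
have e5 : \det ('J (dev_param F t) w *m h.1) = \det ('J (dev_param F t) w).
  by rewrite [LHS]det_mulmx dh mulr1.
exact: (etrans e4 e5).
Qed.

Lemma det_periodic t w w' : is_trivialization p t -> good t w -> good t w' ->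
  rsubmx w = rsubmx w' -> ang (angle w) = ang (angle w') ->
  \det ('J (dev_param F t) w) = \det ('J (dev_param F t) w').
Proof.
move=> Ht.
have pi0 := pi_gt0 R.
have p2 : pi *+ 2 = pi + pi :> R by rewrite mulr2n.
have p3 : pi *+ 3 = pi + pi + pi :> R by rewrite !mulrS mulr0n addr0 addrA.
have p4 : pi *+ 4 = pi + pi + pi + pi :> R by rewrite !mulrS mulr0n addr0 !addrA.
have sh z z' : good t z -> good t z' -> rsubmx z = rsubmx z' -> angle z' = angle z + pi *+ 2 ->
    \det ('J (dev_param F t) z) = \det ('J (dev_param F t) z').
  move=> Gz Gz' rzz hzz; have [/andP[a1 a2] _ _] := Gz; have [/andP[b1 b2] _ _] := Gz'.
  have -> : z' = z + cyl_point (pi *+ 2) 0.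
    rewrite -[LHS]cyl_point_eta hzz -rzz -[z in RHS]cyl_point_eta /cyl_point add_row_mx addr0.
    by congr row_mx; rewrite raddfD.
  have Iz : itvo 0 pi (angle z).
    by apply/andP; split=> //; rewrite hzz p2 p3 in b2; lra.
  exact: (esym (det_shift Ht Iz Gz)).
move=> Gw Gw' rE hE; have [/andP[a1 a2] _ _] := Gw; have [/andP[b1 b2] _ _] := Gw'.
case: (ang_eq hE) => [|D|D|D].
- by rewrite ltr_norml p4; rewrite p3 in a2 b2; apply/andP; split; lra.
- by rewrite -[w]cyl_point_eta D rE cyl_point_eta.
- exact: (esym (sh w' w Gw' Gw (esym rE) D)).
- exact: (sh w w' Gw Gw' rE D).
Qed.

Lemma oppr_gt0_ngt0 (a b : R) : a = - b -> b != 0 -> (0 < b) = false -> 0 < a.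
Proof. by move=> -> b0 bn; rewrite oppr_gt0 lt_neqAle b0 leNgt bn. Qed.

(** The sign of the determinant is constant on a convex slab around [s0]. If it is negative there,
    reversing the fibre with the reflection [M] makes it positive. *)
Lemma positive_triv (M : 'M[R]_n) s0 : M *m M = 1%:M -> M *m M^T = 1%:M -> \det M = -1 ->
  itvo 0 (pi *+ 3) s0 ->
  exists t, [/\ is_trivialization p t, tbase t (ang s0) &
    forall w, good t w -> 0 < \det ('J (dev_param F t) w)].
Proof.
move=> MM MT dM Is0.
have [t [Ht ts]] := triv_at Hp s0.
have [ot _ _ _ _] := Ht.
have nt : nbhs s0 [set s | tbase t (ang s)] by apply: continuous_ang; exact: open_nbhs_nbhs.
have /nbhs_ballP[d /= d0 Hd] : nbhs s0 [set s | tbase t (ang s) /\ itvo 0 (pi *+ 3) s].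
  by apply: filterS2 nt (itvo_near Is0) => s; split.
have [N [l [oN Ns ls lP]]] := ang_lift s0 d0.
have HG w : open_slab s0 d w -> good t w.
  move=> [w1 w2]; have [|q1 q2] := Hd (angle w); first by rewrite -ball_normE /= distrC.
  by split.
pose t1 := restrict_triv N t.
have Ht1 : is_trivialization p t1 by exact: restrict_trivP.
have t1s : tbase t1 (ang s0) by split.
(* The angle of [w] may be far from [s0] by a full turn although its base point is close;
   periodicity of the determinant moves it into the slab. *)
have key w : good t1 w -> exists2 w', open_slab s0 d w' &
    \det ('J (dev_param F t) w) = \det ('J (dev_param F t) w').
  move=> [w1 [w2 w2'] w3]; have [_ lb lE] := lP _ w2.
  have lE' := lE (ang_circle _).
  exists (cyl_point (l (ang (angle w))) (rsubmx w)).
    by split; rewrite ?angle_cyl_point ?rsubmx_cyl_point.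
  apply: det_periodic => //.
  - by apply: HG; split; rewrite ?angle_cyl_point ?rsubmx_cyl_point.
  - by rewrite rsubmx_cyl_point.
  - by rewrite angle_cyl_point lE'.
pose w0 : 'rV[R]_(1 + n) := cyl_point s0 0.
have K0 : open_slab s0 d w0.
  split; first by rewrite angle_cyl_point subrr normr0.
  by rewrite rsubmx_cyl_point /open_disc /= inner1E big1 ?ltr01// => i _; rewrite mxE mul0r.
have [D DE] : exists D : 'rV[R]_(1 + n) -> R, forall w, D w = \det ('J (dev_param F t) w).
  by exists (fun w => \det ('J (dev_param F t) w)).
have DK w : good t1 w -> (0 < D w) = (0 < D w0).
  move=> Gw; have [w' Kw' E'] := key w Gw.
  have q := det_sign_const dF Ht HG Kw' K0.
  have e1 := congr1 (fun x : R => 0 < x) (etrans (DE w) E').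
  exact: (etrans e1 (etrans q (esym (congr1 (fun x : R => 0 < x) (DE w0))))).
have [pos|neg] := boolP (0 < D w0).
  exists t1; split; [exact: Ht1|exact: t1s|move=> w Gw].
  have Dw : 0 < D w by rewrite DK.
  exact: (eq_ind _ (fun x : R => 0 < x) Dw _ (DE w)).
exists (flip_triv M t1); split; [exact: flip_trivP|exact: t1s|move=> w Gw].
have Gw1 := good_flip MT Gw.
have e := det_flip MT dM dF Ht1 Gw.
have [_ nz _] := dev_param_regular dF Ht1 Gw1.
have Dneg := DK _ Gw1; rewrite (negbTE neg) in Dneg.
exact: (oppr_gt0_ngt0 (etrans e (congr1 -%R (esym (DE _)))) (eq_ind _ (fun x : R => x != 0) nz _ (esym (DE _))) Dneg).
Qed.

End Flip.

Section Final.
Context {R : realType} {n : nat} {E : smooth_manifold R n}.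
Variables (g : riemannian_metric E) (p : E -> 'rV[R]_2).
Hypotheses (Hp : is_disc_bundle n p).

Lemma reflection_exists k : exists M : 'M[R]_k.+1,
  [/\ M *m M = 1%:M, M *m M^T = 1%:M & \det M = -1].
Proof.
pose d : 'rV[R]_k.+1 := \row_i (if i == 0 then -1 else 1).
have dd : diag_mx d *m diag_mx d = 1%:M.
  rewrite mulmx_diag -diag_const_mx; congr diag_mx; apply/rowP => i.
  by rewrite !mxE; case: (i == 0); rewrite ?mulrNN mulr1.
exists (diag_mx d); split; rewrite ?tr_diag_mx//.
rewrite det_diag big_ord_recl mxE eqxx big1 ?mulr1// => i _.
by rewrite mxE.
Qed.

Lemma orientable_of_det (F : R -> E -> 'rV[R]_n.+1) (h : @iso_grp R n) :
  (forall s, itvo 0 (pi *+ 3) s -> develops g p s F) ->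
  (forall s e, itvo 0 pi s -> p e = ang s -> F (s + pi *+ 2) e = iso_act h (F s e)) ->
  \det h.1 = 1 -> orientable_disc_bundle n p.
Proof.
move=> dF hP dh; have pi0 := pi_gt0 R.
have lift b : circle R b -> exists2 s, itvo 0 (pi *+ 3) s & ang s = b.
  move=> /ang_surj[s /andP[s0 s2] sE]; exists s => //; apply/andP; split=> //.
  by apply: le_lt_trans s2 _; rewrite !mulrS mulr0n; lra.
(* In dimension zero there is no reflection, but the empty determinant is [1], so all
   trivializations together form an oriented atlas. *)
have [n0|npos] := posnP n.
  exists [set t | is_trivialization p t]; split=> //.
    by move=> b cb; have [_ _ H] := Hp; have [t [Ht tb]] := H b cb; exists t.
  move=> t t' b x _ _ _ _ _ _.
  have det0 k (A : 'M[R]_k) : k = 0%N -> 0 < \det A.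
    by move=> k0; move: A; rewrite k0 => A; rewrite det_mx00.
  exact: (det0 _ _ n0).
have [M [MM MT dM]] : exists M : 'M[R]_n, [/\ M *m M = 1%:M, M *m M^T = 1%:M & \det M = -1].
  by move: npos; case: (n) => // k _; exact: reflection_exists.
exists [set t | is_trivialization p t /\ forall w, good t w -> 0 < \det ('J (dev_param F t) w)].
split; first by move=> t [].
  move=> b /lift[s Is <-].
  by have [t [Ht ts P]] := positive_triv Hp dF hP dh MM MT dM Is; exists t.
move=> t t' b x [Ht P] [Ht' P'] tb tb' /lift[s Is sE] ox.
rewrite -sE in tb tb' *.
exact: (transition_positive dF Ht Ht' Is tb tb' ox P P').
Qed.

End Final.

Theorem theorem1 (R : realType) (n : nat) (E : smooth_manifold R n)
    (p : E -> 'rV[R]_2) (g : riemannian_metric E) :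
  is_disc_bundle n p -> ~ orientable_disc_bundle n p -> locally_flat g ->
  exists F : foliation E, minimal_leaves g F.
Proof.
move=> Hp No Hg; have [F [h [ah dF hP]]] := developing_map Hp Hg.
have [dh|dh] := eqVneq (\det h.1) 1.
  by case: No; exact: (orientable_of_det Hp dF hP dh).
have [v v0 vE] := orthogonal_eigenvector ah dh.
exact: (hyperplane_foliation Hp dF hP v0 vE).
Qed.
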